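(* Let $G=(V,E,J)$ be an infinite, simple, unimodular transitive weighted graph, let $o$ be a vertex of $G$, and suppose that there exist constants $1/2 < a < 1$, $c>0$, and $\varepsilon_0>0$ such that $|\{ e\in E^\rightarrow_o : J_e \geq \varepsilon\}| \geq c\, \varepsilon^{-a}$ for every $0<\varepsilon \leq \varepsilon_0$. Then $\beta_c < \infty$ and there exists a constant $C$ such that \[ \mathbf{P}_{\beta}(|K_o| \geq n) \leq C n^{-(2a-1)/(a+1)} \] for every $0\leq \beta \leq \beta_c$ and $n\geq 1$. In particular, there are almost surely no infinite clusters at the critical parameter $\beta_c$.
   Context: A weighted graph $G=(V,E,J)$ is a countable graph $(V,E)$ together with positive weights $\{J_e:e\in E\}$ such that $\sum_{e\in E^\rightarrow_v}J_e<\infty$ for each $v\in V$, where $E^\rightarrow_v$ denotes the set of oriented edges emanating from $v$ (identified with the corresponding unoriented edges when convenient). Vertices may have infinite degree. $G$ is simple if there is at most one edge between any two vertices. An automorphism of $G$ is a graph automorphism preserving the weights; $\mathrm{Aut}(G)$ is the group of these, and $G$ is transitive if for every two vertices there is an automorphism sending one to the other. A transitive weighted graph is unimodular if $\mathrm{Aut}(G)$ satisfies the mass-transport principle: $\sum_{v\in V}F(o,v)=\sum_{v\in V}F(v,o)$ for every $o \in V$ and every $F:V^2\to[0,\infty]$ with $F(\gamma u,\gamma v)=F(u,v)$ for all $u,v\in V$, $\gamma\in\mathrm{Aut}(G)$. For $\beta\ge 0$, $\mathbf{P}_\beta$ is the law of Bernoulli-$\beta$ bond percolation on $G$, in which each edge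 $e$ is retained independently with probability $1-e^{-\beta J_e}$ and otherwise deleted. Clusters are the connected components of the resulting random subgraph; $K_o$ is the cluster of $o$ and $|K_o|$ its number of vertices. The critical parameter is $\beta_c=\sup\{\beta\ge0:\mathbf{P}_\beta\text{ is supported on configurations with no infinite clusters}\}$. *)

(* Defs.v *)
From HB Require Import structures.
From mathcomp Require Import all_boot all_order all_algebra.
From mathcomp Require Import all_classical all_reals all_analysis.
From mathcomp Require Import lra.

Set Implicit Arguments.
Unset Strict Implicit.
Unset Printing Implicit Defensive.
Import Order.TTheory GRing.Theory Num.Theory.
Import numFieldNormedType.Exports.

Local Open Scope classical_set_scope.
Local Open Scope ring_scope.

Definition coordinate_events (E : Type) : set (set (E -> bool)) :=
  range (fun e : E => [set w : E -> bool | w e]).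

Arguments coordinate_events : clear implicits.

Notation configuration E := (g_sigma_algebraType (coordinate_events E)).

Definition cylinder (E : eqType) (s : seq E) (b : E -> bool) :
    set (configuration E) :=
  [set w | forall e, e \in s -> w e = b e].

(* The coordinates are independent, the one at [e] being [true] with probability
   [p e]. *)
Definition is_bernoulli_product (R : realType) (E : countType) (p : E -> R)
    (P : probability (configuration E) R) : Prop :=
  forall (s : seq E) (b : E -> bool), uniq s ->
    P (cylinder s b) = (\prod_(e <- s) (if b e then p e else 1 - p e))%:E.

Section existence.
Context {R : realType}.
Implicit Types (q : nat -> R) (x : R) (b : nat -> bool) (D : pred nat).

(* Reads off independent bits of parameters q 0, q 1, ... from a single
   uniform variable x in [0, 1[ by iterated rescaling. *)
Fixpoint bits q x (n : nat) : bool :=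
  if n is m.+1 then
    bits (fun k => q k.+1)
         (if x < q 0%N then x / q 0%N else (x - q 0%N) / (1 - q 0%N)) m
  else x < q 0%N.

Let f q b k : R := if b k then q k else 1 - q k.

Let f01 q b k : (forall k, 0 <= q k <= 1) -> 0 <= f q b k <= 1.
Proof. by move=> /(_ k); rewrite /f; case: (b k) => /andP[? ?]; lra. Qed.

Lemma bits_interval n q b : (forall k, 0 <= q k <= 1) ->
  exists2 l, 0 <= l /\ l + \prod_(0 <= k < n) f q b k <= 1 &
    forall x, 0 <= x < 1 ->
      ((forall k, (k < n)%N -> bits q x k = b k) <->
       l <= x < l + \prod_(0 <= k < n) f q b k).
Proof.
elim: n q b => [|n IHn] q b q01.
  exists 0; first by rewrite big_geq// lexx add0r lexx.
  by move=> x x01; rewrite big_geq// add0r; split.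
have [l [l0 l1] lP] := IHn _ (fun k => b k.+1) (fun k => q01 k.+1).
rewrite big_nat_recl//=.
set pi' := \prod_(0 <= i < n) f (fun k => q k.+1) (fun k => b k.+1) i in l1 lP.
have -> : \prod_(0 <= i < n) f q b i.+1 = pi' by [].
have pi0 : 0 <= pi'.
  by apply: prodr_ge0 => k _; have /andP[] := @f01 _ (fun k => b k.+1) k (fun k => q01 k.+1).
have sE x : (forall k, (k < n.+1)%N -> bits q x k = b k) <->
    (x < q 0%N) = b 0%N /\ forall k, (k < n)%N ->
    bits (fun k => q k.+1) (if x < q 0%N then x / q 0%N
       else (x - q 0%N) / (1 - q 0%N)) k = b k.+1.
  split=> [H|[H0 H] [|k]//=]; last by rewrite ltnS; exact: H.
  split; first exact: (H 0%N).
  by move=> k kn; exact: (H k.+1).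
have /andP[q0 q1] := q01 0%N.
rewrite /f; case: (b 0%N) sE => sE.
- exists (q 0%N * l); first by split; nra.
  move=> x /andP[x0 x1]; rewrite sE; split.
  + move=> [xq]; rewrite xq => H.
    have q_gt0 : 0 < q 0%N by lra.
    have y01 : 0 <= x / q 0%N < 1 by rewrite divr_ge0//= ltr_pdivrMr// mul1r.
    have := (lP _ y01).1 H; rewrite ler_pdivlMr// ltr_pdivrMr// => /andP[? ?].
    by apply/andP; split; lra.
  + move=> /andP[h1 h2].
    have xq : x < q 0%N by nra.
    have q_gt0 : 0 < q 0%N by lra.
    split=> //; rewrite xq; apply/lP.
      by rewrite divr_ge0//= ltr_pdivrMr// mul1r.
    by rewrite ler_pdivlMr// ltr_pdivrMr//; apply/andP; split; lra.
- exists (q 0%N + (1 - q 0%N) * l); first by split; nra.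
  move=> x /andP[x0 x1]; rewrite sE; split.
  + move=> [xq]; rewrite xq => H; move/negbT: xq; rewrite -leNgt => xq.
    have q_lt1 : 0 < 1 - q 0%N by lra.
    have y01 : 0 <= (x - q 0%N) / (1 - q 0%N) < 1.
      by rewrite divr_ge0//= ?ltr_pdivrMr//; lra.
    have := (lP _ y01).1 H; rewrite ler_pdivlMr// ltr_pdivrMr// => /andP[? ?].
    by apply/andP; split; lra.
  + move=> /andP[h1 h2].
    have xq : q 0%N <= x by nra.
    have q_lt1 : 0 < 1 - q 0%N by lra.
    rewrite ltNge xq/=; split=> //; apply/lP.
      by rewrite divr_ge0//= ?ltr_pdivrMr//; lra.
    by rewrite ler_pdivlMr// ltr_pdivrMr//; apply/andP; split; lra.
Qed.

Let I : set (measurableTypeR R) := [set x : R | 0 <= x < 1].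

Let IE : I = [set` `[0, 1[].
Proof. by apply/seteqP; split => x /=; rewrite /I/= in_itv. Qed.

Let mI : measurable I. Proof. by rewrite IE; exact: measurable_itv. Qed.

Let B q b D n : set (measurableTypeR R) :=
  I `&` [set x | forall k, (k < n)%N -> D k -> bits q x k = b k].

Lemma bits_measure n j q b D : (forall k, 0 <= q k <= 1) -> (j <= n)%N ->
  (forall k, (j <= k < n)%N -> D k) ->
  measurable (B q b D n) /\
  lebesgue_measure (B q b D n) = (\prod_(0 <= k < n | D k) f q b k)%:E.
Proof.
move=> q01; elim: j b D => [|j IHj] b D jn Dj.
  have [l [l0 l1] lP] := bits_interval n b q01.
  set p := \prod_(0 <= k < n) f q b k in l1 lP.
  have p0 : 0 <= p.
    by apply: prodr_ge0 => k _; have /andP[] := @f01 q b k q01.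
  have BE : B q b D n = [set` `[l, l + p[].
    apply/seteqP; split => x /=; rewrite in_itv/=.
      move=> [xI H]; apply/(lP x xI).1 => k kn; apply: H => //.
      exact: Dj.
    move=> /andP[lx xl].
    have xI : 0 <= x < 1 by apply/andP; split; lra.
    split=> // k kn _; move: k kn; apply/(lP x xI).2.
    by rewrite lx.
  rewrite BE; split; first exact: measurable_itv.
  rewrite lebesgue_measure_itv/= lte_fin.
  have -> : \prod_(0 <= k < n | D k) f q b k = p.
    by apply: congr_big_nat => // k kn; rewrite Dj.
  case: ifPn => [_|]; first by rewrite -EFinD addrAC subrr add0r.
  by rewrite -leNgt => h; congr EFin; lra.
have [Djj|nDj] := boolP (D j).
  apply: IHj; first exact: ltnW.
  move=> k /andP[]; rewrite leq_eqVlt => /orP[/eqP <-//|jk kn].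
  by apply: Dj; rewrite jk.
pose D' k := D k || (k == j).
pose bb c k := if k == j then c else b k.
have D'j k : (j <= k < n)%N -> D' k.
  move=> /andP[]; rewrite leq_eqVlt => /orP[/eqP <-|jk kn].
    by rewrite /D' eqxx orbT.
  by rewrite /D' Dj// jk.
have [mt et] := IHj (bb true) D' (ltnW jn) D'j.
have [mf ef] := IHj (bb false) D' (ltnW jn) D'j.
have BU : B q b D n = B q (bb true) D' n `|` B q (bb false) D' n.
  apply/seteqP; split => x /=.
    move=> [xI H]; case bxj : (bits q x j); [left|right]; split => // k kn;
      rewrite /D' /bb; case: eqP => [->//|_]; rewrite orbF; exact: H.
  have aux c : B q (bb c) D' n x -> B q b D n x.
    move=> [xI H]; split => // k kn Dk; have := H k kn.
    rewrite /D' Dk => /(_ erefl); rewrite /bb; case: eqP => // kj.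
    by move: nDj; rewrite -kj Dk.
  by case; exact: aux.
split; first by rewrite BU; exact: measurableU.
rewrite BU measureU//; last first.
  apply/seteqP; split => // x [[_ /(_ j jn) Ht] [_ /(_ j jn) Hf]].
  move: Ht Hf; rewrite /D' /bb eqxx orbT => /(_ erefl) Ht /(_ erefl) Hf.
  by move: Hf; rewrite Ht.
transitivity ((\prod_(0 <= k < n | D' k) f q (bb true) k)%:E +
  (\prod_(0 <= k < n | D' k) f q (bb false) k)%:E)%E; first exact: (f_equal2 _ et ef).
have split_prod c : \prod_(0 <= k < n | D' k) f q (bb c) k =
    (if c then q j else 1 - q j) * \prod_(0 <= k < n | D k) f q b k.
  have jI : j \in index_iota 0 n by rewrite mem_index_iota.
  rewrite big_mkcond (bigD1_seq j jI (iota_uniq _ _))/=.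
  rewrite [in RHS]big_mkcond [in RHS](bigD1_seq j jI (iota_uniq _ _))/=.
  rewrite (negbTE nDj) mul1r /f /D' /bb eqxx orbT; congr (_ * _).
  by apply: eq_bigr => k /negbTE ->; rewrite orbF.
by rewrite !split_prod -EFinD; congr EFin; rewrite -mulrDl addrC subrK mul1r.
Qed.

Context {E : countType} (p : E -> R).
Hypothesis p01 : forall e, 0 <= p e <= 1.

Let q (n : nat) : R := if unpickle n is Some e then p e else 0.

Let q01 k : 0 <= q k <= 1.
Proof. by rewrite /q; case: unpickle => [e//|]; rewrite lexx ler01. Qed.

Let toconf (x : measurableTypeR R) : configuration E :=
  fun e => (x \in I) && bits q x (pickle e).

Let m_toconf : measurable_fun [set: measurableTypeR R] toconf.
Proof.
refine (@measurability _ _ _ _ [set: measurableTypeR R] toconf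
  (coordinate_events E) erefl _).
move=> _ [_ [e _ <-]] <-; rewrite setTI.
have D1 k : ((pickle e).+1 <= k < (pickle e).+1)%N -> pred1 (pickle e) k.
  by move=> /andP[h1 h2]; move: (leq_trans h2 h1); rewrite ltnn.
have [m _] := bits_measure (fun=> true) q01 (leqnn _) D1.
suff -> : toconf @^-1` [set w | w e] =
  B q (fun=> true) (pred1 (pickle e)) (pickle e).+1 by [].
apply/seteqP; split => x /=; rewrite /toconf.
  by move=> /andP[/set_mem xI bx]; split => // k _ /eqP ->.
move=> [xI H]; rewrite (mem_set xI)/=; apply: H => //.
exact: eqxx.
Qed.

Let mu := mrestr (@lebesgue_measure R) mI.

Let muT : mu setT = 1%E.
Proof.
by rewrite /mu /mrestr setTI IE lebesgue_measure_itv/= lte_fin ltr01 sube0.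
Qed.

HB.instance Definition _ := Measure.on mu.
HB.instance Definition _ := Measure_isProbability.Build _ _ _ mu muT.
HB.instance Definition _ := isMeasurableFun.Build _ _ _ _ toconf m_toconf.

Lemma bernoulli_product_exists :
  exists P : probability (configuration E) R, is_bernoulli_product p P.
Proof.
exists (distribution mu toconf) => s b us.
pose b' k := if unpickle k is Some e then b e else false.
pose D k := k \in map pickle s.
pose N := (\max_(k <- map pickle s) k).+1.
have DN k : D k -> (k < N)%N by move=> Dk; rewrite ltnS; exact: leq_bigmax_seq.
have Db k : (N <= k < N)%N -> D k.
  by move=> /andP[h1 h2]; move: (leq_trans h2 h1); rewrite ltnn.
have [_ mB] := bits_measure b' q01 (leqnn _) Db.
have cE : (toconf @^-1` cylinder s b) `&` I = B q b' D N.
  apply/seteqP; split => x /=.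
    move=> [H xI]; split => // k _ /mapP[e es ->].
    by rewrite /b' pickleK -(H e es) /toconf (mem_set xI).
  move=> [xI H]; split => // e es; rewrite /toconf (mem_set xI)/=.
  have De : D (pickle e) by apply/mapP; exists e.
  by rewrite (H _ (DN _ De) De) /b' pickleK.
transitivity (lebesgue_measure (B q b' D N)).
  by rewrite -cE.
rewrite mB; congr EFin.
rewrite -big_filter (perm_big (map pickle s)); last first.
  apply: uniq_perm; first by rewrite filter_uniq// iota_uniq.
    by rewrite map_inj_uniq//; exact: (pcan_inj pickleK).
  move=> k; rewrite mem_filter mem_index_iota leq0n/= -/(D k).
  by case: (boolP (D k)) => // /DN ->.
by rewrite big_map; apply: eq_bigr => e _; rewrite /f /b' /q pickleK.
Qed.

End existence.

Lemma bernoulli_product_unique (R : realType) (E : countType) (p : E -> R)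
    (P Q : probability (configuration E) R) :
  is_bernoulli_product p P -> is_bernoulli_product p Q ->
  forall A, measurable A -> P A = Q A.
Proof.
move=> hP hQ A mA.
pose G : set (set (configuration E)) :=
  [set C | C = set0 \/ exists s b, uniq s /\ C = cylinder s b].
have mcyl s (b : E -> bool) : measurable (cylinder s b : set (configuration E)).
  have -> : cylinder s b = \bigcap_(e in [set` s]) [set w | w e = b e] by [].
  apply: fin_bigcap_measurable => // e _.
  have me : measurable ([set w : E -> bool | w e] : set (configuration E)).
    by apply: sub_sigma_algebra; exists e.
  case: (b e) => //.
  rewrite (_ : [set w | _] = ~` [set w : configuration E | w e]).
    exact: measurableC.
  by apply/seteqP; split => w /=; case: (w e).
have mG : @measurable _ (configuration E) = <<s G >>.
  apply/seteqP; split.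
    apply: smallest_sub; first exact: smallest_sigma_algebra.
    move=> _ [e _ <-]; apply: sub_sigma_algebra; right.
    exists [:: e], (fun=> true); split => //.
    apply/seteqP; split => w /=; first by move=> we e'; rewrite inE => /eqP ->.
    by move=> /(_ e); rewrite inE eqxx => ->.
  apply: smallest_sub; first exact: sigma_algebra_measurable.
  by move=> _ [->|[s [b [_ ->]]]].
have GT : G setT.
  by right; exists [::], (fun=> true); split => //; apply/seteqP; split.
apply: (measure_unique G (fun=> setT)) => //.
- move=> C1 C2 [->|[s [b [us ->]]]]; first by move=> _; rewrite set0I; left.
  move=> [->|[t [c [ut ->]]]]; first by rewrite setI0; left.
  case: (pselect (exists2 e, (e \in s) && (e \in t) & b e != c e)).
    move=> [e /andP[es et] bc]; left; apply/seteqP; split => // w [ws wt].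
    by move: bc; rewrite -(ws e es) -(wt e et) eqxx.
  move=> /forall2NP bc; right.
  exists (undup (s ++ t)), (fun e => if e \in s then b e else c e).
  split; first exact: undup_uniq.
  apply/seteqP; split => w /=.
    move=> [ws wt] e; rewrite mem_undup mem_cat.
    by case: (boolP (e \in s)) => [/ws|_ /wt].
  move=> h; split => e eI; have := h e; rewrite mem_undup mem_cat eI ?orbT.
    by move=> /(_ erefl).
  move=> /(_ erefl); case: ifPn => // es ->.
  by have [|/negP] := bc e; rewrite ?es ?eI// negbK => /eqP.
- by rewrite bigcup_const.
- move=> _ [->|[s [b [us ->]]]]; first by rewrite !measure0.
  exact: etrans (hP s b us) (esym (hQ s b us)).
- by move=> n; apply: (le_lt_trans (probability_le1 _ _)) => //; rewrite ltry.
Qed.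

(* Given reference orientations [ends] of the edges, [(e, false)] stands for [e]
   with its reference orientation and [(e, true)] for [e] reversed. *)
Definition origin (V E : Type) (ends : E -> V * V) (d : E * bool) : V :=
  if d.2 then (ends d.1).2 else (ends d.1).1.

Definition target (V E : Type) (ends : E -> V * V) (d : E * bool) : V :=
  origin ends (d.1, ~~ d.2).

(* Parallel edges and loops are allowed; the order within [ends e] carries no
   information. *)
Record weighted_graph (R : realType) := WeightedGraph {
  vertex : countType;
  edge : countType;
  ends : edge -> vertex * vertex;
  weight : edge -> R;
  weight_gt0 : forall e, 0 < weight e;
  weight_summable : forall v,
    (\esum_(d in [set d | origin ends d = v]) (weight d.1)%:E < +oo)%E }.

Section weighted_graph.
Context {R : realType}.
Variable G : weighted_graph R.
Local Notation V := (vertex G).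
Local Notation E := (edge G).

Definition oriented_edges_from (v : V) : set (E * bool) :=
  [set d | origin (@ends R G) d = v].

Definition same_ends (x y : V * V) : Prop := x = y \/ x = (y.2, y.1).

(* The two ends may coincide, so this allows at most one loop at each vertex. *)
Definition simple_graph : Prop :=
  forall e e' : E, same_ends (ends e) (ends e') -> e = e'.

Definition automorphism (f : V -> V) (g : E -> E) : Prop :=
  [/\ bijective f, bijective g,
      forall e, same_ends (ends (g e)) (f (ends e).1, f (ends e).2) &
      forall e, weight (g e) = weight e].

Definition transitive_graph : Prop :=
  forall u v : V, exists f g, automorphism f g /\ f u = v.

Definition unimodular : Prop :=
  forall (o : V) (F : V -> V -> \bar R),
    (forall u v, 0 <= F u v)%E ->
    (forall f g, automorphism f g -> forall u v, F (f u) (f v) = F u v) ->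
    (\esum_(v in [set: V]) F o v = \esum_(v in [set: V]) F v o)%E.

Definition open_adjacent (w : configuration E) (u v : V) : Prop :=
  exists d, [/\ w d.1, origin (@ends R G) d = u & target (@ends R G) d = v].

Definition open_cluster (w : configuration E) (v : V) : set V :=
  [set u | exists2 p, path (fun x y => `[< open_adjacent w x y >]) v p &
                      last v p = u].

Definition has_infinite_cluster (w : configuration E) : Prop :=
  exists v, infinite_set (open_cluster w v).

Lemma percolation_exists (beta : R) :
  exists P : probability (configuration E) R, 0 <= beta ->
    is_bernoulli_product (fun e : E => 1 - expR (- (beta * weight e))) P.
Proof.
have [b0|_] := boolP (0 <= beta).
  have [|P hP] := @bernoulli_product_exists R E
    (fun e => 1 - expR (- (beta * weight e))); last by exists P.
  move=> e; rewrite subr_ge0 gerBl expR_ge0 andbT -expR0 ler_expR oppr_le0.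
  by rewrite mulr_ge0// ltW// weight_gt0.
have [|P _] := @bernoulli_product_exists R E (fun=> 0); last by exists P.
by move=> _; rewrite lexx ler01.
Qed.

(* Only meaningful for 0 <= beta. *)
Definition percolation (beta : R) : probability (configuration E) R :=
  sval (cid (percolation_exists beta)).

Lemma percolationP (beta : R) : 0 <= beta ->
  is_bernoulli_product (fun e : E => 1 - expR (- (beta * weight e)))
    (percolation beta).
Proof. exact: svalP (cid (percolation_exists beta)). Qed.

Definition beta_c : \bar R :=
  ereal_sup [set beta%:E | beta in
    [set beta : R | 0 <= beta /\
       {ae percolation beta, forall w, ~ has_infinite_cluster w}]].

End weighted_graph.

(* Main.v *)
Require Import Defs.
From mathcomp Require Import all_boot all_order all_algebra.
From mathcomp Require Import all_classical all_reals all_analysis.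
From mathcomp Require Import ring lra zify.

(* Write theta = (2a-1)/(a+1) and Q n for the probability of a cluster of at least n
   vertices. Three facts are combined at parameters where the mean cluster size is finite,
   with constants that do not depend on this mean.
   - By the BK inequality, the number of vertices of a cluster in a set of N vertices has an
     exponential tail beyond the typical size of the largest such number. Hence, if
     Q k <= A k^-theta for all k, a vertex o is connected to at most
     C A^(2/(1+theta)) N^((1-theta)/(1+theta)) of N given vertices on average.
   - Two-ghost inequality: let o and y be the ends of an edge of weight at least eps. Give a
     cluster of m vertices the concave weight min(m/n, 1); mass transport identifies the
     expected decrease of total weight when the edge is opened with the expectation of a sum
     of centred variables over the edges touching the cluster of o, divided by the size of
     this cluster. Along an exploration the latter is a martingale, which is controlled on
     dyadic scales. This bounds the probability that o and y are in distinct clusters of at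
     least n vertices, on average over the N edges of weight at least eps at o.
   - By Harris' inequality both clusters have at least n vertices with probability at least
     (Q n)^2. With N of order n^(1+theta), the bounds above give
     A^2 <= C A^(2/(1+theta)) for the best constant A, so that A is bounded.
   Finiteness of the mean below beta_c is the sharpness of the phase transition, proved as by
   Duminil-Copin and Tassion. If beta_c were infinite, the same estimate would apply to
   the truncated weights min(beta J, 1) uniformly in beta, although the degree of o in the
   open subgraph then tends to infinity with beta. *)

Set Implicit Arguments.
Unset Strict Implicit.
Unset Printing Implicit Defensive.
Import Order.TTheory GRing.Theory Num.Theory.
Import numFieldNormedType.Exports.

Local Open Scope classical_set_scope.
Local Open Scope ring_scope.

(** * Expectations over finitely many independent edges *)

Section update.
Context {E : eqType}.
Implicit Types (w : E -> bool) (e : E) (s : seq E).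

(** All estimates are made over finite lists of edges, with every other edge closed; BK, Harris and
    Russo's formula then are inductions on the list. Increasing events pass to the percolation
    measure by monotone limits. The obstacle is mass transport, since a finite list is not invariant
    under automorphisms: the identity holds for the limit, hence up to an error eta for large lists.
    The limit is a supremum, so masses must be nonnegative and increase with the configuration and
    the list, whereas the mass of the two-ghost inequality is signed. It is written as a signed sum
    of four products of monotone factors. The finite mean serves twice without entering the
    constants: it makes the total mass finite, and the best constant A finite before A is bounded.
    Origin of theta: for eps of order n^(-(1+theta)/a) there are N >= n^(1+theta) edges, and the
    two-ghost bound is of order sqrt(N/eps) n^(-1/2-theta). It is at most a multiple of N n^(-2
    theta) as soon as (1+theta)/a <= 2 - theta; equality is theta = (2a-1)/(a+1). *)

Definition upd w e (b : bool) : E -> bool := fun x => if x == e then b else w x.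

Definition conf_le w w' := forall e, w e -> w' e.

Definition supported s w := forall e, w e -> e \in s.

Lemma updC w e f b c : e != f -> upd (upd w e b) f c = upd (upd w f c) e b.
Proof.
move=> ef; apply/funext => x; rewrite /upd; case: (eqVneq x f) => // ->.
by rewrite eq_sym (negbTE ef).
Qed.

Lemma upd_upd w e b c : upd (upd w e b) e c = upd w e c.
Proof. by apply/funext => x; rewrite /upd; case: eqVneq. Qed.

Lemma upd_id w e : upd w e (w e) = w.
Proof. by apply/funext => x; rewrite /upd; case: eqVneq => // ->. Qed.

Lemma updE w e b : upd w e b e = b.
Proof. by rewrite /upd eqxx. Qed.

Lemma upd_le w w' e b : conf_le w w' -> conf_le (upd w e b) (upd w' e b).
Proof. by move=> ww' x; rewrite /upd; case: eqVneq => // _; apply: ww'. Qed.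

Lemma upd_true_ge w e : conf_le w (upd w e true).
Proof. by move=> x; rewrite /upd; case: eqVneq. Qed.

Lemma upd_false_le w e : conf_le (upd w e false) w.
Proof. by move=> x; rewrite /upd; case: eqVneq. Qed.

Lemma upd_notin s w e : supported s w -> e \notin s -> upd w e false = w.
Proof.
move=> sw es; rewrite -[RHS](upd_id w e); congr upd.
by apply/esym/negP => /sw; apply/negP.
Qed.

Lemma supported_upd s w e b : supported s w -> supported (e :: s) (upd w e b).
Proof.
by move=> sw x; rewrite /upd inE; case: eqVneq => //= _; apply: sw.
Qed.

Lemma supported0 : supported [::] (fun=> false). Proof. by []. Qed.

End update.

Section expectation.
Context {R : realType} {E : eqType}.
Implicit Types (w : E -> bool) (e : E) (s : seq E) (p : E -> R)
  (F G : (E -> bool) -> R) (A B : (E -> bool) -> Prop).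

(** Edges outside [s] are closed. A recursion instead of an integral, so that inequalities are
    proved one edge at a time. If [s] has repetitions, the first occurrence of an edge decides its
    state. *)
Fixpoint Ex p s F : R :=
  if s is e :: s' then
    p e * Ex p s' (fun w => F (upd w e true)) +
    (1 - p e) * Ex p s' (fun w => F (upd w e false))
  else F (fun=> false).

Definition ind A w : R := if `[< A w >] then 1 else 0.

Definition Pr p s A := Ex p s (ind A).

Definition incr F := forall w w', conf_le w w' -> F w <= F w'.

Definition incr_event A := forall w w', conf_le w w' -> A w -> A w'.

Definition prob_vec p := forall e, 0 <= p e <= 1.

Lemma ind_ge0 A w : 0 <= ind A w.
Proof. by rewrite /ind; case: ifP. Qed.

Lemma ind_le1 A w : ind A w <= 1.
Proof. by rewrite /ind; case: ifP. Qed.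

Lemma indT A w : A w -> ind A w = 1.
Proof. by move=> Aw; rewrite /ind asboolT. Qed.

Lemma indF A w : ~ A w -> ind A w = 0.
Proof. by move=> Aw; rewrite /ind asboolF. Qed.

Lemma ind_le A B w w' : (A w -> B w') -> ind A w <= ind B w'.
Proof.
move=> AB; rewrite {1}/ind; case: asboolP => [/AB Bw'|_]; last exact: ind_ge0.
by rewrite indT.
Qed.

Lemma ind_incr A : incr_event A -> incr (ind A).
Proof. by move=> iA w w' ww'; apply: ind_le; apply: iA. Qed.

Lemma Ex_eq_supp p s F G : (forall w, supported s w -> F w = G w) ->
  Ex p s F = Ex p s G.
Proof.
elim: s F G => [|e s IH] F G FG /=; first exact: FG.
by congr (_ * _ + _ * _); apply: IH => w sw; apply: FG; apply: supported_upd.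
Qed.

Lemma Ex_ext p s F G : F =1 G -> Ex p s F = Ex p s G.
Proof. by move=> FG; apply: Ex_eq_supp => w _; apply: FG. Qed.

Lemma ExD p s F G : Ex p s (fun w => F w + G w) = Ex p s F + Ex p s G.
Proof. by elim: s F G => [//|e s IH] F G /=; rewrite !IH; ring. Qed.

Lemma ExZ p s c F : Ex p s (fun w => c * F w) = c * Ex p s F.
Proof. by elim: s F => [//|e s IH] F /=; rewrite !IH; ring. Qed.

Lemma ExB p s F G : Ex p s (fun w => F w - G w) = Ex p s F - Ex p s G.
Proof. by elim: s F G => [//|e s IH] F G /=; rewrite !IH; ring. Qed.

Lemma Ex_cst p s c : Ex p s (fun=> c) = c.
Proof. by elim: s => [//|e s IH] /=; rewrite !IH; ring. Qed.

Lemma Ex_sum p s (I : Type) (r : seq I) (P : pred I) (F : I -> (E -> bool) -> R) :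
  Ex p s (fun w => \sum_(i <- r | P i) F i w) = \sum_(i <- r | P i) Ex p s (F i).
Proof.
elim: r => [|i r IH].
  by under Ex_ext do rewrite big_nil; rewrite Ex_cst big_nil.
rewrite big_cons -IH; case: ifP => Pi.
  by rewrite -ExD; apply: Ex_ext => w; rewrite big_cons Pi.
by apply: Ex_ext => w; rewrite big_cons Pi.
Qed.

Lemma Ex_swap p e f s F : e != f -> Ex p (e :: f :: s) F = Ex p (f :: e :: s) F.
Proof.
move=> ef /=.
have H b c : Ex p s (fun w => F (upd (upd w f c) e b)) =
    Ex p s (fun w => F (upd (upd w e b) f c)).
  by apply: Ex_ext => w; rewrite updC// eq_sym.
rewrite !H; ring.
Qed.

Lemma Ex_rem p e s F : uniq s -> e \in s -> Ex p s F = Ex p (e :: rem e s) F.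
Proof.
elim: s F => // f s IH F /=/andP[fs us]; rewrite inE; case: (eqVneq e f) => [->//|ef es].
rewrite (IH _ us es) (IH _ us es).
rewrite -[RHS]/(Ex p (e :: f :: rem e s) F) Ex_swap//.
Qed.

Lemma Ex_perm p s s' F : uniq s -> perm_eq s s' -> Ex p s F = Ex p s' F.
Proof.
elim: s s' F => [|e s IH] s' F; first by rewrite perm_sym => _ /perm_nilP ->.
move=> /= /andP[es us] ps; have us' : uniq s' by rewrite -(perm_uniq ps)/= es.
have es' : e \in s' by rewrite -(perm_mem ps) mem_head.
rewrite (Ex_rem _ _ us' es') /=.
have ps' : perm_eq s (rem e s').
  by rewrite -(perm_cons e) (perm_trans ps)// perm_to_rem.
by rewrite !(IH (rem e s')).
Qed.

Lemma Ex_upd p s e F : uniq s -> e \in s ->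
  Ex p s F = p e * Ex p s (fun w => F (upd w e true)) +
    (1 - p e) * Ex p s (fun w => F (upd w e false)).
Proof.
move=> us es; rewrite 3!(Ex_rem _ _ us es)/=.
have H b c : Ex p (rem e s) (fun w => F (upd (upd w e b) e c)) =
    Ex p (rem e s) (fun w => F (upd w e c)).
  by apply: Ex_ext => w; rewrite upd_upd.
rewrite !H; ring.
Qed.

Lemma Ex_map p s (g g' : E -> E) F : cancel g g' -> cancel g' g ->
  (forall e, p (g e) = p e) ->
  Ex p (map g s) F = Ex p s (fun w => F (w \o g')).
Proof.
move=> gK g'K pg; elim: s F => [//|e s IH] F /=; rewrite !IH pg.
have H b : Ex p s (fun w => F (upd (w \o g') (g e) b)) =
    Ex p s (fun w => F (upd w e b \o g')).
  apply: Ex_ext => w; congr F; apply/funext => x; rewrite /upd/=.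
  by rewrite -(can_eq g'K) gK.
by rewrite !H.
Qed.

Section positive.
Variables (p : E -> R) (p01 : prob_vec p).

Let p0 e : 0 <= p e. Proof. by case/andP: (p01 e). Qed.
Let p1 e : 0 <= 1 - p e. Proof. by rewrite subr_ge0; case/andP: (p01 e). Qed.

Lemma Ex_le_supp s F G : (forall w, supported s w -> F w <= G w) ->
  Ex p s F <= Ex p s G.
Proof.
elim: s F G => [|e s IH] F G FG /=; first exact: FG.
by apply: lerD; apply: ler_wpM2l => //; apply: IH => w sw; apply: FG;
  apply: supported_upd.
Qed.

Lemma Ex_le s F G : (forall w, F w <= G w) -> Ex p s F <= Ex p s G.
Proof. by move=> FG; apply: Ex_le_supp. Qed.

Lemma Ex_ge0 s F : (forall w, 0 <= F w) -> 0 <= Ex p s F.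
Proof. by move=> F0; rewrite -(Ex_cst p s 0); apply: Ex_le. Qed.

Lemma Pr_ge0 s A : 0 <= Pr p s A.
Proof. by apply: Ex_ge0 => w; apply: ind_ge0. Qed.

Lemma Pr_le1 s A : Pr p s A <= 1.
Proof. by rewrite -(Ex_cst p s 1); apply: Ex_le => w; apply: ind_le1. Qed.

Lemma Pr_le_supp s A B : (forall w, supported s w -> A w -> B w) ->
  Pr p s A <= Pr p s B.
Proof. by move=> AB; apply: Ex_le_supp => w sw; apply: ind_le; apply: AB. Qed.

Lemma Pr_le s A B : (forall w, A w -> B w) -> Pr p s A <= Pr p s B.
Proof. by move=> AB; apply: Pr_le_supp => w _; apply: AB. Qed.

Lemma incr_upd F e b : incr F -> incr (fun w => F (upd w e b)).
Proof. by move=> iF w w' ww'; apply: iF; apply: upd_le. Qed.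

Lemma incr_event_upd A e b : incr_event A -> incr_event (fun w => A (upd w e b)).
Proof. by move=> iA w w' ww'; apply: iA; apply: upd_le. Qed.

Lemma Ex_cons_ge e s F : incr F -> e \notin s -> Ex p s F <= Ex p (e :: s) F.
Proof.
move=> iF es /=.
have -> : Ex p s (fun w => F (upd w e false)) = Ex p s F.
  by apply: Ex_eq_supp => w sw; rewrite (upd_notin sw es).
have : Ex p s F <= Ex p s (fun w => F (upd w e true)).
  by apply: Ex_le => w; apply: iF; apply: upd_true_ge.
move=> /(ler_wpM2l (p0 e)); lra.
Qed.

Lemma Ex_subset s s' F : incr F -> uniq s -> uniq s' -> {subset s <= s'} ->
  Ex p s F <= Ex p s' F.
Proof.
move=> iF us us' ss'.
pose t := [seq e <- s' | e \notin s].
have ut : uniq t by rewrite filter_uniq.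
have ts : {in t, forall e, e \notin s} by move=> e; rewrite mem_filter => /andP[].
have -> : Ex p s' F = Ex p (t ++ s) F.
  apply: Ex_perm => //; apply: uniq_perm => //.
    rewrite cat_uniq ut us andbT/=; apply/hasPn => e es; apply/negP => /ts.
    by rewrite es.
  move=> e; rewrite mem_cat mem_filter; case: (boolP (e \in s)) => /=.
    by move=> /ss' ->.
  by rewrite orbF.
elim: t ut ts => [//|e t IH] /= /andP[et ut] ts; apply: (le_trans (IH ut _)).
  by move=> f ft; apply: ts; rewrite inE ft orbT.
apply: Ex_cons_ge => //; rewrite mem_cat negb_or et/=.
by apply: ts; rewrite mem_head.
Qed.

Lemma Pr_subset s s' A : incr_event A -> uniq s -> uniq s' ->
  {subset s <= s'} -> Pr p s A <= Pr p s' A.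
Proof. by move=> iA; apply: Ex_subset; apply: ind_incr. Qed.

(* Harris' inequality: one coordinate contributes
   p (1 - p) (F1 - F0) (G1 - G0) to the covariance. *)
Lemma Harris s F G : incr F -> incr G ->
  Ex p s F * Ex p s G <= Ex p s (fun w => F w * G w).
Proof.
elim: s F G => [//|e s IH] F G iF iG /=.
have := IH _ _ (incr_upd e true iF) (incr_upd e true iG).
have := IH _ _ (incr_upd e false iF) (incr_upd e false iG).
have mono H : incr H -> Ex p s (fun w => H (upd w e false)) <=
    Ex p s (fun w => H (upd w e true)).
  move=> iH; apply: Ex_le => w; apply: iH => x; rewrite /upd.
  by case: eqVneq.
move: (mono _ iF) (mono _ iG).
set f0 := Ex p s (fun w => F (upd w e false)).
set f1 := Ex p s (fun w => F (upd w e true)).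
set g0 := Ex p s (fun w => G (upd w e false)).
set g1 := Ex p s (fun w => G (upd w e true)).
set h0 := Ex p s _; set h1 := Ex p s _ => f01 g01 le0 le1.
have := p0 e; have := p1 e; set q := p e => q1 q0.
have : 0 <= q * (1 - q) * ((f1 - f0) * (g1 - g0)).
  by rewrite !mulr_ge0// subr_ge0.
have := ler_wpM2l q0 le1; have := ler_wpM2l q1 le0; lra.
Qed.

(** Disjoint occurrence, in the form suited to increasing events: the witnesses are two sets of open
    edges without common element. *)
Definition box A B w := exists w1 w2, [/\ conf_le w1 w, conf_le w2 w,
  forall e, ~~ (w1 e && w2 e), A w1 & B w2].

Lemma box_incr A B : incr_event (box A B).
Proof.
move=> w w' ww' [w1 [w2 [h1 h2 d a b]]]; exists w1, w2.
by split => // e; [move=> /h1|move=> /h2] => /ww'.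
Qed.

Lemma box_le A A' B B' w : (forall w, A w -> A' w) -> (forall w, B w -> B' w) ->
  box A B w -> box A' B' w.
Proof.
move=> AA BB [w1 [w2 [h1 h2 d a b]]]; exists w1, w2.
by split => //; [apply: AA|apply: BB].
Qed.

Lemma Pr_or s A B C : (forall w, C w -> A w /\ B w) ->
  Pr p s (fun w => A w \/ B w) <= Pr p s A + Pr p s B - Pr p s C.
Proof.
move=> CAB; rewrite /Pr -ExD -ExB; apply: Ex_le => w; rewrite /ind.
case: (asboolP (C w)) => [/CAB [a b]|c].
  by rewrite !asboolT//; [lra|left].
case: (asboolP (A w)) => a; case: (asboolP (B w)) => b;
  case: (asboolP (A w \/ B w)) => ab; (lra || tauto).
Qed.

(* Induction on the edges: with u the probability of [box A0 B0] and v that of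
   [box A1 B0 \/ box A0 B1], both v <= a1 b1 and v <= a1 b0 + a0 b1 - u hold by induction,
   and their average with weights p and 1 - p is what is needed. *)
Lemma BK s A B : uniq s -> incr_event A -> incr_event B ->
  Pr p s (box A B) <= Pr p s A * Pr p s B.
Proof.
elim: s A B => [|e s IH] A B.
  move=> _ iA iB; rewrite /Pr /= {1}/ind.
  case: asboolP => [[w1 [w2 [h1 h2 d a b]]]|_].
    by rewrite !indT ?mulr1//; [apply: iB b|apply: iA a].
  by rewrite mulr_ge0// ind_ge0.
move=> /= /andP[es us] iA iB; rewrite {1}/Pr /=.
pose A0 w := A (upd w e false); pose A1 w := A (upd w e true).
pose B0 w := B (upd w e false); pose B1 w := B (upd w e true).
have iA0 : incr_event A0 by apply: incr_event_upd.
have iA1 : incr_event A1 by apply: incr_event_upd.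
have iB0 : incr_event B0 by apply: incr_event_upd.
have iB1 : incr_event B1 by apply: incr_event_upd.
have le01 w : conf_le (upd w e false) (upd w e true).
  by move=> x; rewrite /upd; case: eqVneq.
have A01 w : A0 w -> A1 w by apply: iA.
have B01 w : B0 w -> B1 w by apply: iB.
have H0 : Ex p s (fun w => ind (box A B) (upd w e false)) <= Pr p s (box A0 B0).
  rewrite /Pr; apply: Ex_le_supp => w sw; apply: ind_le => -[w1 [w2 [h1 h2 d a b]]].
  have we (v : E -> bool) : conf_le v (upd w e false) -> upd v e false = v.
    move=> vw; rewrite -[RHS](upd_id v e); congr upd; apply/esym/negP => /vw.
    by rewrite updE.
  have ew := upd_notin sw es; exists w1, w2; split => //.
  - by move=> x /h1; rewrite ew.
  - by move=> x /h2; rewrite ew.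
  - by rewrite /A0 (we _ h1).
  - by rewrite /B0 (we _ h2).
(* At most one of the two witnesses uses the open edge [e]; the other one still works with [e]
   closed. *)
have H1 : Ex p s (fun w => ind (box A B) (upd w e true)) <=
    Pr p s (fun w => box A1 B0 w \/ box A0 B1 w).
  rewrite /Pr; apply: Ex_le_supp => w sw; apply: ind_le => -[w1 [w2 [h1 h2 d a b]]].
  have le v : conf_le v (upd w e true) -> conf_le (upd v e false) w.
    by move=> vw x; have := vw x; rewrite /upd; case: eqVneq.
  have dd : forall x, ~~ (upd w1 e false x && upd w2 e false x).
    by move=> x; rewrite /upd; case: eqVneq.
  have up v : upd (upd v e false) e true = upd v e true by rewrite upd_upd.
  have dn v : upd (upd v e false) e false = upd v e false by rewrite upd_upd.
  case w1e : (w1 e).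
    left; exists (upd w1 e false), (upd w2 e false).
    split; [exact: le|exact: le|by []| |].
      by rewrite /A1 up -w1e upd_id.
    rewrite /B0 dn; suff <- : w2 e = false by rewrite upd_id.
    by have := d e; rewrite w1e/= => /negbTE.
  right; exists (upd w1 e false), (upd w2 e false).
  split; [exact: le|exact: le|by []| |].
    by rewrite /A0 dn -w1e upd_id.
  rewrite /B1 up; apply: iB b; exact: upd_true_ge.
have hu := IH _ _ us iA0 iB0.
have hx := IH _ _ us iA1 iB0.
have hy := IH _ _ us iA0 iB1.
have hw := IH _ _ us iA1 iB1.
have hor : Pr p s (fun w => box A1 B0 w \/ box A0 B1 w) <= Pr p s (box A1 B1).
  apply: Pr_le => w [|]; exact: box_le.
have hor2 : Pr p s (fun w => box A1 B0 w \/ box A0 B1 w) <=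
    Pr p s (box A1 B0) + Pr p s (box A0 B1) - Pr p s (box A0 B0).
  by apply: Pr_or => w ?; split; apply: box_le; eauto.
rewrite [X in _ <= X * _]/Pr [X in _ <= _ * X]/Pr /=.
have eA c : Ex p s (fun w => ind A (upd w e c)) = Pr p s (fun w => A (upd w e c)) by [].
have eB c : Ex p s (fun w => ind B (upd w e c)) = Pr p s (fun w => B (upd w e c)) by [].
rewrite !eA !eB -/A0 -/A1 -/B0 -/B1.
move: hu hx hy hw hor hor2 H0 H1.
move: (Pr p s A0) (Pr p s A1) (Pr p s B0) (Pr p s B1) => a0 a1 b0 b1.
move: (Pr p s (box A0 B0)) (Pr p s (box A1 B0)) (Pr p s (box A0 B1))
  (Pr p s (box A1 B1)) => u x y z.
set v := Pr p s _; set c0 := Ex p s _; set c1 := Ex p s _.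
have := p0 e; have := p1 e; set q := p e => q1 q0.
move=> hu hx hy hw hor hor2 H0 H1.
have hv : v <= q * (a1 * b1) + (1 - q) * (a1 * b0 + a0 * b1 - u).
  have v1 : v <= a1 * b1 by lra.
  have v2 : v <= a1 * b0 + a0 * b1 - u by lra.
  have := ler_wpM2l q0 v1; have := ler_wpM2l q1 v2; lra.
have h1 := ler_wpM2l q0 H1; have h0 := ler_wpM2l q1 H0.
have h2 := ler_wpM2l q0 hv.
(* The terms in [u] add up to (1 - q)^2 u, so the bound on [u] is needed with exactly this
   factor. *)
have h3 := ler_wpM2l q1 (ler_wpM2l q1 hu).
apply: le_trans (lerD (le_trans h1 h2) h0) _.
rewrite -subr_ge0 in h3; rewrite -subr_ge0; congr (_ <= _) : h3; ring.
Qed.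

End positive.

Lemma Ex_le_p p p' s F : prob_vec p -> prob_vec p' -> (forall e, p e <= p' e) ->
  incr F -> Ex p s F <= Ex p' s F.
Proof.
move=> p01 p'01 pp'; elim: s F => [//|e s IH] F iF /=.
have h1 := IH _ (incr_upd e true iF).
have h0 := IH _ (incr_upd e false iF).
have h : Ex p s (fun w => F (upd w e false)) <= Ex p s (fun w => F (upd w e true)).
  by apply: Ex_le => // w; apply: iF => x; rewrite /upd; case: eqVneq.
have /andP[q'0 q'1] := p'01 e; have qq' := pp' e.
have q'1' : 0 <= 1 - p' e by rewrite subr_ge0.
have qq : 0 <= p' e - p e by rewrite subr_ge0.
move: h1 h0 h => /(ler_wpM2l q'0) h1 /(ler_wpM2l q'1') h0 /(ler_wpM2l qq) h.
lra.
Qed.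

Lemma Pr_le_p p p' s A : prob_vec p -> prob_vec p' -> (forall e, p e <= p' e) ->
  incr_event A -> Pr p s A <= Pr p' s A.
Proof. by move=> *; apply: Ex_le_p => //; apply: ind_incr. Qed.

Lemma Harris_Pr p s A B : prob_vec p -> incr_event A -> incr_event B ->
  Pr p s A * Pr p s B <= Pr p s (fun w => A w /\ B w).
Proof.
move=> p01 iA iB; apply: le_trans (Harris _ _ _ _) _ => //; try exact: ind_incr.
apply: Ex_le => // w; rewrite /ind; case: asboolP => a; case: asboolP => b;
  rewrite ?mulr0 ?mul0r ?mulr1; by case: asboolP => // -[].
Qed.

End expectation.

Section expectation_derivative.
Context {R : realType} {E : eqType}.
Implicit Types (k : E -> R) (s : seq E) (F : (E -> bool) -> R).

(** The weights [k] are left free: besides the weights of the graph, their multiples and truncations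
    are used, mostly with [t] = 1. The parameter [t] is there to be differentiated. *)
Definition pexp k (t : R) (e : E) : R := 1 - expR (- (t * k e)).

Lemma pexp_prob k t : 0 <= t -> (forall e, 0 <= k e) -> prob_vec (pexp k t).
Proof.
move=> t0 k0 e; rewrite /pexp; apply/andP; split; last first.
  by rewrite gerBl expR_ge0.
by rewrite subr_ge0 -expR0 ler_expR oppr_le0 mulr_ge0.
Qed.

Lemma pexp_le k k' t t' e : t * k e <= t' * k' e -> pexp k t e <= pexp k' t' e.
Proof. by move=> h; rewrite /pexp lerB// ler_expR lerN2. Qed.

(** Russo's formula. The derivative of p = [pexp k t e] is k (1 - p), and the factor 1 - p is
    absorbed in the expectation, because [F (upd w e true) - F w] vanishes when [e] is open. *)
Lemma is_derive_Ex k s F (t : R) : uniq s ->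
  is_derive t (1 : R) (fun t => Ex (pexp k t) s F)
    (\sum_(e <- s) k e * Ex (pexp k t) s (fun w => F (upd w e true) - F w)).
Proof.
elim: s F => [|e s IH] F /=; first by rewrite big_nil => _; apply: is_derive_cst.
move=> /andP[es us].
have d1 := IH (fun w => F (upd w e true)) us.
have d0 := IH (fun w => F (upd w e false)) us.
have dq : is_derive t (1 : R) (fun t => 1 - pexp k t e) (- (k e) * (1 - pexp k t e)).
  have -> : (fun t => 1 - pexp k t e) = (fun t => expR (- (k e) * t)).
    by apply/funext => x; rewrite /pexp subKr; congr expR; ring.
  have -> : 1 - pexp k t e = expR (- (k e) * t).
    by rewrite /pexp subKr; congr expR; ring.
  have dl : is_derive t (1 : R) (fun t : R => - (k e) * t) (- (k e)).
    have -> : (fun t : R => - k e * t) = cst (- k e) * id by apply/funext.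
    apply: (@is_derive_eq _ _ _ _ _ _ _ _
      (is_deriveM (is_derive_cst (- k e) t (1 : R)) (is_derive_id t (1 : R)))).
    by rewrite /GRing.scale/= mulr0 addr0 mulr1.
  apply: (@is_derive_eq _ _ _ _ _ _ _ _
    (is_derive1_comp (is_derive_expR (- k e * t)) dl)).
  by rewrite mulrC.
have dp : is_derive t (1 : R) (fun t => pexp k t e) (k e * (1 - pexp k t e)).
  have dB := is_deriveB (is_derive_cst (1 : R) t (1 : R)) dq.
  have -> : k e * (1 - pexp k t e) = 0 - - k e * (1 - pexp k t e).
    by rewrite sub0r mulNr opprK.
  congr (is_derive _ _ _ _) : dB.
  by apply/funext => x; rewrite !fctE subKr.
apply: (@is_derive_eq _ _ _ _ _ _ _ _ (is_deriveD (is_deriveM dp d1) (is_deriveM dq d0))).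
rewrite big_cons /GRing.scale/=.
have e1 : Ex (pexp k t) s (fun w => F (upd (upd w e true) e true) - F (upd w e true)) = 0.
  rewrite -[RHS](Ex_cst (pexp k t) s 0); apply: Ex_ext => w.
  by rewrite upd_upd subrr.
have e0 : Ex (pexp k t) s (fun w => F (upd (upd w e false) e true) - F (upd w e false)) =
   Ex (pexp k t) s (fun w => F (upd w e true)) - Ex (pexp k t) s (fun w => F (upd w e false)).
  by rewrite -ExB; apply: Ex_ext => w; rewrite upd_upd.
rewrite e1 e0.
have sumE : \sum_(f <- s) k f * (pexp k t e *
      Ex (pexp k t) s (fun w => F (upd (upd w e true) f true) - F (upd w e true)) +
      (1 - pexp k t e) *
      Ex (pexp k t) s (fun w => F (upd (upd w e false) f true) - F (upd w e false))) =
    pexp k t e * (\sum_(f <- s) k f *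
      Ex (pexp k t) s (fun w => F (upd (upd w f true) e true) - F (upd w e true))) +
    (1 - pexp k t e) * (\sum_(f <- s) k f *
      Ex (pexp k t) s (fun w => F (upd (upd w f true) e false) - F (upd w e false))).
  rewrite !big_distrr/= -big_split/= !big_seq; apply: eq_bigr => f fs.
  have ef : e != f by apply: contraNneq es => ->.
  have H b : Ex (pexp k t) s (fun w => F (upd (upd w e b) f true) - F (upd w e b)) =
      Ex (pexp k t) s (fun w => F (upd (upd w f true) e b) - F (upd w e b)).
    by apply: Ex_ext => w; rewrite updC.
  by rewrite !H; ring.
rewrite sumE; ring.
Qed.

End expectation_derivative.

(** * Clusters *)

Section clusters.
Context {R : realType} {G : weighted_graph R}.
Local Notation V := (vertex G).
Local Notation E := (edge G).
Implicit Types (w : E -> bool) (e : E) (s : seq E) (u v x y : V) (D : seq V).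

Definition joins e u v : bool :=
  (@ends R G e == (u, v)) || (@ends R G e == (v, u)).

Definition conn w u v : Prop := @open_cluster R G w u v.

Definition restr s w : E -> bool := fun e => (e \in s) && w e.

(** A finite list as witness also covers infinite clusters, and shows that the event is increasing
    and decided by finitely many open edges. *)
Definition big w v n := exists t : seq V,
  [/\ uniq t, size t = n & forall x, x \in t -> conn w v x].

Definition vs s : seq V :=
  undup (flatten [seq [:: (@ends R G e).1; (@ends R G e).2] | e <- s]).

(** The size of the cluster of [u] when [w] is supported by [s] and [u] is an end of an edge of [s].
    For such [w], other vertices get the value 0. *)
Definition ksz s w u : nat := count (fun x => `[< conn w u x >]) (vs s).

Lemma joinsC e u v : joins e u v = joins e v u.
Proof. by rewrite /joins orbC. Qed.

Lemma joins_ends e : joins e (@ends R G e).1 (@ends R G e).2.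
Proof. by rewrite /joins -surjective_pairing eqxx. Qed.

Lemma open_adjacentP w u v :
  @open_adjacent R G w u v <-> exists2 e, w e & joins e u v.
Proof.
split=> [[[e b] [/= we]]|[e we]].
  rewrite /target /origin/=; case: b => /= <- <-; exists e => //.
    by rewrite joinsC joins_ends.
  exact: joins_ends.
move=> /orP[]/eqP eu.
  by exists (e, false); rewrite /target /origin/= eu.
by exists (e, true); rewrite /target /origin/= eu.
Qed.

Lemma conn_refl w u : conn w u u.
Proof. by exists [::]. Qed.

Lemma conn_trans w v u x : conn w u v -> conn w v x -> conn w u x.
Proof.
move=> [p pp <-] [q qq <-]; exists (p ++ q); last by rewrite last_cat.
by rewrite cat_path pp.
Qed.

Lemma conn_edge w e u v : w e -> joins e u v -> conn w u v.
Proof.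
move=> we euv; exists [:: v] => //=; rewrite andbT; apply/asboolP.
by apply/open_adjacentP; exists e.
Qed.

Lemma conn_ind w u (P : V -> Prop) : P u ->
  (forall x y e, P x -> conn w u x -> w e -> joins e x y -> P y) ->
  forall v, conn w u v -> P v.
Proof.
move=> Pu step v [p pp <-] {v}.
elim/last_ind: p pp => [//|p v IH].
rewrite rcons_path last_rcons => /andP[pp /asboolP/open_adjacentP[e we ej]].
by apply: (step (last u p) _ e) => //; [exact: IH|exists p].
Qed.

Lemma conn_sym w u v : conn w u v -> conn w v u.
Proof.
move: v; apply: conn_ind; first exact: conn_refl.
move=> x y e xu _ we ej; apply: conn_trans xu.
by apply: conn_edge we _; rewrite joinsC.
Qed.

Lemma conn_le w w' u v : conf_le w w' -> conn w u v -> conn w' u v.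
Proof.
move=> ww'; move: v; apply: conn_ind; first exact: conn_refl.
move=> x y e ux _ /ww' we ej; apply: conn_trans ux _; exact: conn_edge we ej.
Qed.

Lemma conn_incr u v : incr_event (fun w => conn w u v).
Proof. by move=> w w'; apply: conn_le. Qed.

Lemma big_le w w' v n : conf_le w w' -> big w v n -> big w' v n.
Proof.
by move=> ww' [t [ut st h]]; exists t; split => // x /h; apply: conn_le.
Qed.

Lemma big_incr v n : incr_event (fun w => big w v n).
Proof. by move=> w w'; apply: big_le. Qed.

Lemma big_leq w v m n : (m <= n)%N -> big w v n -> big w v m.
Proof.
move=> mn [t [ut st h]]; exists (take m t); split.
- exact: take_uniq.
- by rewrite size_takel// st.
- by move=> x /mem_take /h.
Qed.

Lemma big_conn w u v n : conn w u v -> big w u n -> big w v n.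
Proof.
move=> uv [t [ut st h]]; exists t; split => // x /h.
by apply: conn_trans; apply: conn_sym.
Qed.

Lemma big_self w v : big w v 1.
Proof. by exists [:: v]; split => // x; rewrite inE => /eqP ->; exact: conn_refl. Qed.

Lemma restr_le s w : conf_le (restr s w) w.
Proof. by move=> e /andP[]. Qed.

Lemma restr_mono s s' w : {subset s <= s'} -> conf_le (restr s w) (restr s' w).
Proof. by move=> ss' e /andP[/ss' es we]; rewrite /restr es. Qed.

Lemma restr_id s w : supported s w -> restr s w = w.
Proof.
move=> sw; apply/funext => e; rewrite /restr; case we : (w e); last by rewrite andbF.
by rewrite (sw _ we).
Qed.

Lemma conn_restr w u v : conn w u v -> exists s, conn (restr s w) u v.
Proof.
move: v; apply: conn_ind; first by exists [::]; exact: conn_refl.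
move=> x y e [s ux] _ we ej; exists (e :: s); apply: (@conn_trans _ x).
  by apply: conn_le ux; apply: restr_mono => f fs; rewrite inE fs orbT.
by apply: conn_edge ej; rewrite /restr mem_head.
Qed.

Lemma big_restr w v n : big w v n -> exists s, big (restr s w) v n.
Proof.
move=> [t [ut st h]].
suff [s hs] : exists s, forall x, x \in t -> conn (restr s w) v x by exists s, t.
elim: t h {ut st} => [|x t IH] h; first by exists [::].
have [|s hs] := IH; first by move=> y yt; apply: h; rewrite inE yt orbT.
have [s' hs'] := conn_restr (h x (mem_head _ _)).
exists (s ++ s') => y; rewrite inE => /orP[/eqP ->|/hs].
  by apply: conn_le hs'; apply: restr_mono => e; rewrite mem_cat => ->; rewrite orbT.
by apply: conn_le; apply: restr_mono => e; rewrite mem_cat => ->.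
Qed.

Lemma mem_vs s e u v : e \in s -> joins e u v -> (u \in vs s) && (v \in vs s).
Proof.
move=> es ej; rewrite /vs !mem_undup; apply/andP; split; apply/flattenP;
  exists [:: (@ends R G e).1; (@ends R G e).2]; rewrite ?(map_f (fun e => [:: (@ends R G e).1; (@ends R G e).2]))//;
  by move: ej => /orP[]/eqP -> /=; rewrite !inE eqxx ?orbT.
Qed.

Lemma mem_vsP s v : v \in vs s -> exists2 e, e \in s & exists u, joins e u v.
Proof.
rewrite /vs mem_undup => /flattenP[_ /mapP[e es ->]]; rewrite !inE => ve.
exists e => //; case/orP: ve => /eqP ->.
  by exists (@ends R G e).2; rewrite joinsC joins_ends.
by exists (@ends R G e).1; rewrite joins_ends.
Qed.

Lemma vs_uniq s : uniq (vs s). Proof. exact: undup_uniq. Qed.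

Lemma vs_sub s s' : {subset s <= s'} -> {subset vs s <= vs s'}.
Proof.
move=> ss' v /mem_vsP[e es [u ej]].
by have /andP[] := mem_vs (ss' _ es) ej.
Qed.

Lemma conn_supp s w u v : supported s w -> conn w u v -> u = v \/ (u \in vs s /\ v \in vs s).
Proof.
move=> sw; move: v; apply: conn_ind; first by left.
move=> x y e [<-|[ux xs]] _ /sw es ej; right; have /andP[? ?] := mem_vs es ej => //.
Qed.

Lemma conn_vs s w u v : supported s w -> u \in vs s -> conn w u v -> v \in vs s.
Proof. by move=> sw us /(conn_supp sw)[<-|[]]. Qed.

Lemma big_ksz s w u n : supported s w -> u \in vs s -> big w u n -> (n <= ksz s w u)%N.
Proof.
move=> sw us [t [ut <- h]]; rewrite /ksz -size_filter; apply: uniq_leq_size => // x xt.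
rewrite mem_filter; have hx := h _ xt; rewrite asboolT//=.
exact: conn_vs hx.
Qed.

Lemma ksz_le s s' w w' u : {subset s <= s'} -> conf_le w w' ->
  (ksz s w u <= ksz s' w' u)%N.
Proof.
move=> ss' ww'; rewrite /ksz -!size_filter; apply: uniq_leq_size.
  by rewrite filter_uniq// vs_uniq.
move=> x; rewrite !mem_filter => /andP[/asboolP ux xs].
by rewrite (vs_sub ss')// asboolT//; apply: conn_le ux.
Qed.

Lemma conn_ksz s w u v : conn w u v -> ksz s w u = ksz s w v.
Proof.
move=> uv; rewrite /ksz; apply: eq_count => x; apply/asbool_equiv_eq; split.
  by apply: conn_trans; apply: conn_sym.
exact: conn_trans.
Qed.

End clusters.

(** * Invariance of clusters under automorphisms *)

Section transport.
Context {R : realType} {G : weighted_graph R}.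
Local Notation V := (vertex G).
Local Notation E := (edge G).
Variables (f f' : V -> V) (g g' : E -> E).
Hypotheses (fK : cancel f f') (f'K : cancel f' f) (gK : cancel g g') (g'K : cancel g' g).
Hypothesis gends : forall e, same_ends (@ends R G (g e))
  (f (@ends R G e).1, f (@ends R G e).2).

Lemma joins_map e u v : joins (g e) (f u) (f v) = joins e u v.
Proof.
have fI := can_inj fK.
have [H|H] := gends e; rewrite /joins H /= !xpair_eqE !(inj_eq fI);
  case: (@ends R G e) => a b /=; rewrite !xpair_eqE//.
by rewrite orbC; congr (_ || _); rewrite andbC.
Qed.

Lemma conn_map w u v : conn w u v -> conn (w \o g') (f u) (f v).
Proof.
move: v; apply: conn_ind; first exact: conn_refl.
move=> x y e ux _ we ej; apply: conn_trans ux _.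
by apply: (@conn_edge _ _ _ (g e)); rewrite ?joins_map//= gK.
Qed.
End transport.

Section transport_iff.
Context {R : realType} {G : weighted_graph R}.
Local Notation V := (vertex G).
Local Notation E := (edge G).
Variables (f f' : V -> V) (g g' : E -> E).
Hypotheses (fK : cancel f f') (f'K : cancel f' f) (gK : cancel g g') (g'K : cancel g' g).
Hypothesis gends : forall e, same_ends (@ends R G (g e))
  (f (@ends R G e).1, f (@ends R G e).2).

Lemma gends_inv e : same_ends (@ends R G (g' e))
  (f' (@ends R G e).1, f' (@ends R G e).2).
Proof.
have := gends (g' e); rewrite g'K /same_ends => -[] -> /=; rewrite !fK;
  case: (ends (g' e)) => a b /=; by [left|right].
Qed.

Lemma conn_mapE w u v : conn (w \o g') (f u) (f v) <-> conn w u v.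
Proof.
split=> [h|]; last exact: (conn_map fK gK gends).
have := conn_map f'K g'K gends_inv h; rewrite !fK; congr conn.
by apply/funext => e /=; rewrite gK.
Qed.

Lemma big_transport w u n : big w u n -> big (w \o g') (f u) n.
Proof.
move=> [t [ut st h]]; exists (map f t); split.
- by rewrite map_inj_uniq//; exact: can_inj fK.
- by rewrite size_map.
- by move=> _ /mapP[x xt ->]; apply/conn_mapE; apply: h.
Qed.

Lemma big_mapE w u n : big (w \o g') (f u) n <-> big w u n.
Proof.
split; last exact: big_transport.
move=> [t [ut st h]]; exists (map f' t); split.
- by rewrite map_inj_uniq//; exact: can_inj f'K.
- by rewrite size_map.
- by move=> _ /mapP[x xt ->]; apply/conn_mapE; rewrite f'K; apply: h.
Qed.

Lemma vs_map s x : (f x \in vs (map g s)) = (x \in vs s).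
Proof.
apply/idP/idP.
  move=> /mem_vsP[_ /mapP[e es ->] [u]]; rewrite -(f'K u) (joins_map fK gends) => ej.
  by have /andP[] := mem_vs es ej.
move=> /mem_vsP[e es [u ej]].
have : joins (g e) (f u) (f x) by rewrite (joins_map fK gends).
by move=> /(mem_vs (map_f g es)) /andP[].
Qed.

Lemma ksz_map s w u : ksz (map g s) (w \o g') (f u) = ksz s w u.
Proof.
rewrite /ksz (@permP _ (vs (map g s)) (map f (vs s)) _).
  rewrite count_map; apply: eq_count => x /=; apply/asbool_equiv_eq.
  exact: conn_mapE.
apply: uniq_perm; rewrite ?vs_uniq ?map_inj_uniq ?vs_uniq//; first exact: can_inj fK.
move=> x; rewrite -(f'K x) vs_map; rewrite mem_map//; exact: can_inj fK.
Qed.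

End transport_iff.

(** * Cluster sizes in a finite set of vertices *)

Section trees.
Context {R : realType} {G : weighted_graph R}.
Local Notation V := (vertex G).
Local Notation E := (edge G).
Implicit Types (w : E -> bool) (e : E) (S s : seq E) (u v x y : V) (T : seq V).

Definition opens S : E -> bool := fun e => e \in S.

(** A rooted tree is built by hanging one tree at a time below the root of another. A node of any
    degree is thus split in binary steps, which lets [tree_split] descend by structural
    induction. *)
Inductive tree : V -> seq V -> seq E -> Prop :=
| tree_root u : tree u [:: u] [::]
| tree_join u v T1 T2 S1 S2 e : tree u T1 S1 -> tree v T2 S2 ->
    (forall x, x \in T1 -> x \notin T2) -> joins e u v ->
    tree u (T1 ++ T2) (e :: S1 ++ S2).

Lemma joins_inj e u v x y : joins e u v -> joins e x y ->
  (x = u /\ y = v) \/ (x = v /\ y = u).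
Proof.
by move=> /orP[]/eqP h /orP[]/eqP; rewrite h => -[-> ->]; [left|right|right|left].
Qed.

Lemma tree_mem_root u T S : tree u T S -> u \in T.
Proof.
by elim=> [{}u|{}u v T1 T2 S1 S2 e _ u1 _ _ _ _]; rewrite ?mem_head ?mem_cat ?u1.
Qed.

Lemma tree_edges u T S : tree u T S -> forall e x y, e \in S -> joins e x y ->
  x \in T /\ y \in T.
Proof.
elim=> [//|{}u v T1 T2 S1 S2 f t1 IH1 t2 IH2 _ fuv] e x y.
rewrite !inE !mem_cat => /or3P[/eqP -> ej|/IH1 h /h[-> ->]//|/IH2 h /h[-> ->]].
  have u1 := tree_mem_root t1; have v2 := tree_mem_root t2.
  by have [[-> ->]|[-> ->]] := joins_inj fuv ej; rewrite ?u1 ?v2 ?orbT.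
by rewrite !orbT.
Qed.

Lemma tree_conn u T S : tree u T S -> forall x, x \in T -> conn (opens S) u x.
Proof.
elim=> [{}u x|{}u v T1 T2 S1 S2 f t1 IH1 t2 IH2 _ fuv x].
  by rewrite inE => /eqP ->; exact: conn_refl.
rewrite mem_cat => /orP[/IH1|/IH2 h].
  by apply: conn_le; rewrite /opens => e eS; rewrite inE mem_cat eS orbT.
apply: (@conn_trans _ _ _ v); first by apply: (conn_edge (e := f)); rewrite /opens// mem_head.
by apply: conn_le h; rewrite /opens => e eS; rewrite inE mem_cat eS !orbT.
Qed.

Lemma tree_leaf u T S x y e : tree u T S -> x \in T -> y \notin T ->
  joins e x y -> exists T' S', [/\ tree u T' S',
    forall z, (z \in T') = (z == y) || (z \in T) & {subset S' <= e :: S}].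
Proof.
move=> t; elim: t x => [{}u|{}u v T1 T2 S1 S2 f t1 IH1 t2 IH2 dis fuv] x.
  rewrite !inE => /eqP -> yu ej; exists ([:: u] ++ [:: y]), (e :: [::] ++ [::]).
  split=> //.
    apply: tree_join ej; [exact: tree_root|exact: tree_root|].
    by move=> z; rewrite !inE => /eqP ->; rewrite eq_sym.
  by move=> z; rewrite !inE orbC.
rewrite !mem_cat negb_or => xT /andP[y1 y2] ej; case/orP: xT => [x1|x2].
  have [T' [S' [t' T'E S'S]]] := IH1 _ x1 y1 ej.
  exists (T' ++ T2), (f :: S' ++ S2); split.
  - apply: tree_join t' t2 _ fuv => z; rewrite T'E => /orP[/eqP ->//|]; exact: dis.
  - by move=> z; rewrite !mem_cat T'E orbA.
  - move=> z; rewrite !inE !mem_cat => /or3P[->|/S'S|->]; rewrite ?orbT//.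
    by rewrite inE => /orP[]->; rewrite ?orbT.
have [T' [S' [t' T'E S'S]]] := IH2 _ x2 y2 ej.
exists (T1 ++ T'), (f :: S1 ++ S'); split.
- apply: tree_join t1 t' _ fuv => z z1; rewrite T'E negb_or dis// andbT.
  by apply: contraNneq y1 => <-.
- by move=> z; rewrite !mem_cat T'E orbCA.
- move=> z; rewrite !inE !mem_cat => /or3P[->|->|/S'S]; rewrite ?orbT//.
  by rewrite inE => /orP[]->; rewrite ?orbT.
Qed.

(** A path from the root to a new vertex is followed step by step; each vertex not yet in the tree
    is added as a leaf. *)
Lemma tree_cover w u (t : seq V) : (forall x, x \in t -> conn w u x) ->
  exists T S, [/\ tree u T S, {subset t <= T} & conf_le (opens S) w].
Proof.
elim: t => [|x t IH] h.
  by exists [:: u], [::]; split => //; exact: tree_root.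
have [|T [S [tr tT Sw]]] := IH; first by move=> y yt; apply: h; rewrite inE yt orbT.
suff [T' [S' [tr' TT' xT' S'w]]] : exists T' S',
    [/\ tree u T' S', {subset T <= T'}, x \in T' & conf_le (mem S') w].
  by exists T', S'; split => // y; rewrite inE => /orP[/eqP ->//|/tT/TT'].
have := h _ (mem_head _ _); move: (x); apply: conn_ind.
  by exists T, S; split => //; exact: tree_mem_root tr.
move=> a b e [T' [S' [tr' TT' aT' S'w]]] _ we ej.
have [bT'|bT'] := boolP (b \in T'); first by exists T', S'.
have [T'' [S'' [tr'' TE SE]]] := tree_leaf tr' aT' bT' ej.
exists T'', S''; split => //.
- by move=> z /TT' zT; rewrite TE zT orbT.
- by rewrite TE eqxx.
- by move=> f /SE; rewrite inE => /orP[/eqP ->//|]; exact: S'w.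
Qed.

Variable L : seq V.

Let wt T := count (fun x => x \in T) L.

Let wt_cat T1 T2 : (wt (T1 ++ T2) <= wt T1 + wt T2)%N.
Proof.
rewrite /wt -count_predUI; apply: leq_trans (leq_addr _ _).
by apply: sub_count => x /=; rewrite mem_cat.
Qed.

Let wt_sub T1 T2 : {subset T1 <= T2} -> (wt T1 <= wt T2)%N.
Proof. by move=> h; apply: sub_count => x /h. Qed.

(** Descend into a branch of weight at least M as long as there is one. Where both branches weigh
    less than M, their union weighs less than 2 M and is cut off; the rest stays connected to the
    root. Only the edge sets are disjoint: a vertex may belong to both pieces. *)
Lemma tree_split u T S M : uniq L -> (0 < M)%N -> tree u T S -> (M <= wt T)%N ->
  exists Ta Tb Sa Sb v,
  [/\ {subset T <= Ta ++ Tb} /\ (M <= wt Tb <= 2 * M)%N,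
      forall x, x \in Ta -> conn (opens Sa) u x,
      forall x, x \in Tb -> conn (opens Sb) v x,
      {subset Sa <= S} /\ {subset Sb <= S} &
      forall e, ~~ ((e \in Sa) && (e \in Sb))].
Proof.
move=> uL M0; elim=> [{}u|{}u v T1 T2 S1 S2 f t1 IH1 t2 IH2 dis fuv] MT.
  exists [:: u], [:: u], [::], [::], u; split => //.
  - split; first by move=> x; rewrite mem_cat => ->.
    rewrite MT/= /wt; have -> : count (fun x => x \in [:: u]) L = (u \in L).
      rewrite -(count_uniq_mem _ uL); apply: eq_count => x /=.
      by rewrite inE eq_sym.
    by case: (u \in L); lia.
  - by move=> x; rewrite inE => /eqP ->; exact: conn_refl.
  - by move=> x; rewrite inE => /eqP ->; exact: conn_refl.
have u1 := tree_mem_root t1; have v2 := tree_mem_root t2.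
have fS1 : f \notin S1.
  apply/negP => fS; have [_ v1] := tree_edges t1 fS fuv.
  by have := dis _ v1; rewrite v2.
have fS2 : f \notin S2.
  apply/negP => fS; have [uT2 _] := tree_edges t2 fS fuv.
  by have := dis _ u1; rewrite uT2.
have S12 e : e \in S1 -> e \notin S2.
  move=> eS1; apply/negP => eS2.
  have [x1 _] := tree_edges t1 eS1 (joins_ends e).
  have [x2 _] := tree_edges t2 eS2 (joins_ends e).
  by have := dis _ x1; rewrite x2.
have [M2|M2] := leqP M (wt T2).
  have [Ta [Tb [Sa [Sb [z [[TT h] ca cb [sa sb] d]]]]]] := IH2 M2.
  exists (T1 ++ Ta), Tb, (f :: S1 ++ Sa), Sb, z; split => //.
  - split=> // x; rewrite !mem_cat => /orP[->//|/TT].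
    by rewrite mem_cat => /orP[]->; rewrite ?orbT.
  - move=> x; rewrite mem_cat => /orP[/(tree_conn t1)|/ca cx].
      by apply: conn_le; rewrite /opens => e eS; rewrite inE mem_cat eS orbT.
    apply: (@conn_trans _ _ _ v); first by apply: (conn_edge (e := f)); rewrite /opens// mem_head.
    by apply: conn_le cx; rewrite /opens => e eS; rewrite inE mem_cat eS !orbT.
  - split=> e.
      rewrite !inE !mem_cat => /or3P[->//|->|/sa ->]; by rewrite ?orbT.
    by move=> /sb eS; rewrite inE mem_cat eS !orbT.
  - move=> e; apply/negP => /andP[]; rewrite inE mem_cat => /or3P[/eqP ->|e1|ea] eb.
    + by move: fS2; rewrite sb.
    + by have := S12 _ e1; rewrite sb.
    + by have := d e; rewrite ea eb.
have [M1|M1] := leqP M (wt T1).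
  have [Ta [Tb [Sa [Sb [z [[TT h] ca cb [sa sb] d]]]]]] := IH1 M1.
  exists (Ta ++ T2), Tb, (f :: Sa ++ S2), Sb, z; split => //.
  - split=> // x; rewrite !mem_cat => /orP[/TT|->]; rewrite ?orbT//.
    by rewrite mem_cat => /orP[]->; rewrite ?orbT.
  - move=> x; rewrite mem_cat => /orP[/ca|/(tree_conn t2) cx].
      by apply: conn_le; rewrite /opens => e eS; rewrite inE mem_cat eS orbT.
    apply: (@conn_trans _ _ _ v); first by apply: (conn_edge (e := f)); rewrite /opens// mem_head.
    by apply: conn_le cx; rewrite /opens => e eS; rewrite inE mem_cat eS !orbT.
  - split=> e.
      rewrite !inE !mem_cat => /or3P[->//|/sa ->|->]; by rewrite ?orbT.
    by move=> /sb eS; rewrite inE mem_cat eS !orbT.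
  - move=> e; apply/negP => /andP[]; rewrite inE mem_cat => /or3P[/eqP ->|ea|e2] eb.
    + by move: fS1; rewrite sb.
    + by have := d e; rewrite ea eb.
    + by have := S12 _ (sb _ eb); rewrite e2.
exists [:: u], (T1 ++ T2), [::], (f :: S1 ++ S2), u; split => //.
- split; first by move=> x xT; rewrite mem_cat xT orbT.
  rewrite MT/=; apply: leq_trans (wt_cat _ _) _; lia.
- by move=> x; rewrite inE => /eqP ->; exact: conn_refl.
- exact: (tree_conn (tree_join t1 t2 dis fuv)).
- by split.
Qed.

Definition hits w u := count (fun x => `[< conn w u x >]) L.

Lemma hits_le w w' u : conf_le w w' -> (hits w u <= hits w' u)%N.
Proof.
move=> ww'; apply: sub_count => x /asboolP ux; apply/asboolP.
exact: conn_le ux.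
Qed.

Lemma hits_incr k u : incr_event (fun w => (k <= hits w u)%N).
Proof. by move=> w w' /hits_le h /leq_trans; apply. Qed.

(** A tree of open edges covering the vertices of [L] in the cluster is cut into a piece with
    between M and 2 M of them and a piece containing [u] that keeps at least k. *)
Lemma hits_box w u k M : uniq L -> (0 < M)%N -> (k + 2 * M <= hits w u)%N ->
  box (fun w => (k <= hits w u)%N) (fun w => exists v, (M <= hits w v)%N) w.
Proof.
move=> uL M0 kh.
have [|T [S [tr tT Sw]]] := @tree_cover w u [seq x <- L | `[< conn w u x >]].
  by move=> x; rewrite mem_filter => /andP[/asboolP].
have hT : (hits w u <= wt T)%N.
  rewrite /hits -size_filter /wt -size_filter; apply: uniq_leq_size.
    exact: filter_uniq.
  by move=> x xL; have := tT _ xL; move: xL; rewrite !mem_filter => /andP[_ ->] ->.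
have [|Ta [Tb [Sa [Sb [v [[TT h] ca cb [sa sb] d]]]]]] := tree_split uL M0 tr.
  by lia.
exists (opens Sa), (opens Sb); split.
- by move=> e /= /sa; apply: Sw.
- by move=> e /= /sb; apply: Sw.
- exact: d.
- have h1 : (wt Ta <= hits (opens Sa) u)%N.
    by apply: sub_count => x /ca ?; apply/asboolP.
  case/andP: h => _ h; rewrite -(leq_add2r (2 * M)) (leq_trans kh)//.
  apply: (leq_trans hT); apply: (leq_trans (wt_sub TT)).
  by apply: (leq_trans (wt_cat _ _)); exact: leq_add.
- exists v; have h1 : (wt Tb <= hits (opens Sb) v)%N.
    by apply: sub_count => x /cb ?; apply/asboolP.
  by case/andP: h => h _; exact: leq_trans h h1.
Qed.

Lemma hits_big w u k : uniq L -> (k <= hits w u)%N -> big w u k.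
Proof.
move=> uL kh; apply: big_leq kh _; exists [seq x <- L | `[< conn w u x >]].
split; [exact: filter_uniq|by rewrite size_filter|].
by move=> x; rewrite mem_filter => /andP[/asboolP].
Qed.

(** Levels are counted one by one up to M, then in blocks of 2 M, the loss in one application of
    [hits_box]. *)
Lemma leq_block_sum (h M J : nat) : (h <= M + 2 * M * J)%N ->
  (h <= \sum_(k < M) (k.+1 <= h)%N + 2 * M * \sum_(j < J) (M + 2 * M * j <= h)%N)%N.
Proof.
have hM : (minn h M <= \sum_(k < M) (k.+1 <= h)%N)%N.
  elim: M => [|M IH]; first by rewrite minn0.
  rewrite big_ord_recr/=; move: IH; move: (\sum_(k < M) _)%N => S0.
  by move=> h0; case: (ltnP M h) => hM /=; lia.
elim: J => [|J IH] hJ; first by rewrite big_ord0; lia.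
rewrite big_ord_recr/=; have [h1|h1] := leqP h (M + 2 * M * J).
  by have := IH h1; move: (\sum_(k < M) _)%N (\sum_(j < J) _)%N => S0 S1; rewrite mulnDr; lia.
rewrite (ltnW h1) [X in (2 * M * (X + _))%N](eq_bigr (fun=> 1%N)).
  rewrite sum1_card card_ord.
  move: hM h1 hJ; move: (\sum_(k < M) _)%N => S0 hM h1 hJ.
  have e1 : (2 * M * (J + 1) = 2 * M * J + 2 * M)%N by rewrite mulnDr muln1.
  have e2 : (2 * M * J.+1 = 2 * M * J + 2 * M)%N by rewrite mulnS addnC.
  change (h <= S0 + 2 * M * (J + 1))%N.
  by have [h2|h2] := leqP h M; lia.
move=> j _; have := ltn_ord j; move: (nat_of_ord j) => {}j jJ.
suff -> : (M + 2 * M * j <= h)%N by [].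
have : (2 * M * j <= 2 * M * J)%N by apply: leq_mul => //; exact: ltnW.
lia.
Qed.

Variables (p : E -> R) (p01 : prob_vec p) (s : seq E) (us : uniq s).
Variable Q : nat -> R.
Hypothesis Qbig : forall v n, Pr p s (fun w => big w v n) <= Q n.
Hypothesis uL : uniq L.

(** Markov's inequality: on this event at least M vertices of [L] lie in a cluster with at least M
    vertices. *)
Lemma Pr_big_hits M : (0 < M)%N ->
  Pr p s (fun w => exists v, (M <= hits w v)%N) <= (size L)%:R * Q M / M%:R.
Proof.
move=> M0; have M0' : (0 : R) < M%:R by rewrite ltr0n.
rewrite ler_pdivlMr//.
have -> : (size L)%:R * Q M = \sum_(x <- L) Q M.
  by rewrite big_const_seq count_predT iter_addr_0 mulr_natl.
apply: (@le_trans _ _ (\sum_(x <- L) Pr p s (fun w => big w x M))); last first.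
  exact: ler_sum.
rewrite /Pr -Ex_sum mulrC -ExZ; apply: Ex_le => // w.
have H : \sum_(x <- L) ind (fun w => big w x M) w =
    (count (fun x => `[< big w x M >]) L)%:R :> R.
  rewrite -sum1_count natr_sum [RHS]big_mkcond/=; apply: eq_bigr => x _.
  by rewrite /ind; case: ifP.
rewrite H {1}/ind; case: asboolP => [[v hv]|_]; last by rewrite mulr0 ler0n.
rewrite mulr1 ler_nat (leq_trans hv)//; apply: sub_count => x /asboolP vx.
apply/asboolP; exact: (big_conn vx (hits_big uL hv)).
Qed.

(* If no cluster is likely to meet L in M vertices, then by BK the number of vertices
   of L in a given cluster has an exponential tail at scale M. *)
Lemma tightness o M : (0 < M)%N -> (size L)%:R * Q M / M%:R <= 1 / 2 ->
  \sum_(x <- L) Pr p s (fun w => conn w o x) <=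
  \sum_(k < M) Q k.+1 + 4 * M%:R * Q M.
Proof.
move=> M0 hM.
pose B w := exists v, (M <= hits w v)%N.
have PB : Pr p s B <= 1 / 2 by apply: le_trans (Pr_big_hits M0) hM.
have iB : incr_event B.
  by move=> w w' ww' [v hv]; exists v; apply: leq_trans hv (hits_le _ ww').
have Q0 n : 0 <= Q n by apply: le_trans (Qbig o n); exact: Pr_ge0.
have step k : Pr p s (fun w => (k + 2 * M <= hits w o)%N) <=
    Pr p s (fun w => (k <= hits w o)%N) * (1 / 2).
  apply: (@le_trans _ _ (Pr p s (box (fun w => (k <= hits w o)%N) B))).
    by apply: Pr_le => // w; exact: hits_box.
  apply: le_trans (BK p01 us _ iB) _; first exact: hits_incr.
  by apply: ler_wpM2l PB; exact: Pr_ge0.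
have hk k : Pr p s (fun w => (k <= hits w o)%N) <= Q k.
  by apply: le_trans (Qbig o k); apply: Pr_le => // w; exact: hits_big.
have tail j : Pr p s (fun w => (M + 2 * M * j <= hits w o)%N) <= Q M * (1 / 2) ^+ j.
  elim: j => [|j IH]; first by rewrite expr0 mulr1 muln0 addn0; exact: hk.
  have -> : (M + 2 * M * j.+1 = (M + 2 * M * j) + 2 * M)%N by lia.
  apply: le_trans (step _) _; rewrite exprSr.
  by move: IH; set x := Pr _ _ _; set y := _ ^+ j => IH; lra.
have -> : \sum_(x <- L) Pr p s (fun w => conn w o x) = Ex p s (fun w => (hits w o)%:R).
  rewrite /Pr -Ex_sum; apply: Ex_ext => w.
  rewrite /hits -sum1_count natr_sum [RHS]big_mkcond/=; apply: eq_bigr => x _.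
  by rewrite /ind; case: ifP.
(* Since no cluster hits [L] more than [size L] times, this many blocks suffice. *)
pose J := size L.
have hJ w : (hits w o <= M + 2 * M * J)%N.
  have : (hits w o <= J)%N by exact: count_size.
  have : (J <= M * J)%N by exact: leq_pmull.
  lia.
apply: (@le_trans _ _ (Ex p s (fun w =>
    \sum_(k < M) ind (fun w => (k.+1 <= hits w o)%N) w +
    2 * M%:R * \sum_(j < J) ind (fun w => (M + 2 * M * j <= hits w o)%N) w))).
  apply: Ex_le => // w; have := leq_block_sum (hJ w); rewrite -(ler_nat R).
  move=> /le_trans; apply; rewrite natrD !natrM !natr_sum.
  have indE k : ind (fun w => (k <= hits w o)%N) w = (k <= hits w o)%N%:R :> R.
    by rewrite /ind asboolb; case: (_ <= _)%N.
  by under eq_bigr do rewrite -indE; under [X in _ * X]eq_bigr do rewrite -indE.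
rewrite ExD ExZ !Ex_sum; apply: lerD.
  by apply: ler_sum => k _; exact: hk.
(* Blocks have length 2 M, and the geometric series of ratio 1/2 is at most 2. *)
have -> : 4 * M%:R * Q M = 2 * M%:R * (Q M * 2) by ring.
apply: ler_wpM2l; first by rewrite mulr_ge0// ler0n.
apply: (@le_trans _ _ (\sum_(j < J) Q M * (1 / 2) ^+ j)).
  by apply: ler_sum => j _; exact: tail.
rewrite -big_distrr/=; apply: ler_wpM2l => //.
have -> : \sum_(j < J) (1 / 2) ^+ j = 2 - 2 * (1 / 2) ^+ J :> R.
  elim: J {hJ} => [|J IH]; first by rewrite big_ord0 expr0; ring.
  by rewrite big_ord_recr/= IH exprS; field.
have : 0 <= (1 / 2 : R) ^+ J by apply: exprn_ge0; lra.
lra.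
Qed.

End trees.

(** * Sharpness of the phase transition *)

Lemma Ex_filter (R : realType) (E : eqType) (p : E -> R) s (a : pred E) F :
  Ex p s (fun w => F (fun e => w e && a e)) = Ex p [seq e <- s | a e] F.
Proof.
elim: s F => [//|e s IH] F /=.
case: ifP => ae /=.
  rewrite -!IH; congr (_ * _ + _ * _); apply: Ex_ext => w; congr F;
    apply/funext => x; rewrite /upd; by case: eqVneq => // ->; rewrite ae.
rewrite -IH.
have H b : Ex p s (fun w => F (fun x => upd w e b x && a x)) =
    Ex p s (fun w => F (fun x => w x && a x)).
  apply: Ex_ext => w; congr F; apply/funext => x; rewrite /upd.
  by case: eqVneq => // ->; rewrite ae !andbF.
rewrite !H; ring.
Qed.

Lemma ler_sum_subset (R : numDomainType) (I : eqType) (r r' : seq I) (P : pred I)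
    (F : I -> R) : uniq r -> uniq r' -> {subset r <= r'} -> (forall i, 0 <= F i) ->
  \sum_(i <- r | P i) F i <= \sum_(i <- r' | P i) F i.
Proof.
move=> + + + F0; elim: r r' => [|i r IH] r' /=.
  by move=> _ _ _; rewrite big_nil sumr_ge0.
move=> /andP[ir ur] ur' rr'; have ir' : i \in r' by apply: rr'; rewrite mem_head.
rewrite big_cons (big_rem i ir')/=.
have IH' : \sum_(i <- r | P i) F i <= \sum_(i <- rem i r' | P i) F i.
  apply: IH => //; first exact: rem_uniq.
  move=> j jr; rewrite mem_rem_uniq// inE rr' ?inE ?jr ?orbT// andbT.
  by apply: contraNneq ir => <-.
by case: ifP => // _; [exact: lerD|rewrite add0r].
Qed.

Section sharpness.
Context {R : realType} {G : weighted_graph R}.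
Local Notation V := (vertex G).
Local Notation E := (edge G).
Implicit Types (w : E -> bool) (e : E) (s : seq E) (u v x y o : V) (S T : seq V).

Definition inside S e : bool := ((@ends R G e).1 \in S) && ((@ends R G e).2 \in S).

Definition conn_in S w x y := conn (fun e => w e && inside S e) x y.

Definition exits e x S : bool :=
  [|| ((@ends R G e).1 == x) && ((@ends R G e).2 \notin S) |
      ((@ends R G e).2 == x) && ((@ends R G e).1 \notin S)].

Definition other e x := if (@ends R G e).1 == x then (@ends R G e).2 else (@ends R G e).1.

(** The functional of Duminil-Copin and Tassion. An exit edge is counted with [k e] instead of its
    probability: this is the factor in Russo's formula, and it dominates the probability at [t] =
    1. *)
Definition phi (k : E -> R) t s S o :=
  \sum_(x <- S) \sum_(e <- s | exits e x S) k e * Pr (pexp k t) s (fun w => conn_in S w o x).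

Lemma joins_inside e u v S : joins e u v -> inside S e = (u \in S) && (v \in S).
Proof. by rewrite /joins /inside => /orP[]/eqP -> //=; rewrite andbC. Qed.

Lemma exitsP e x S : x \in S -> exits e x S -> joins e x (other e x) /\ other e x \notin S.
Proof.
move=> xS; rewrite /exits /other /joins.
case: (@ends R G e) => a b /=; rewrite !xpair_eqE; have [->|ax] := eqVneq a x => /=.
  by rewrite eqxx/= xS/= andbF orbF => ->.
by move=> /andP[/eqP -> ->]; rewrite !eqxx ?orbT.
Qed.

Lemma joins_exits e x y S : joins e x y -> x \in S -> y \notin S ->
  exits e x S /\ other e x = y.
Proof.
rewrite /joins /exits /other => /orP[]/eqP -> /= xS yS; rewrite !eqxx yS ?orbT; split => //.
by case: eqVneq => // yx; move: yS; rewrite yx xS.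
Qed.

Lemma exits_inj e x y S : x \in S -> y \in S -> exits e x S -> exits e y S -> x = y.
Proof.
move=> xS yS /(exitsP xS)[jx ox] /(exitsP yS)[jy oy].
move: jx jy; rewrite /joins => /orP[]/eqP h /orP[]/eqP; rewrite h => -[h1 h2] //.
  by move: ox; rewrite h2 yS.
by move: ox; rewrite h1 yS.
Qed.

Lemma conn_in_incr S x y : incr_event (fun w => conn_in S w x y).
Proof.
by move=> w w' ww'; apply: conn_le => e /andP[/ww' -> ->].
Qed.

Lemma phi_subset k t s s' S o : 0 <= t -> (forall e, 0 <= k e) -> uniq s -> uniq s' ->
  {subset s <= s'} -> phi k t s S o <= phi k t s' S o.
Proof.
move=> t0 k0 us us' ss'; apply: ler_sum => x _.
have pp : prob_vec (pexp k t) by exact: pexp_prob.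
rewrite -!big_distrl/=; apply: ler_pM.
- exact: sumr_ge0.
- exact: Pr_ge0.
- exact: ler_sum_subset.
- by apply: Pr_subset => //; exact: conn_in_incr.
Qed.

Lemma path_conn w A u q : path (fun x y => `[< @open_adjacent R G w x y >]) u q ->
  {subset u :: q <= A} -> conn_in A w u (last u q).
Proof.
elim: q u => [|v q IH] u /=; first by move=> _ _; exact: conn_refl.
move=> /andP[/asboolP/open_adjacentP[e we ej] pq] sA.
apply: (@conn_trans _ _ _ v); last first.
  by apply: IH => // x xq; apply: sA; rewrite inE xq orbT.
apply: (conn_edge (e := e)) => //=.
by rewrite we (joins_inside _ ej) !sA// !inE eqxx ?orbT.
Qed.

(* Cutting a simple open path at its first exit from S gives pieces without common edges. *)
Lemma conn_exit w u y S : u \in S -> y \notin S -> conn w u y ->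
  exists x e, [/\ x \in S, w e, exits e x S &
    box (fun w => conn_in S w u x)
      (box (fun w => w e) (fun w => conn w (other e x) y)) w].
Proof.
move=> uS yS [q0 pq0].
case/shortenP: pq0 => q pq uq _ yq {q0}.
have [q1 [v [q2 [qE q1S vS]]]] : exists q1 v q2,
    [/\ q = q1 ++ v :: q2, {subset q1 <= S} & v \notin S].
  elim: q u uS pq uq yq => [|a q IH] u uS /=.
    by move=> _ _ uy; move: yS; rewrite -uy uS.
  move=> /andP[_ pq] /andP[_ uq] yq; have [aS|aS] := boolP (a \in S).
    have [q1 [v [q2 [qE q1S vS]]]] := IH a aS pq uq yq.
    exists (a :: q1), v, q2; split => //; first by rewrite qE.
    by move=> z; rewrite inE => /orP[/eqP ->//|/q1S].
  by exists [::], a, q.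
move: pq uq yq; rewrite qE -cat_cons cat_path cat_uniq last_cat /=.
move=> /and3P[pq1 /asboolP/open_adjacentP[e we ej] pq2] /and3P[_ /norP[vq1 hq2] _] yq2.
have xS : last u q1 \in S.
  by have := mem_last u q1; rewrite inE => /orP[/eqP ->//|/q1S].
have [ex ov] := joins_exits ej xS vS.
exists (last u q1), e; split => //.
exists (fun f => w f && inside (u :: q1) f),
  (fun f => (f == e) || (w f && inside (v :: q2) f)); split.
- by move=> f /andP[].
- by move=> f /orP[/eqP ->//|/andP[]].
- move=> f; apply/negP => /andP[/andP[wf i1] /orP[/eqP fe|/andP[_ i2]]].
    by move: i1; rewrite fe (joins_inside _ ej) (negbTE vq1) andbF.
  move: i1 i2; rewrite /inside => /andP[f1 _] /andP[f2 _].
  move: f2; rewrite inE => /orP[/eqP f2|f2]; first by move: vq1; rewrite -f2 f1.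
  by move/hasPn: hq2 => /(_ _ f2); rewrite f1.
- apply: conn_le (path_conn pq1 (A := u :: q1) _) => //.
  move=> f /andP[/[swap] i1 ->]; rewrite i1/=; move: i1 => /andP[i1 i2].
  have sub x : x \in u :: q1 -> x \in S.
    by rewrite inE => /orP[/eqP ->//|/q1S].
  by rewrite /inside !sub.
exists (pred1 e), (fun f => w f && inside (v :: q2) f); split.
- by move=> f /= ->.
- by move=> f ->; rewrite orbT.
- move=> f /=; apply/negP => /andP[/eqP -> /andP[_]].
  rewrite (joins_inside _ ej) => /andP[h _].
  move: h; rewrite inE => /orP[/eqP h|h]; first by move: vS; rewrite -h xS.
  by move/hasPn: hq2 => /(_ _ h); rewrite mem_last.
- by rewrite /= eqxx.
- by rewrite ov -yq2; apply: (path_conn pq2 (A := v :: q2)).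
Qed.

(** An inequality of Simon-Lieb type: a union bound over the first exit from [S], then BK twice for
    the three disjoint pieces of the path. *)
Lemma Pr_conn_exit (p : E -> R) s u y S : prob_vec p -> uniq s ->
  u \in S -> y \notin S ->
  Pr p s (fun w => conn w u y) <=
  \sum_(x <- S) \sum_(e <- s | exits e x S)
    Pr p s (fun w => conn_in S w u x) * (p e * Pr p s (fun w => conn w (other e x) y)).
Proof.
move=> p01 us uS yS.
pose B x e := box (fun w => conn_in S w u x)
  (box (fun w => w e) (fun w => conn w (other e x) y)).
apply: (@le_trans _ _ (\sum_(x <- S) \sum_(e <- s | exits e x S) Pr p s (B x e))).
  rewrite /Pr; under eq_bigr do rewrite -Ex_sum; rewrite -Ex_sum.
  apply: Ex_le_supp => // w sw; rewrite {1}/ind; case: asboolP => [uy|_]; last first.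
    by apply: sumr_ge0 => x _; apply: sumr_ge0 => e _; exact: ind_ge0.
  have [x [e [xS we ex bx]]] := conn_exit uS yS uy.
  rewrite (big_rem x)//= (big_rem e) ?sw//= ex indT//.
  rewrite -addrA lerDl addr_ge0//; first by apply: sumr_ge0 => *; exact: ind_ge0.
  by apply: sumr_ge0 => *; apply: sumr_ge0 => *; exact: ind_ge0.
apply: ler_sum => x _; rewrite big_seq_cond [leRHS]big_seq_cond.
apply: ler_sum => e /andP[es ex].
have ic : incr_event (fun w => conn w (other e x) y) by exact: conn_incr.
have io : incr_event (fun w : E -> bool => w e) by move=> w w'; apply.
apply: le_trans (BK p01 us (@conn_in_incr _ _ _) _) _; first exact: box_incr.
apply: ler_wpM2l; first exact: Pr_ge0.
apply: le_trans (BK p01 us io ic) _; apply: ler_wpM2r; first exact: Pr_ge0.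
rewrite /Pr (Ex_upd _ _ us es).
rewrite (@Ex_ext _ _ _ _ _ (fun=> 1)); last by move=> w; rewrite indT// updE.
rewrite [X in _ + _ * X](@Ex_ext _ _ _ _ _ (fun=> 0)); last by move=> w; rewrite indF// updE.
by rewrite !Ex_cst mulr1 mulr0 addr0.
Qed.

(** Vertices of [S] contribute at most [size S]. The others are reached from the far end of an exit
    edge, where [B] applies again, and the exit edges have total weight at most 1/2. *)
Lemma sum_conn_le (k : E -> R) s u S T B : (forall e, 0 <= k e) -> uniq s -> uniq T ->
  u \in S -> phi k 1 s S u <= 1 / 2 -> 0 <= B ->
  (forall v, \sum_(y <- T) Pr (pexp k 1) s (fun w => conn w v y) <= B) ->
  \sum_(y <- T) Pr (pexp k 1) s (fun w => conn w u y) <= (size S)%:R + B / 2.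
Proof.
move=> k0 us uT uS hphi B0 hB.
have p01 : prob_vec (pexp k 1) by exact: pexp_prob.
rewrite (bigID (mem S))/=; apply: lerD.
  apply: (@le_trans _ _ (\sum_(y <- T | y \in S) 1)).
    by apply: ler_sum => y _; exact: Pr_le1.
  rewrite big_const_seq iter_addr_0 -[_ *+ _]/(_%:R).
  rewrite ler_nat -size_filter; apply: uniq_leq_size; first exact: filter_uniq.
  by move=> x; rewrite mem_filter => /andP[].
apply: (@le_trans _ _ (\sum_(y <- T | y \notin S) \sum_(x <- S)
    \sum_(e <- s | exits e x S) Pr (pexp k 1) s (fun w => conn_in S w u x) *
      (pexp k 1 e * Pr (pexp k 1) s (fun w => conn w (other e x) y)))).
  by apply: ler_sum => y yS; exact: Pr_conn_exit.
rewrite exchange_big/=.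
apply: (@le_trans _ _ (B * phi k 1 s S u)); last by have := ler_wpM2l B0 hphi; lra.
rewrite /phi big_distrr/=; apply: ler_sum => x _.
rewrite exchange_big/= big_distrr/=; apply: ler_sum => e _.
rewrite -!big_distrr/= [leRHS]mulrC [_ * Pr _ _ _]mulrC -[leRHS]mulrA.
have h1 : pexp k 1 e <= k e.
  rewrite /pexp mul1r; have := expR_ge1Dx (- k e); lra.
have h2 : \sum_(y <- T | y \notin S) Pr (pexp k 1) s (fun w => conn w (other e x) y) <= B.
  apply: le_trans (hB (other e x)); rewrite [leRHS](bigID (mem S))/= lerDr.
  by apply: sumr_ge0 => y _; exact: Pr_ge0.
have q0 : 0 <= pexp k 1 e by case/andP: (p01 e).
apply: ler_wpM2l; first exact: Pr_ge0.
by apply: ler_pM => //; apply: sumr_ge0 => y _; exact: Pr_ge0.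
Qed.

End sharpness.

Section sharpness_transitive.
Context {R : realType} {G : weighted_graph R}.
Local Notation V := (vertex G).
Local Notation E := (edge G).
Implicit Types (w : E -> bool) (e : E) (s : seq E) (u v x y o : V) (S T : seq V).

Definition invariant_weights (k : E -> R) := forall f g,
  @automorphism R G f g -> forall e, k (g e) = k e.

Lemma exits_map f g e x S : @automorphism R G f g ->
  exits (g e) (f x) (map f S) = exits e x S.
Proof.
move=> [fb gb gends _]; have fI := bij_inj fb.
by have [h|h] := gends e; rewrite /exits h /= !(inj_eq fI) !mem_map// orbC.
Qed.

Lemma inside_map f g e S : @automorphism R G f g ->
  inside (map f S) (g e) = inside S e.
Proof.
move=> [fb gb gends _]; have fI := bij_inj fb.
by have [h|h] := gends e; rewrite /inside h /= !mem_map// andbC.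
Qed.

Lemma Pr_map (k : E -> R) t f g s (A B : (E -> bool) -> Prop) :
  invariant_weights k -> @automorphism R G f g ->
  (forall g', cancel g g' -> cancel g' g -> forall w, A (w \o g') <-> B w) ->
  Pr (pexp k t) (map g s) A = Pr (pexp k t) s B.
Proof.
move=> kinv fg AB; have [fb [g' gK g'K] gends gw] := fg.
rewrite /Pr (Ex_map _ _ gK g'K); last by move=> e; rewrite /pexp (kinv _ _ fg).
by apply: Ex_ext => w; rewrite /ind (asbool_equiv_eq (AB _ gK g'K w)).
Qed.

Lemma phi_map (k : E -> R) t f g s S o : invariant_weights k -> @automorphism R G f g ->
  phi k t (map g s) (map f S) (f o) = phi k t s S o.
Proof.
move=> kinv fg; have [[f' fK f'K] gb gends gw] := fg.
rewrite /phi big_map; apply: eq_bigr => x _; rewrite big_map; apply: eq_big.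
  by move=> e; rewrite (exits_map _ _ _ fg).
move=> e _; rewrite (kinv _ _ fg); congr (_ * _).
apply: (@Pr_map k t f g s _ _ kinv fg) => g' gK g'K w; rewrite /conn_in.
rewrite -(conn_mapE fK f'K gK g'K gends (fun e => w e && inside S e)).
suff -> : (fun e => (w \o g') e && inside (map f S) e) =
  (fun e => w e && inside S e) \o g' by [].
by apply/funext => e' /=; rewrite -{2}(g'K e') (inside_map _ _ fg).
Qed.

Lemma automorphism_inv f g : @automorphism R G f g ->
  exists f' g', [/\ cancel f f', cancel f' f, cancel g g', cancel g' g &
    @automorphism R G f' g'].
Proof.
move=> [[f' fK f'K] [g' gK g'K] gends gw]; exists f', g'; split => //; split.
- by exists f.
- by exists g.
- exact: (gends_inv fK g'K gends).
- by move=> e; rewrite -{2}(g'K e) gw.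
Qed.

(** Starting from the trivial bound [size T], each use of [sum_conn_le] halves the excess over
    [2 * size S]; in the limit the dependence on [T] disappears. *)
Lemma susceptibility_bound (k : E -> R) o S : @transitive_graph R G ->
  (forall e, 0 <= k e) -> invariant_weights k -> o \in S ->
  (forall s, uniq s -> phi k 1 s S o <= 1 / 2) ->
  forall s u T, uniq s -> uniq T ->
  \sum_(y <- T) Pr (pexp k 1) s (fun w => conn w u y) <= 2 * (size S)%:R.
Proof.
move=> tr k0 kinv oS hphi s u T us uT.
have p01 : prob_vec (pexp k 1) by exact: pexp_prob.
have H n : forall v, \sum_(y <- T) Pr (pexp k 1) s (fun w => conn w v y) <=
    2 * (size S)%:R + (size T)%:R / 2 ^+ n.
  elim: n => [|n IH] v.
    rewrite expr0 divr1; apply: (@le_trans _ _ (\sum_(y <- T) 1)).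
      by apply: ler_sum => y _; exact: Pr_le1.
    by rewrite big_const_seq iter_addr_0 count_predT -[_ *+ _]/(_%:R) lerDr mulr_ge0.
  have [f [g [fg fov]]] := tr o v.
  have [f' [g' [fK f'K gK g'K fg']]] := automorphism_inv fg.
  have B0 : 0 <= 2 * (size S)%:R + (size T)%:R / 2 ^+ n :> R.
    by rewrite addr_ge0// ?mulr_ge0// divr_ge0// exprn_ge0.
  have vS : v \in map f S by rewrite -fov map_f.
  (* The hypothesis on [phi] at [o] concerns all edge lists, hence also the preimage of [s] under
     the automorphism. *)
  have hv : phi k 1 s (map f S) v <= 1 / 2.
    have -> : s = map g (map g' s) by rewrite mapK.
    rewrite -fov phi_map//; apply: hphi.
    by rewrite map_inj_uniq//; exact: can_inj g'K.
  apply: le_trans (sum_conn_le k0 us uT vS hv B0 IH) _.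
  rewrite size_map exprS.
  have : (2 : R) ^+ n != 0 by rewrite expf_neq0.
  move=> n0; rewrite le_eqVlt; apply/orP; left; apply/eqP; field.
  by rewrite n0.
apply/ler_addgt0Pr => eps eps0.
pose n := Num.bound ((size T)%:R / eps).
apply: le_trans (H n u) _; rewrite lerD2l ler_pdivrMr ?exprn_gt0// mulrC -ler_pdivrMr//.
have h : (size T)%:R / eps < n%:R :> R by apply: archi_boundP; rewrite divr_ge0// ltW.
apply: (le_trans (ltW h)); rewrite -natrX ler_nat ltnW//; exact: ltn_expl.
Qed.

End sharpness_transitive.

(** * The differential inequality for escape probabilities *)

Section escape.
Context {R : realType} {G : weighted_graph R}.
Local Notation V := (vertex G).
Local Notation E := (edge G).
Implicit Types (w : E -> bool) (e : E) (s : seq E) (u v x y o : V) (S T : seq V).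

Definition escape S o w := exists2 y, y \notin S & conn w o y.

(** When [o] does not escape, such an edge is closed, and opening it makes [o] escape. *)
Definition pivots S o e w := exists x y, [/\ conn w o x, joins e x y & escape S y w].

Lemma escape_incr S o : incr_event (escape S o).
Proof. by move=> w w' ww' [y yS oy]; exists y => //; apply: conn_le oy. Qed.

(** One end of [e] is outside [S]; once [e] is open, reaching either end means escaping, so both
    ends may be removed from [S]. *)
Lemma escape_upd S o e w : let S' := [seq x <- S | x != (@ends R G e).1 & x != (@ends R G e).2] in
  ~~ inside S e -> escape S o (upd w e true) <-> escape S' o w.
Proof.
move=> S' eS; split=> [[y yS oy]|[y yS' oy]].
  suff [oy'|//] : conn w o y \/ escape S' o w.
    by exists y => //; rewrite mem_filter negb_and (negbTE yS) orbT.
  move: y {yS} oy; apply: conn_ind; first by left; exact: conn_refl.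
  move=> x y f [ox|]; last by right.
  move=> _; rewrite /upd; case: (eqVneq f e) => [->|fe] wf fj; last first.
    by left; apply: conn_trans ox _; exact: conn_edge fj.
  right; exists x => //; rewrite mem_filter !negb_and !negbK.
  by move: fj => /orP[]/eqP -> /=; rewrite eqxx ?orbT.
have le := @upd_true_ge _ w e.
move: yS'; rewrite mem_filter !negb_and !negbK => /orP[ye|yS]; last first.
  by exists y => //; exact: conn_le oy.
have oy' := conn_le le oy.
have ee : upd w e true e by rewrite updE.
move: eS; rewrite /inside negb_and => /orP[] eS.
  exists (@ends R G e).1 => //; case/orP: ye => /eqP yE; first by rewrite -yE.
  apply: conn_trans oy' _; apply: (conn_edge ee).
  by rewrite yE joinsC joins_ends.
exists (@ends R G e).2 => //; case/orP: ye => /eqP yE; last by rewrite -yE.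
by apply: conn_trans oy' _; apply: (conn_edge ee); rewrite yE joins_ends.
Qed.

Lemma pivots_upd S o e f w : let S' := [seq x <- S | x != (@ends R G e).1 & x != (@ends R G e).2] in
  ~~ inside S e -> pivots S' o f w -> pivots S o f (upd w e true).
Proof.
move=> S' eS [x [y [ox fj esc]]]; exists x, y; split => //.
  exact: conn_le (@upd_true_ge _ w e) ox.
exact/(escape_upd _ _ eS).
Qed.

Variables (k : E -> R) (k0 : forall e, 0 <= k e) (t : R) (t0 : 0 <= t).
Variables (s0 : seq E) (us0 : uniq s0) (o : V) (L : seq V).
Hypothesis phi_ge : forall S, {subset S <= L} -> uniq S -> o \in S ->
  1 / 2 <= phi k t s0 S o.

Let p := pexp k t.
Let p01 : prob_vec p. Proof. exact: pexp_prob. Qed.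

(* Exploring the cluster of the complement of S from outside leaves, when it stops, a
   set of vertices inside which the percolation is untouched; the expected
   weight of the closed edges joining it to the cluster of o is then [phi]. *)
Lemma pivots_ge s S : uniq s -> {subset s <= s0} ->
  (forall e, e \in s0 -> e \notin s -> ~~ inside S e) ->
  {subset S <= L} -> uniq S ->
  1 / 2 * Ex p s (fun w => 1 - ind (escape S o) w) <=
  Ex p s (fun w => (1 - ind (escape S o) w) *
     \sum_(e <- s0) k e * ind (pivots S o e) w).
Proof.
have [n] := ubnP (size s); elim: n s S => // n IH s S sn us ss0 out SL uS.
have [oS|oS] := boolP (o \in S); last first.
  have esc w : escape S o w by exists o => //; exact: conn_refl.
  rewrite (@Ex_ext _ _ _ _ _ (fun=> 0)) => [|w]; last by rewrite indT// subrr.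
  rewrite [leRHS](@Ex_ext _ _ _ _ _ (fun=> 0)) => [|w]; last by rewrite indT// subrr mul0r.
  by rewrite !Ex_cst mulr0.
(* Reveal an edge with an end outside [S]: if it is open, [S] loses the ends of this edge; if it is
   closed, [S] stays. In both cases the edge leaves [s]. *)
have [/hasP[e es eS]|/hasPn ins] := boolP (has (fun e => ~~ inside S e) s).
  pose S' := [seq x <- S | x != (@ends R G e).1 & x != (@ends R G e).2].
  have us' : uniq (rem e s) by exact: rem_uniq.
  have sn' : (size (rem e s) < n)%N.
    by rewrite size_rem// prednK//; case: (s) es.
  have ss' : {subset rem e s <= s0} by move=> f /mem_rem /ss0.
  have outS' f : f \in s0 -> f \notin rem e s -> ~~ inside S' f.
    move=> fs0; rewrite mem_rem_uniq// inE negb_and negbK => /orP[/eqP ->|fs].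
      by rewrite /inside !mem_filter eqxx.
    apply: contra (out _ fs0 fs); rewrite /inside !mem_filter.
    by move=> /andP[/andP[_ ->] /andP[_ ->]].
  have outS f : f \in s0 -> f \notin rem e s -> ~~ inside S f.
    move=> fs0; rewrite mem_rem_uniq// inE negb_and negbK => /orP[/eqP ->//|fs].
    exact: out.
  have S'L : {subset S' <= L} by move=> x; rewrite mem_filter => /andP[_ /SL].
  have uS' : uniq S' by rewrite filter_uniq.
  have h1 := IH _ _ sn' us' ss' outS' S'L uS'.
  have h0 := IH _ _ sn' us' ss' outS SL uS.
  rewrite (Ex_rem _ _ us es) [leRHS](Ex_rem _ _ us es) /=.
  have er : e \notin rem e s by rewrite mem_rem_uniq// inE eqxx.
  have indE w : ind (escape S o) (upd w e true) = ind (escape S' o) w :> R.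
    by rewrite /ind (asbool_equiv_eq (escape_upd o w eS)).
  have E1 : Ex p (rem e s) (fun w => 1 - ind (escape S o) (upd w e true)) =
      Ex p (rem e s) (fun w => 1 - ind (escape S' o) w).
    by apply: Ex_ext => w; rewrite indE.
  have E0 F : Ex p (rem e s) (fun w => F (upd w e false)) = Ex p (rem e s) F.
    by apply: Ex_eq_supp => w sw; rewrite (upd_notin sw).
  rewrite E1 (E0 (fun w => 1 - ind (escape S o) w)).
  rewrite (E0 (fun w => (1 - ind (escape S o) w) * \sum_(f <- s0) k f * ind (pivots S o f) w)).
  have hR : Ex p (rem e s) (fun w => (1 - ind (escape S' o) w) *
       \sum_(f <- s0) k f * ind (pivots S' o f) w) <=
    Ex p (rem e s) (fun w => (1 - ind (escape S o) (upd w e true)) *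
       \sum_(f <- s0) k f * ind (pivots S o f) (upd w e true)).
    apply: Ex_le => // w; rewrite indE.
    apply: ler_wpM2l; first by rewrite subr_ge0 ind_le1.
    apply: ler_sum => f _; apply: ler_wpM2l => //; apply: ind_le.
    exact: pivots_upd.
  have /andP[q0 q1] := p01 e; have q1' : 0 <= 1 - p e by rewrite subr_ge0.
  have a1 := ler_wpM2l q0 (le_trans h1 hR); have a2 := ler_wpM2l q1' h0.
  by rewrite mulrDr; apply: lerD; rewrite mulrCA.
(* The exploration is over: the edges left are exactly those of [s0] inside [S], so [o] cannot
   escape and the connections are those of [phi]. *)
have insE : {in s, forall e, inside S e} by move=> e /ins; rewrite negbK.
have nesc w : supported s w -> ~ escape S o w.
  move=> sw [y yS oy]; move/negP: yS; apply.
  move: y oy; apply: conn_ind => // x z e xS _ /sw/insE; move=> /[swap] ej.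
  by rewrite (joins_inside _ ej) => /andP[].
rewrite (@Ex_eq_supp _ _ _ _ (fun w => 1 - _) (fun=> 1)) => [|w sw]; last first.
  by rewrite indF ?subr0//; exact: nesc.
rewrite Ex_cst mulr1; apply: le_trans (phi_ge SL uS oS) _.
have -> : phi k t s0 S o = Ex p s (fun w => \sum_(x <- S)
    \sum_(e <- s0 | exits e x S) k e * ind (fun w => conn w o x) w).
  rewrite Ex_sum; apply: eq_bigr => x _; rewrite Ex_sum; apply: eq_bigr => e _.
  rewrite ExZ; congr (_ * _).
  transitivity (Ex p [seq f <- s0 | inside S f] (ind (fun w => conn w o x))).
    by rewrite -Ex_filter.
  apply: Ex_perm; first exact: filter_uniq.
  apply: uniq_perm => //; first exact: filter_uniq.
  move=> f; rewrite mem_filter; apply/andP/idP => [[fS fs0]|fs]; last by rewrite insE ?ss0.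
  by apply: contraLR fS => /out -/(_ fs0).
apply: Ex_le_supp => // w sw; rewrite indF ?subr0 ?mul1r; last exact: nesc.
under eq_bigr do rewrite big_mkcond.
rewrite exchange_big/=; apply: ler_sum => e _.
have [/hasP[x xS ex]|/hasPn nex] := boolP (has (fun x => exits e x S) S); last first.
  rewrite big_seq big1 ?mulr_ge0 ?ind_ge0// => x /nex /negbTE -> //.
rewrite (bigD1_seq x)//= ex big_seq_cond big1 ?addr0; last first.
  move=> y /andP[yS yx]; case: ifP => // ey; move: yx.
  by rewrite (exits_inj yS xS ey ex) eqxx.
apply: ler_wpM2l => //; apply: ind_le => ox.
have [ej oo] := exitsP xS ex.
by exists x, (other e x); split => //; exists (other e x) => //; exact: conn_refl.
Qed.

(** With Russo's formula on the right, this says f' >= (1 - f) / 2 for the escape probability f: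
    without escape, each edge of [pivots] has increment 1. *)
Lemma escape_derivative_ge : uniq L ->
  1 / 2 * (1 - Pr p s0 (escape L o)) <=
  \sum_(e <- s0) k e * Ex p s0 (fun w => ind (escape L o) (upd w e true) - ind (escape L o) w).
Proof.
move=> uL; have LL : {subset L <= L} by [].
rewrite -[X in X - Pr _ _ _](Ex_cst p s0) /Pr -ExB.
apply: le_trans (pivots_ge us0 _ _ LL uL) _ => //; first by move=> e ->.
under [leRHS]eq_bigr do rewrite -ExZ.
rewrite -Ex_sum; apply: Ex_le => // w; rewrite big_distrr/=; apply: ler_sum => e _.
rewrite mulrCA; apply: ler_wpM2l => //.
have mono : ind (escape L o) w <= ind (escape L o) (upd w e true) :> R.
  by apply: ind_incr; [exact: escape_incr|exact: upd_true_ge].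
rewrite {1}/ind; case: asboolP => esc; first by rewrite subrr mul0r subr_ge0.
rewrite subr0 mul1r (indF esc) subr0; apply: ind_le => -[x [y [ox ej [z zL yz]]]].
have le := @upd_true_ge _ w e.
exists z => //; apply: conn_trans (conn_le le ox) _; apply: conn_trans (conn_le le yz).
by apply: conn_edge ej; rewrite updE.
Qed.

End escape.

Section supercritical.
Context {R : realType} {G : weighted_graph R}.
Local Notation V := (vertex G).
Local Notation E := (edge G).

Lemma phi_le_t (k : E -> R) (t t' : R) s S (o : V) : 0 <= t -> t <= t' ->
  (forall e, 0 <= k e) -> phi k t s S o <= phi k t' s S o.
Proof.
move=> t0 tt' k0; apply: ler_sum => x _; apply: ler_sum => e _; apply: ler_wpM2l => //.
apply: Pr_le_p; [exact: pexp_prob|apply: pexp_prob => //; exact: le_trans tt'| |].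
  by move=> f; apply: pexp_le; exact: ler_wpM2r.
exact: conn_in_incr.
Qed.

Lemma phi_eq_mem (k : E -> R) (t : R) s S S' (o : V) : uniq S -> uniq S' -> S =i S' ->
  phi k t s S o = phi k t s S' o.
Proof.
move=> uS uS' SS'; rewrite /phi (perm_big S')/=; last exact: uniq_perm.
apply: eq_bigr => x _; apply: eq_big => [e|e _]; first by rewrite /exits !SS'.
congr (_ * _); apply: Ex_ext => w; congr ind; apply/funext => w'.
by rewrite /conn_in; congr conn; apply/funext => f; rewrite /inside !SS'.
Qed.

Lemma common_edges (I : eqType) (r : seq I) (P : I -> seq E -> Prop) :
  (forall i s s', uniq s -> uniq s' -> {subset s <= s'} -> P i s -> P i s') ->
  (forall i, exists2 s, uniq s & P i s) ->
  exists2 s, uniq s & forall i, i \in r -> P i s.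
Proof.
move=> mono ex; elim: r => [|i r [s us hs]]; first by exists [::].
have [s' us' hs'] := ex i; exists (undup (s ++ s')); first exact: undup_uniq.
move=> j; rewrite inE => /orP[/eqP ->|/hs].
  apply: mono hs' => //; first exact: undup_uniq.
  by move=> e es; rewrite mem_undup mem_cat es orbT.
apply: mono => //; first exact: undup_uniq.
by move=> e es; rewrite mem_undup mem_cat es.
Qed.

(** The mean value theorem between 1 and r, with f increasing, replaces the integration of f' >= (1
    - f) / 2: for x = (r - 1) / 2 it gives f r >= x (1 - f r), whence x / (1 + x). *)
Lemma escape_bound (k : E -> R) (o : V) (r : R) (L : seq V) :
  (forall e, 0 <= k e) -> 1 < r -> o \in L -> uniq L ->
  (forall S, uniq S -> o \in S -> exists2 s, uniq s & 1 / 2 < phi k 1 s S o) ->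
  exists2 s, uniq s &
    ((r - 1) / 2) / (1 + (r - 1) / 2) <= Pr (pexp k r) s (escape L o).
Proof.
move=> k0 r1 oL uL hphi.
pose P (m : seq bool) (s : seq E) := o \in mask m L -> 1 / 2 <= phi k 1 s (mask m L) o.
(* The subsets of [L], enumerated as masks, are finite in number, so one edge list serves them
   all. *)
have [s us hs] : exists2 s, uniq s &
    forall m, m \in (map val (enum {: (size L).-tuple bool})) -> P m s.
  apply: common_edges.
    move=> m s s' us us' ss' h om; apply: le_trans (h om) _.
    exact: phi_subset.
  move=> m; have [om|om] := boolP (o \in mask m L); last first.
    by exists [::] => //; rewrite /P (negbTE om).
  by have [s us hs] := hphi _ (mask_uniq uL m) om; exists s => // _; exact: ltW.
exists s => //.
have phi_ge t S : 1 <= t -> {subset S <= L} -> uniq S -> o \in S -> 1 / 2 <= phi k t s S o.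
  move=> t1 SL uS oS; pose m := map (mem S) L.
  have mE : mask m L =i S.
    move=> x; rewrite /m -filter_mask mem_filter; apply/andP/idP => [[]//|xS].
    by split => //; exact: SL.
  have sm : size m == size L by rewrite size_map.
  have := hs m; rewrite /P mE oS => h.
  apply: le_trans (h _ isT) _.
    by apply/mapP; exists (Tuple sm) => //; rewrite mem_enum.
  rewrite (phi_eq_mem _ _ _ _ (mask_uniq uL m) uS mE).
  exact: phi_le_t.
pose f t := Pr (pexp k t) s (escape L o).
pose df t := \sum_(e <- s) k e * Ex (pexp k t) s
  (fun w => ind (escape L o) (upd w e true) - ind (escape L o) w).
have fd t : is_derive t (1 : R) f (df t) by exact: is_derive_Ex.
have [c] : exists2 c, c \in `]1, r[%R & f r - f 1 = df c * (r - 1).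
  apply: MVT => //; apply: derivable_within_continuous => x _.
  by have [] := fd x.
rewrite in_itv/= => /andP[c1 cr] fE.
have c0 : 0 <= c by rewrite (le_trans _ (ltW c1)).
have dfc : 1 / 2 * (1 - f c) <= df c.
  by apply: escape_derivative_ge => // S SL uS oS; apply: phi_ge => //; exact: ltW.
have fcr : f c <= f r.
  apply: Pr_le_p; [exact: pexp_prob|apply: pexp_prob => //; exact: le_trans (ltW cr)| |].
    by move=> e; apply: pexp_le; apply: ler_wpM2r => //; exact: ltW.
  exact: escape_incr.
have f1 : 0 <= f 1 by apply: Pr_ge0; apply: pexp_prob.
have h : 0 < 1 + (r - 1) / 2 by lra.
rewrite ler_pdivrMr// -/(f r).
have r10 : 0 <= r - 1 by lra.
have := ler_wpM2r r10 dfc; rewrite -fE => h2.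
have h3 : (r - 1) * f c <= (r - 1) * f r by exact: ler_wpM2l.
lra.
Qed.

End supercritical.

(** * Cluster exploration *)

Section exploration.
Context {R : realType} {G : weighted_graph R}.
Local Notation V := (vertex G).
Local Notation E := (edge G).
Implicit Types (w : E -> bool) (e : E) (s : seq E) (u v y o : V) (D : seq V)
  (f : nat -> R) (x : E -> bool -> R).

Definition incident e v : bool := ((@ends R G e).1 == v) || ((@ends R G e).2 == v).

Definition touches e D : bool := ((@ends R G e).1 \in D) || ((@ends R G e).2 \in D).

Definition add_ends e D := undup ((@ends R G e).1 :: (@ends R G e).2 :: D).

(* Reveals the edges of s one by one, starting from D, with n as fuel; each revealed edge
   contributes its score x, weighted by f at the number of vertices found so far. *)
Fixpoint explore f x n s D w : R :=
  if n is n'.+1 then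
    if [seq e <- s | touches e D] is e :: _ then
      f (size D) * x e (w e) +
      explore f x n' (rem e s) (if w e then add_ends e D else D) w
    else 0
  else 0.

Definition reached D s w e :=
  exists z v, [/\ z \in D, conn (restr s w) z v & incident e v].

Lemma touch_headP s D e l : [seq e <- s | touches e D] = e :: l ->
  e \in s /\ touches e D.
Proof.
move=> h; have : e \in [seq e <- s | touches e D] by rewrite h mem_head.
by rewrite mem_filter => /andP[].
Qed.

Lemma mem_add_ends e D y :
  (y \in add_ends e D) = (incident e y) || (y \in D).
Proof. by rewrite mem_undup !inE orbA /incident ![y == _]eq_sym. Qed.

Lemma explore_upd f x n s D w e b : e \notin s ->
  explore f x n s D (upd w e b) = explore f x n s D w.
Proof.
elim: n s D => [//|n IH] s D es /=; case h : [seq _ <- _ | _] => [//|a l].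
have [ais _] := touch_headP h.
have ae : a != e by apply: contraNneq es => <-.
rewrite {1 2}/upd (negbTE ae) IH//; apply: contra es; exact: mem_rem.
Qed.

Lemma explore_sum (I : Type) (r : seq I) (F : I -> nat -> R) x n s D w :
  explore (fun m => \sum_(i <- r) F i m) x n s D w = \sum_(i <- r) explore (F i) x n s D w.
Proof.
elim: n s D => [|n IH] s D /=; first by rewrite big1_eq.
case: [seq _ <- _ | _] => [|e l]; first by rewrite big1_eq.
by rewrite IH big_split/= big_distrl.
Qed.

Lemma size_add_ends e D : uniq D -> (size D <= size (add_ends e D))%N.
Proof.
by move=> uD; apply: uniq_leq_size => // y yD; rewrite mem_add_ends yD orbT.
Qed.

Lemma size_add_ends_le e D : (size (add_ends e D) <= (size D).+2)%N.
Proof. by apply: leq_trans (size_undup _) _. Qed.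

Lemma explore_ext f f' x n s D w : uniq D ->
  (forall m, (size D <= m <= size D + 2 * n)%N -> f m = f' m) ->
  explore f x n s D w = explore f' x n s D w.
Proof.
elim: n s D => [//|n IH] s D uD ff /=; case: [seq _ <- _ | _] => [//|e l].
rewrite ff ?leqnn ?leq_addr//; congr (_ + _); case: (w e); apply: IH => //.
- exact: undup_uniq.
- move=> m /andP[m1 m2]; apply: ff; apply/andP; split.
    exact: leq_trans (size_add_ends e uD) m1.
  apply: (leq_trans m2); rewrite mulnS addnA leq_add2r addn2.
  exact: size_add_ends_le.
- by move=> m /andP[m1 m2]; apply: ff; lia.
Qed.

Section moments.
Variables (p : E -> R) (x : E -> bool -> R).
Hypothesis xmean : forall e, p e * x e true + (1 - p e) * x e false = 0.

Definition score_var e := p e * x e true ^+ 2 + (1 - p e) * x e false ^+ 2.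

(* The scores of successively revealed edges are orthogonal. *)
Lemma explore_sqr f n s D z : uniq s ->
  Ex p s (fun w => (z + explore f x n s D w) ^+ 2) =
  z ^+ 2 + Ex p s (explore (fun m => f m ^+ 2) (fun e _ => score_var e) n s D).
Proof.
elim: n s D z => [|n IH] s D z us /=.
  by rewrite !Ex_cst !addr0.
case h : [seq _ <- _ | _] => [|e l]; first by rewrite !Ex_cst !addr0.
have [es _] := touch_headP h.
have us' : uniq (rem e s) by exact: rem_uniq.
have er : e \notin rem e s by rewrite mem_rem_uniq// inE eqxx.
rewrite !(Ex_rem _ _ us es)/= /upd !eqxx -!/(upd _ _ _).
have E1 b D' : Ex p (rem e s) (fun w => (z + (f (size D) * x e b +
      explore f x n (rem e s) D' (upd w e b))) ^+ 2) =
    Ex p (rem e s) (fun w => ((z + f (size D) * x e b) + explore f x n (rem e s) D' w) ^+ 2).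
  by apply: Ex_ext => w; rewrite explore_upd// addrA.
have E2 b D' : Ex p (rem e s) (fun w => f (size D) ^+ 2 * score_var e +
      explore (fun m => f m ^+ 2) (fun e _ => score_var e) n (rem e s) D' (upd w e b)) =
    f (size D) ^+ 2 * score_var e + Ex p (rem e s)
     (explore (fun m => f m ^+ 2) (fun e _ => score_var e) n (rem e s) D').
  rewrite -[X in X + Ex _ _ _](Ex_cst p (rem e s)) -ExD.
  by apply: Ex_ext => w; rewrite explore_upd.
rewrite !E1// !E2 !IH//.
move: (Ex p _ _) (Ex p _ _) => b a; have := xmean e; rewrite /score_var.
move: (p e) (x e true) (x e false) (f (size D)) => q x1 x0 c.
move=> h0.

have -> : q * ((z + c * x1) ^+ 2 + a) + (1 - q) * ((z + c * x0) ^+ 2 + b) =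
  z ^+ 2 + 2 * z * c * (q * x1 + (1 - q) * x0) +
  c ^+ 2 * (q * x1 ^+ 2 + (1 - q) * x0 ^+ 2) + (q * a + (1 - q) * b) by ring.
by rewrite h0; ring.
Qed.

End moments.

Lemma add_ends_conn s D w e z : e \in s -> touches e D ->
  z \in (if w e then add_ends e D else D) -> exists2 y, y \in D & conn (restr s w) y z.
Proof.
move=> es eD; case we : (w e) => zD; last by exists z => //; exact: conn_refl.
move: zD; rewrite mem_add_ends => /orP[ez|zD]; last by exists z => //; exact: conn_refl.
have ee : restr s w e by rewrite /restr es.
case/orP: eD => yD; case/orP: ez => /eqP <-.
- by exists (@ends R G e).1 => //; exact: conn_refl.
- by exists (@ends R G e).1 => //; apply: (conn_edge ee); exact: joins_ends.
- by exists (@ends R G e).2 => //; apply: (conn_edge ee); rewrite joinsC; exact: joins_ends.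
- by exists (@ends R G e).2 => //; exact: conn_refl.
Qed.

(** A path through the revealed open edge can be restarted at an end of this edge, so nothing is
    lost by deleting the edge and adding its ends to [D]. *)
Lemma reached_step s D w e : uniq s -> e \in s -> touches e D -> forall g,
  reached D s w g <-> reached (if w e then add_ends e D else D) (rem e s) w g.
Proof.
move=> us es eD g.
have le : conf_le (restr (rem e s) w) (restr s w).
  by apply: restr_mono => z; exact: mem_rem.
case we : (w e); last first.
  suff rE : restr s w = restr (rem e s) w by rewrite /reached rE.
  apply/funext => z; rewrite /restr mem_rem_uniq// inE.
  by case: (eqVneq z e) => [->|//]; rewrite we !andbF.
split=> [[z [v [zD zv gv]]]|[z [v [zD zv gv]]]].
  suff [z' z'D z'v] : exists2 z', z' \in add_ends e D & conn (restr (rem e s) w) z' v.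
    by exists z', v.
  move: v zv {gv}; apply: conn_ind.
    by exists z; [rewrite mem_add_ends zD orbT|exact: conn_refl].
  move=> a b h [z' z'D z'a] _ /andP[hs wh] hj.
  have [he|he] := eqVneq h e.
    exists b; last exact: conn_refl.
    rewrite mem_add_ends /incident -he; move: hj => /orP[]/eqP -> /=.
      by rewrite eqxx orbT.
    by rewrite eqxx.
  exists z' => //; apply: conn_trans z'a _; apply: conn_edge hj.
  by rewrite /restr mem_rem_uniq// inE he hs.
have [y yD yz] : exists2 y, y \in D & conn (restr s w) y z.
  by apply: (@add_ends_conn _ _ _ e) => //; rewrite we.
by exists y, v; split => //; apply: conn_trans yz _; exact: conn_le zv.
Qed.

Lemma touches_reached D s w e : touches e D -> reached D s w e.
Proof.
by move=> /orP[h|h]; [exists (@ends R G e).1, (@ends R G e).1|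
  exists (@ends R G e).2, (@ends R G e).2]; split;
  rewrite // ?/incident ?eqxx ?orbT//; exact: conn_refl.
Qed.

(** The exploration stops only when no unrevealed edge touches the discovered set, which then is
    closed under open edges; fuel [size s] is enough because each step removes an edge. *)
Lemma explore_total x n s D w : (size s <= n)%N -> uniq s ->
  explore (fun=> 1) x n s D w = \sum_(e <- s) ind (fun w => reached D s w e) w * x e (w e).
Proof.
elim: n s D => [|n IH] s D sn us.
  by move: sn; rewrite leqn0 => /nilP ->; rewrite big_nil.
rewrite /=; case h : [seq _ <- _ | _] => [|e l].
  rewrite big_seq big1// => e es; rewrite indF ?mul0r// => -[z [v [zD zv ev]]].
  suff vD : v \in D.
    have : e \in [seq e <- s | touches e D].
      rewrite mem_filter es andbT /touches; case/orP: ev => /eqP ->; by rewrite vD ?orbT.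
    by rewrite h.
  move: v zv {ev}; apply: conn_ind => // a b g aD _ /andP[gs _] gj.
  have : g \in [seq e <- s | touches e D].
    by rewrite mem_filter gs andbT /touches; move: gj => /orP[]/eqP -> /=; rewrite aD ?orbT.
  by rewrite h.
have [es eD] := touch_headP h.
rewrite IH ?rem_uniq//; last by rewrite size_rem//; case: (size s) sn.
rewrite mul1r [RHS](big_rem e)//= indT ?mul1r; last exact: touches_reached.
congr (_ + _); apply: eq_bigr => g _; congr (_ * _).
by rewrite /ind (asbool_equiv_eq (reached_step w us es eD g)).
Qed.

(** All discovered vertices are connected to [D], so their number never reaches the level [l] where
    the weight may be nonzero. *)
Lemma explore_zero f x n s D w l : uniq s -> uniq D ->
  (forall m, (m < l)%N -> f m = 0) ->
  (forall t, uniq t -> (forall y, y \in t -> exists2 z, z \in D & conn (restr s w) z y) ->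
    (size t < l)%N) ->
  explore f x n s D w = 0.
Proof.
move=> us uD f0; elim: n s D us uD => [//|n IH] s D us uD small /=.
case h : [seq _ <- _ | _] => [//|e l']; have [es eD] := touch_headP h.
rewrite f0 ?mul0r ?add0r; last first.
  by apply: small => // y yD; exists y => //; exact: conn_refl.
apply: IH; first exact: rem_uniq.
  by case: (w e) => //; exact: undup_uniq.
move=> t ut ht; apply: small => // y /ht[z zD zy].
have [z' z'D z'z] := add_ends_conn es eD zD.
exists z' => //; apply: conn_trans z'z _; apply: conn_le zy.
by apply: restr_mono => g; exact: mem_rem.
Qed.

Lemma explore_late f x n s D w M : uniq D -> (forall m, (M < m)%N -> f m = 0) ->
  (M < size D)%N -> explore f x n s D w = 0.
Proof.
move=> uD f0; elim: n s D uD => [//|n IH] s D uD MD /=.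
case: [seq _ <- _ | _] => [//|e l]; rewrite f0// mul0r add0r; apply: IH.
  by case: (w e) => //; exact: undup_uniq.
by case: (w e) => //; apply: leq_trans MD _; exact: size_add_ends.
Qed.

(** The edges revealed with nonzero weight touch the set discovered at the last time when it has at
    most M elements; this set is [D']. *)
Lemma explore_var_le f (va : E -> R) n s D w M : uniq s -> uniq D ->
  (forall m, 0 <= f m <= 1) -> (forall m, (M < m)%N -> f m = 0) ->
  (forall e, 0 <= va e) -> (size D <= M)%N ->
  exists D', [/\ uniq D', {subset D <= D'}, (size D' <= M)%N &
    explore f (fun e _ => va e) n s D w <= \sum_(e <- s | touches e D') va e].
Proof.
move=> us uD f01 f0 va0; elim: n s D us uD => [|n IH] s D us uD DM /=.
  by exists D; split => //; exact: sumr_ge0.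
case h : [seq _ <- _ | _] => [|e l].
  by exists D; split => //; exact: sumr_ge0.
have [es eD] := touch_headP h.
set D1 := if w e then _ else _.
have uD1 : uniq D1 by rewrite /D1; case: (w e) => //; exact: undup_uniq.
have DD1 : {subset D <= D1}.
  by move=> y yD; rewrite /D1; case: (w e) => //; rewrite mem_add_ends yD orbT.
have fva : f (size D) * va e <= va e.
  by rewrite ler_piMl//; case/andP: (f01 (size D)).
have [D1M|D1M] := leqP (size D1) M.
  have [D' [uD' DD' D'M hD']] := IH (rem e s) D1 (rem_uniq _ us) uD1 D1M.
  exists D'; split => //; first by move=> y /DD1 /DD'.
  rewrite (big_rem e)//= ifT; first exact: lerD.
  by move: eD => /orP[]/DD1/DD' h'; rewrite /touches h' ?orbT.
exists D; split => //; rewrite (explore_late _ _ _ _ uD1 f0 D1M) addr0.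
rewrite (big_rem e)//= eD; apply: le_trans fva _; rewrite lerDl; exact: sumr_ge0.
Qed.

End exploration.

(** * Variance of the exploration on dyadic scales *)

Section fluctuation.
Context {R : realType} {G : weighted_graph R}.
Local Notation V := (vertex G).
Local Notation E := (edge G).
Implicit Types (w : E -> bool) (e : E) (s : seq E) (u v y o : V) (D : seq V)
  (f : nat -> R) (x : E -> bool -> R).

Definition touched o e w := exists2 v, conn w o v & incident e v.

Definition dyadic (i m : nat) : R := (2 ^ i <= m < 2 ^ i.+1)%N%:R.

Lemma dyadic_sum I m : (0 < m < 2 ^ I)%N -> \sum_(i < I) dyadic i m = 1.
Proof.
have -> : \sum_(i < I) dyadic i m = (0 < m < 2 ^ I)%N%:R.
  elim: I => [|I IH]; first by rewrite big_ord0 expn0; case: m.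
  rewrite big_ord_recr/= IH /dyadic -natrD; congr (_%:R).
  have : (2 ^ I < 2 ^ I.+1)%N by rewrite ltn_exp2l.
  have : (0 < 2 ^ I)%N by rewrite expn_gt0.
  move: (2 ^ I)%N (2 ^ I.+1)%N => a b a0 ab.
  by case: (ltnP 0 m) => m0; case: (ltnP m a) => ma; case: (ltnP m b) => mb /=; lia.
by move=> ->.
Qed.

Lemma dyadic01 i m : 0 <= dyadic i m <= 1.
Proof. by rewrite /dyadic; case: (_ <= _ < _)%N; rewrite ?lexx ?ler01. Qed.

Lemma dyadic_sqr i m : dyadic i m ^+ 2 = dyadic i m.
Proof. by rewrite /dyadic; case: (_ <= _ < _)%N; rewrite ?expr1n ?expr0n. Qed.

Variables (p : E -> R) (p01 : prob_vec p) (s : seq E) (us : uniq s).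
Variables (x : E -> bool -> R) (sig2 : R) (g : nat -> R) (o : V).
Hypothesis xmean : forall e, p e * x e true + (1 - p e) * x e false = 0.
Hypothesis sig2_gt0 : 0 < sig2.
Hypothesis var_le : forall v, \sum_(e <- s | incident e v) score_var p x e <= sig2.
Hypothesis os : o \in vs s.
Hypothesis g0 : forall m, 0 <= g m.
Hypothesis gdecr : forall m n, (m <= n)%N -> g n <= g m.

Let Z i := explore (dyadic i) x (size s) s [:: o].

Let var0 e : 0 <= score_var p x e.
Proof.
have /andP[q0 q1] := p01 e; rewrite addr_ge0// mulr_ge0// ?sqr_ge0//.
by rewrite subr_ge0.
Qed.

Lemma explore_dyadic_zero i w (y : E -> bool -> R) : supported s w ->
  ~ big w o (2 ^ i) -> explore (dyadic i) y (size s) s [:: o] w = 0.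
Proof.
move=> sw nb; apply: (@explore_zero _ _ _ _ _ _ _ _ (2 ^ i)%N) => //.
  by move=> m mi; rewrite /dyadic leqNgt mi.
move=> t ut ht; rewrite ltnNge; apply/negP => st; apply: nb.
apply: big_leq st _; exists t; split => // v /ht[z]; rewrite inE => /eqP ->.
by rewrite restr_id.
Qed.

(** The edges scored on this scale touch at most 2^(i+1) vertices, each responsible for a variance
    of at most [sig2]; in a smaller cluster the scale is never entered. *)
Lemma explore_dyadic_sqr i : Ex p s (fun w => Z i w ^+ 2) <=
  sig2 * (2 ^ i.+1)%:R * Pr p s (fun w => big w o (2 ^ i)).
Proof.
have -> : Ex p s (fun w => Z i w ^+ 2) =
    Ex p s (explore (dyadic i) (fun e _ => score_var p x e) (size s) s [:: o]).
  have := explore_sqr xmean (dyadic i) (size s) [:: o] 0 us.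
  have -> : (fun m => dyadic i m ^+ 2) = dyadic i.
    by apply/funext => m; exact: dyadic_sqr.
  rewrite expr0n/= add0r => <-; by apply: Ex_ext => w; rewrite add0r.
rewrite /Pr -ExZ; apply: Ex_le_supp => // w sw.
have [b|nb] := pselect (big w o (2 ^ i)); last by rewrite explore_dyadic_zero// indF// mulr0.
rewrite indT// mulr1.
have f0 m : (2 ^ i.+1 < m)%N -> dyadic i m = 0.
  by move=> mi; rewrite /dyadic ltnNge (ltnW mi) andbF.
have D1 : (size [:: o] <= 2 ^ i.+1)%N by rewrite expn_gt0.
have uo : uniq [:: o] by [].
have [D' [uD' _ DM hD]] := explore_var_le (size s) w us uo (dyadic01 i) f0 var0 D1.
apply: le_trans hD _.
apply: (@le_trans _ _ (\sum_(v <- D') \sum_(e <- s | incident e v) score_var p x e)).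
  under [leRHS]eq_bigr do rewrite big_mkcond.
  rewrite exchange_big/= big_mkcond/=; apply: ler_sum => e _.
  have sum0 (r : seq V) : 0 <= \sum_(v <- r) (if incident e v then score_var p x e else 0).
    by apply: sumr_ge0 => v _; case: ifP.
  case: ifP => // /orP[] h; rewrite (big_rem _ h)/= /incident eqxx ?orbT lerDl;
    exact: sum0.
apply: (@le_trans _ _ (\sum_(v <- D') sig2)); first by apply: ler_sum => v _.
rewrite big_const_seq iter_addr_0 count_predT -[leLHS]mulr_natr.
by apply: ler_wpM2l; [exact: ltW|rewrite ler_nat].
Qed.

(* The score collected while the number of discovered vertices is between [2 ^ i] and
   [2 ^ i.+1] vanishes unless the cluster has [2 ^ i] vertices, and has variance of
   order [2 ^ i]. *)
Lemma fluctuation_le :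
  Ex p s (fun w => g (ksz s w o) * \sum_(e <- s) ind (touched o e) w * x e (w e)) <=
  \sum_(i < (2 * size s).+1) g (2 ^ i)%N * Num.sqrt (sig2 * (2 ^ i.+1)%:R) *
    Pr p s (fun w => big w o (2 ^ i)).
Proof.
(* A revealed edge adds at most two vertices, so their number is at most 1 + 2 [size s], which is
   less than 2^I. *)
pose I := (2 * size s).+1; pose t i := Num.sqrt (sig2 * (2 ^ i.+1)%:R).
have arg0 i : 0 < sig2 * (2 ^ i.+1)%:R by rewrite mulr_gt0// ltr0n expn_gt0.
have t0 i : 0 < t i by rewrite sqrtr_gt0.
have t2 i : t i ^+ 2 = sig2 * (2 ^ i.+1)%:R by rewrite sqr_sqrtr// ltW.
pose B i w := ind (fun w => big w o (2 ^ i)) w : R.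
(* On scale i, |Z| <= Z^2 / (2 t) + t / 2, used only where the cluster has 2^i vertices. As t^2 is
   the variance factor, both terms have expectation at most t / 2 times the probability of this
   event. *)
apply: (@le_trans _ _ (Ex p s (fun w => \sum_(i < I)
    g (2 ^ i)%N * ((2 * t i)^-1 * Z i w ^+ 2 + t i / 2 * B i w)))); last first.
  rewrite Ex_sum; apply: ler_sum => i _; rewrite ExZ -mulrA; apply: ler_wpM2l => //.
  rewrite ExD !ExZ -/(Pr p s (fun w => big w o (2 ^ i))).
  have h := explore_dyadic_sqr i; rewrite -t2 in h.
  have ti : 0 <= (2 * t i)^-1 by rewrite invr_ge0 mulr_ge0// ltW.
  have := ler_wpM2l ti h.
  rewrite -/(t i); set P := Pr _ _ _; set z := Ex _ _ _.
  have -> : (2 * t i)^-1 * (t i ^+ 2 * P) = t i / 2 * P.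
    by field; rewrite gt_eqF.
  move=> hz; lra.
apply: Ex_le_supp => // w sw.
have -> : \sum_(e <- s) ind (touched o e) w * x e (w e) = \sum_(i < I) Z i w.
  transitivity (explore (fun=> 1) x (size s) s [:: o] w).
    rewrite explore_total//; apply: eq_bigr => e _; congr (_ * _).
    rewrite /ind; congr (if _ then _ else _); apply/asbool_equiv_eq.
    rewrite /reached restr_id//; split=> [[v ov ev]|[z [v []]]].
      by exists o, v; rewrite mem_head.
    by rewrite inE => /eqP -> ov ev; exists v.
  rewrite -explore_sum; apply: explore_ext => // m /andP[m1 m2].
  rewrite dyadic_sum//; apply/andP; split => //.
  by apply: leq_ltn_trans m2 _; exact: ltn_expl.
rewrite big_distrr/=; apply: ler_sum => i _.
have [b|nb] := pselect (big w o (2 ^ i)); last first.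
  by rewrite /Z explore_dyadic_zero// mulr0 expr0n/= mulr0 add0r /B indF// !mulr0.
rewrite /B indT// mulr1.
have kb : (2 ^ i <= ksz s w o)%N by exact: big_ksz.
apply: (@le_trans _ _ (g (2 ^ i)%N * `|Z i w|)).
  apply: (@le_trans _ _ (g (ksz s w o) * `|Z i w|)).
    by apply: ler_wpM2l => //; exact: ler_norm.
  by apply: ler_wpM2r => //; exact: gdecr.
apply: ler_wpM2l => //; rewrite -(real_normK (num_real (Z i w))).
move: `|Z i w| => z; have ti := t0 i.
rewrite -subr_ge0; have -> : (2 * t i)^-1 * z ^+ 2 + t i / 2 - z = (2 * t i)^-1 * (z - t i) ^+ 2.
  by field; rewrite gt_eqF.
by rewrite mulr_ge0 ?sqr_ge0// invr_ge0 mulr_ge0// ltW.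
Qed.

End fluctuation.

(** * Mass transport *)

Section directed_sums.
Context {R : realType} {G : weighted_graph R}.
Local Notation V := (vertex G).
Local Notation E := (edge G).
Implicit Types (s : seq E) (v : V) (T : seq V).
Variable b : seq E -> V -> R.
Hypothesis b_mono : forall s s' v, uniq s -> uniq s' -> {subset s <= s'} -> b s v <= b s' v.
Hypothesis b0 : forall s v, 0 <= b s v.
Hypothesis b_supp : forall s v, v \notin vs s -> b s v = 0.

(** As [b] increases with the edge list, this is its limit. It stands for the expectation in
    infinite volume, so that mass transport involves no integral over configurations. *)
Definition dsup v : \bar R := ereal_sup [set (b s v)%:E | s in [set s | uniq s]].

Lemma dsup_ge s v : uniq s -> ((b s v)%:E <= dsup v)%E.
Proof. by move=> us; apply: ereal_sup_ubound; exists s. Qed.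

Lemma dsup_ge0 v : (0 <= dsup v)%E.
Proof. by apply: le_trans (@dsup_ge [::] v isT); rewrite lee_fin. Qed.

Lemma sum_le_esum s : uniq s -> ((\sum_(v <- vs s) b s v)%:E <= \esum_(v in [set: V]) dsup v)%E.
Proof.
move=> us; apply: esum_ge; exists [set` vs s].
  by split => //; exact: finite_seq.
rewrite -fsbig_seq ?vs_uniq// -sumEFin; apply: lee_sum => v _; exact: dsup_ge.
Qed.

Lemma sum_lt_dsup T (M : R) : (M%:E < \sum_(v <- T) dsup v)%E ->
  exists2 s, uniq s & M < \sum_(v <- T) b s v.
Proof.
elim: T M => [|v T IH] M.
  by rewrite big_nil lte_fin => M0; exists [::] => //; rewrite big_nil.
rewrite big_cons => hM.
have [s1 [us1 h1]] : exists s, uniq s /\ ((M - b s v)%:E < \sum_(v <- T) dsup v)%E.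
  apply: contrapT => /forallNP H.
  have S0 : (0 <= \sum_(v <- T) dsup v)%E by apply: sume_ge0 => u _; exact: dsup_ge0.
  have HS s : uniq s -> (\sum_(v <- T) dsup v <= (M - b s v)%:E)%E.
    by move=> us; rewrite leNgt; apply/negP => h; apply: (H s).
  move: S0 HS hM; case: (\sum_(v <- T) dsup v)%E => [r| |] // r0 HS.
    apply/negP; rewrite -leNgt.
    have : (dsup v <= (M - r)%:E)%E.
      apply: ge_ereal_sup => _ [s us <-]; have := HS s us; rewrite !lee_fin; lra.
    by rewrite EFinB leeBrDr.
  by have := HS [::] isT.
have [s2 us2 h2] := IH _ h1.
have us : uniq (undup (s1 ++ s2)) by exact: undup_uniq.
exists (undup (s1 ++ s2)) => //; rewrite big_cons.
have a1 : b s1 v <= b (undup (s1 ++ s2)) v.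
  by apply: b_mono => // e es; rewrite mem_undup mem_cat es.
have a2 : \sum_(v <- T) b s2 v <= \sum_(v <- T) b (undup (s1 ++ s2)) v.
  apply: ler_sum => u _; apply: b_mono => // e es.
  by rewrite mem_undup mem_cat es orbT.
lra.
Qed.

Lemma sum_gt_esum (M : R) : (M%:E < \esum_(v in [set: V]) dsup v)%E ->
  exists2 s, uniq s & forall s', uniq s' -> {subset s <= s'} ->
    M < \sum_(v <- vs s') b s' v.
Proof.
move=> /ereal_sup_gt[_ [X [finX _] <-]]; rewrite fsbig_finite//= => hM.
have [s us hs] := sum_lt_dsup hM; exists s => // s' us' ss'.
apply: (lt_le_trans hs); set T := (finmap.enum_fset _).
apply: (@le_trans _ _ (\sum_(v <- T) b s' v)).
  by apply: ler_sum => v _; exact: b_mono.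
rewrite (bigID (mem (vs s')))/= [X in _ + X]big1 ?addr0; last by move=> v /b_supp.
rewrite -big_filter; apply: ler_sum_subset => //.
- by rewrite filter_uniq// finmap.fset_uniq.
- exact: vs_uniq.
- by move=> v; rewrite mem_filter => /andP[].
Qed.

End directed_sums.

Section mass_transport.
Context {R : realType} {G : weighted_graph R}.
Local Notation V := (vertex G).
Local Notation E := (edge G).
Implicit Types (s : seq E) (u v : V) (T : seq V).
Variable b : seq E -> V -> V -> R.
Hypothesis G_unimodular : @unimodular R G.
Hypothesis b_mono : forall s s' u v, uniq s -> uniq s' -> {subset s <= s'} ->
  b s u v <= b s' u v.
Hypothesis b0 : forall s u v, 0 <= b s u v.
Hypothesis b_supp : forall s u v, (u \notin vs s) || (v \notin vs s) -> b s u v = 0.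
Hypothesis b_inv : forall f g s u v, @automorphism R G f g ->
  b (map g s) (f u) (f v) = b s u v.
Variables (o : V) (B : R).
Hypothesis b_bound : forall s, uniq s -> \sum_(v <- vs s) b s o v <= B.

(* Mass transport for the limit over finite edge sets: the two
   sums have the same monotone limit. *)
Lemma finite_mass_transport (eta : R) : 0 < eta ->
  exists2 s, uniq s & forall s', uniq s' -> {subset s <= s'} ->
    `|\sum_(v <- vs s') b s' o v - \sum_(u <- vs s') b s' u o| <= eta.
Proof.
move=> eta0.
pose F u v := dsup (fun s v => b s u v) v.
have Finv f g u v : @automorphism R G f g -> F (f u) (f v) = F u v.
  move=> fg; rewrite /F /dsup; congr ereal_sup; apply/seteqP; split=> _ [s us <-] /=.
    have [f' [g' [fK f'K gK g'K fg']]] := automorphism_inv fg.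
    exists (map g' s) => //; first by rewrite /= map_inj_uniq//; exact: can_inj g'K.
    by rewrite -(b_inv _ _ _ fg) mapK.
  have [_ gb _ _] := fg.
  exists (map g s); first by rewrite /= map_inj_uniq//; exact: bij_inj.
  by rewrite (b_inv _ _ _ fg).
have mt := @G_unimodular o F (fun u v => dsup_ge0 (fun s v => b0 s u v) v)
  (fun f g fg u v => Finv f g u v fg).
have m1 s s' v : uniq s -> uniq s' -> {subset s <= s'} -> b s o v <= b s' o v by exact: b_mono.
have m2 s s' v : uniq s -> uniq s' -> {subset s <= s'} -> b s v o <= b s' v o by exact: b_mono.
have s1 s v : v \notin vs s -> b s o v = 0 by move=> h; rewrite b_supp// h orbT.
have s2 s v : v \notin vs s -> b s v o = 0 by move=> h; rewrite b_supp// h.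
pose l := (\esum_(v in [set: V]) F o v)%E.
have l0 : (0 <= l)%E by apply: esum_ge0 => v _; apply: dsup_ge0.
(* Finiteness of the common limit makes it possible to approach both sums within [eta] and to
   subtract. *)
have lB : (l <= B%:E)%E.
  rewrite leNgt; apply/negP => /(sum_gt_esum m1 (fun s v => b0 s o v) s1)[s us] /(_ s us (fun _ => id)).
  by apply/negP; rewrite -leNgt; exact: b_bound.
have [r lr] : exists r : R, l = r%:E.
  by move: l0 lB; case: l => [r| |] // _ _; exists r.
have F2 : (\esum_(v in [set: V]) dsup (fun s v => b s v o) v)%E = r%:E.
  by rewrite -lr /l mt.
have h1 : ((r - eta)%:E < \esum_(v in [set: V]) dsup (fun s v => b s o v) v)%E.
  by rewrite -[X in (_ < X)%E]/l lr lte_fin; lra.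
have h2 : ((r - eta)%:E < \esum_(v in [set: V]) dsup (fun s v => b s v o) v)%E.
  by rewrite F2 lte_fin; lra.
have [t1 ut1 H1] := sum_gt_esum m1 (fun s v => b0 s o v) s1 h1.
have [t2 ut2 H2] := sum_gt_esum m2 (fun s v => b0 s v o) s2 h2.
exists (undup (t1 ++ t2)); first exact: undup_uniq.
move=> s us ss.
have sub1 : {subset t1 <= s} by move=> e et; apply: ss; rewrite mem_undup mem_cat et.
have sub2 : {subset t2 <= s} by move=> e et; apply: ss; rewrite mem_undup mem_cat et orbT.
have a1 := H1 s us sub1; have a2 := H2 s us sub2.
have := @sum_le_esum _ _ (fun s v => b s o v) s us; rewrite -[X in (_ <= X)%E]/l lr lee_fin => b1.
have := @sum_le_esum _ _ (fun s v => b s v o) s us; rewrite F2 lee_fin => b2.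
rewrite ler_norml; apply/andP; split; lra.
Qed.

End mass_transport.

(** * The two-ghost inequality *)

Section two_ghost.
Context {R : realType} {G : weighted_graph R}.
Local Notation V := (vertex G).
Local Notation E := (edge G).
Implicit Types (w : E -> bool) (e : E) (s : seq E) (u v o : V) (T : seq V)
  (gam : nat -> R) (y : E -> bool -> R).
Variables (k : E -> R) (a : pred E) (n : nat) (o : V).
Hypothesis G_unimodular : @unimodular R G.
Hypothesis k0 : forall e, 0 <= k e.
Hypothesis kinv : invariant_weights k.
Hypothesis ainv : forall f g, @automorphism R G f g -> forall e, a (g e) = a e.
Hypothesis a_loopless : forall e, a e -> (@ends R G e).1 != (@ends R G e).2.
Hypothesis k_gt0 : forall e, a e -> 0 < k e.
Hypothesis n_gt0 : (0 < n)%N.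

Let p := pexp k 1.

(** With this factor, averaging p - [w e] against a function of the configuration gives the expected
    difference between closing and opening [e]. It is also the variance of the normalised score. *)
Definition edge_coef e : R := (p e * (1 - p e))^-1.

Local Notation c := edge_coef.

Variable sig2 : R.
Hypothesis sig2_gt0 : 0 < sig2.
Hypothesis coef_le : forall s v, uniq s -> \sum_(e <- s | a e && incident e v) c e <= sig2.
Variable chi : R.
Hypothesis chi_le : forall s, uniq s ->
  \sum_(x <- vs s) Pr p s (fun w => conn w o x) <= chi.

Let p01 : prob_vec p. Proof. exact: pexp_prob. Qed.

Lemma edge_coef_ge0 e : 0 <= c e.
Proof.
have /andP[q0 q1] := p01 e.
by rewrite invr_ge0 mulr_ge0// subr_ge0.
Qed.

Lemma edge_coefE e : a e -> c e * (p e * (1 - p e)) = 1.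
Proof.
move=> ae; rewrite /c mulVf// mulf_neq0//.
  rewrite /p /pexp mul1r subr_eq0 eq_sym -[1]expR0.
  by rewrite lt_eqF// ltr_expR oppr_lt0 k_gt0.
by rewrite /p /pexp subKr gt_eqF// expR_gt0.
Qed.

Definition good_score y := [/\ forall e, 0 <= y e false, forall e, y e false <= y e true,
  forall e, y e true <= 1 & forall f g, @automorphism R G f g -> forall e b, y (g e) b = y e b].

Definition good_factor gam := (forall m, 0 <= gam m <= 1) /\
  forall m m', (m <= m')%N -> gam m <= gam m'.

(** Mass sent from [u] to [v]. With [gam] and [y] nonnegative and nondecreasing it increases with
    [w] and with [s], as the monotone limit requires. *)
Definition mass gam y s u v w : R := gam (ksz s w u) *
  \sum_(e <- s | a e && incident e v) c e * y e (w e) * ind (touched u e) w.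

Lemma touched_incr u e : incr_event (touched u e).
Proof. by move=> w w' ww' [v uv ev]; exists v => //; exact: conn_le uv. Qed.

Lemma score01 y e b : good_score y -> 0 <= y e b <= 1.
Proof.
move=> [y0 ym y1 _]; case: b; first by rewrite y1 (le_trans (y0 e)).
by rewrite y0 (le_trans (ym e)).
Qed.

Lemma mass_term_ge0 y e u w b : good_score y -> 0 <= c e * y e b * ind (touched u e) w.
Proof.
move=> gy; have /andP[y0 _] := score01 e b gy.
by rewrite !mulr_ge0 ?edge_coef_ge0 ?ind_ge0.
Qed.

Lemma mass_ge0 gam y s u v w : good_factor gam -> good_score y -> 0 <= mass gam y s u v w.
Proof.
move=> [g01 _] gy; rewrite mulr_ge0//; first by case/andP: (g01 (ksz s w u)).
by apply: sumr_ge0 => e _; exact: mass_term_ge0.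
Qed.

Lemma mass_le gam y s s' u v w w' : good_factor gam -> good_score y ->
  uniq s -> uniq s' -> {subset s <= s'} -> conf_le w w' ->
  mass gam y s u v w <= mass gam y s' u v w'.
Proof.
move=> [g01 gm] gy us us' ss' ww'; apply: ler_pM.
- by case/andP: (g01 (ksz s w u)).
- by apply: sumr_ge0 => e _; exact: mass_term_ge0.
- by apply: gm; exact: ksz_le.
apply: (@le_trans _ _ (\sum_(e <- s | a e && incident e v)
    c e * y e (w' e) * ind (touched u e) w')).
  apply: ler_sum => e _; have [_ ym _ _] := gy.
  apply: ler_pM.
  - by rewrite mulr_ge0 ?edge_coef_ge0//; case/andP: (score01 e (w e) gy).
  - exact: ind_ge0.
  - apply: ler_wpM2l; first exact: edge_coef_ge0.
    by have := ww' e; case: (w e) => [->//|_]; case: (w' e).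
  - by apply: ind_incr => //; exact: touched_incr.
by apply: ler_sum_subset => // e; exact: mass_term_ge0.
Qed.

Definition mass_exp gam y s u v := Ex p s (mass gam y s u v).

Lemma mass_exp_mono gam y s s' u v : good_factor gam -> good_score y ->
  uniq s -> uniq s' -> {subset s <= s'} -> mass_exp gam y s u v <= mass_exp gam y s' u v.
Proof.
move=> gg gy us us' ss'; apply: (@le_trans _ _ (Ex p s (mass gam y s' u v))).
  by apply: Ex_le => // w; exact: mass_le.
by apply: Ex_subset => // w w' ww'; exact: mass_le.
Qed.

Lemma incident_vs s e v : e \in s -> incident e v -> v \in vs s.
Proof.
by move=> es /orP[]/eqP <-; have /andP[] := mem_vs es (joins_ends e).
Qed.

Lemma mass_exp_supp gam y s u v : (u \notin vs s) || (v \notin vs s) ->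
  mass_exp gam y s u v = 0.
Proof.
move=> uv; rewrite /mass_exp -[RHS](Ex_cst p s 0); apply: Ex_eq_supp => w sw.
rewrite /mass big_seq_cond big1 ?mulr0// => e /and3P[es _ ev].
case/orP: uv => [us|vs']; last by move: vs'; rewrite (incident_vs es ev).
rewrite indF ?mulr0// => -[z uz ez]; have zs := incident_vs es ez.
by have [uz'|[]] := conn_supp sw uz; move: us; rewrite ?uz' ?zs// => /negP.
Qed.

Lemma incident_map f g e v : @automorphism R G f g -> incident (g e) (f v) = incident e v.
Proof.
move=> [fb gb gends _]; have fI := bij_inj fb.
by have [h|h] := gends e; rewrite /incident h /= !(inj_eq fI)// orbC.
Qed.

Lemma touched_map f g g' u e w : @automorphism R G f g -> cancel g g' -> cancel g' g ->
  touched (f u) (g e) (w \o g') <-> touched u e w.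
Proof.
move=> fg gK g'K; have [[f' fK f'K] _ gends _] := fg.
split=> -[v uv ev].
  exists (f' v); last by rewrite -(incident_map _ _ fg) f'K.
  by apply/(conn_mapE fK f'K gK g'K gends); rewrite f'K.
exists (f v); last by rewrite (incident_map _ _ fg).
by apply/(conn_mapE fK f'K gK g'K gends).
Qed.

Lemma pinv f g : @automorphism R G f g -> forall e, p (g e) = p e.
Proof. by move=> fg e; rewrite /p /pexp (kinv fg). Qed.

Lemma mass_exp_inv gam y f g s u v : good_score y -> @automorphism R G f g ->
  mass_exp gam y (map g s) (f u) (f v) = mass_exp gam y s u v.
Proof.
move=> [_ _ _ yinv] fg; have [[f' fK f'K] [g' gK g'K] gends _] := fg.
rewrite /mass_exp (Ex_map _ _ gK g'K (pinv fg)); apply: Ex_ext => w.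
rewrite /mass (ksz_map fK f'K gK g'K gends); congr (_ * _).
rewrite big_map; apply: eq_big => [e|e _].
  by rewrite (ainv fg) (incident_map _ _ fg).
rewrite /c !(pinv fg) (yinv _ _ fg) /= gK; congr (_ * _).
by rewrite /ind (asbool_equiv_eq (touched_map u e w fg gK g'K)).
Qed.

Lemma count_incident s e : e \in s -> (@ends R G e).1 != (@ends R G e).2 ->
  count (incident e) (vs s) = 2.
Proof.
move=> es e12; rewrite -size_filter (@perm_size _ _ [:: (@ends R G e).1; (@ends R G e).2])//.
apply: uniq_perm; first by rewrite filter_uniq// vs_uniq.
  by rewrite /= inE e12.
move=> v; rewrite mem_filter !inE ![v == _]eq_sym -/(incident e v).
by apply/andP/idP => [[]//|ev]; split => //; exact: incident_vs ev.
Qed.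

Lemma sum_incident s (F : E -> R) : uniq s ->
  \sum_(v <- vs s) \sum_(e <- s | a e && incident e v) F e = 2 * \sum_(e <- s | a e) F e.
Proof.
move=> us; under eq_bigr do rewrite big_mkcond.
rewrite exchange_big/= [in RHS]big_mkcond big_distrr/= !big_seq.
apply: eq_bigr => e es; case: ifP => ae; last by rewrite mulr0 big1.
by rewrite /= -big_mkcond/= big_const_seq iter_addr_0 count_incident ?a_loopless// mulr_natl.
Qed.

(** The finite mean [chi] enters here, only to make the total mass finite; it is absent from the
    conclusion of [two_ghost]. The factor 2 counts the ends of an edge. *)
Lemma mass_exp_bound gam y s : good_factor gam -> good_score y -> uniq s ->
  \sum_(v <- vs s) mass_exp gam y s o v <= 2 * (sig2 * chi).
Proof.
move=> gg gy us; rewrite /mass_exp -Ex_sum.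
apply: (@le_trans _ _ (Ex p s (fun w => \sum_(v <- vs s)
    \sum_(e <- s | a e && incident e v) c e * ind (touched o e) w))).
  apply: Ex_le => // w; apply: ler_sum => v _; rewrite /mass.
  have [g01 _] := gg; have /andP[g0 g1] := g01 (ksz s w o).
  apply: (@le_trans _ _ (\sum_(e <- s | a e && incident e v)
      c e * y e (w e) * ind (touched o e) w)).
    by apply: ler_piMl => //; apply: sumr_ge0 => e _; exact: mass_term_ge0.
  apply: ler_sum => e _; apply: ler_wpM2r; first exact: ind_ge0.
  by apply: ler_piMr; [exact: edge_coef_ge0|case/andP: (score01 e (w e) gy)].
under Ex_ext do rewrite sum_incident//.
rewrite ExZ ler_pM2l ?ltr0n//.
apply: (@le_trans _ _ (Ex p s (fun w => \sum_(x <- vs s) ind (fun w => conn w o x) w *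
   \sum_(e <- s | a e && incident e x) c e))).
  apply: Ex_le => // w; under [leRHS]eq_bigr do rewrite big_distrr/= big_mkcond/=.
  rewrite exchange_big/= big_mkcond/= big_seq [leRHS]big_seq; apply: ler_sum => e es.
  have t0 (r : seq V) : 0 <= \sum_(i <- r) (if a e && incident e i then
      ind (fun w => conn w o i) w * c e else 0).
    by apply: sumr_ge0 => i _; case: ifP => // _; rewrite mulr_ge0 ?ind_ge0 ?edge_coef_ge0.
  case: ifP => ae; last by have := t0 (vs s); rewrite ae.
  have [[z oz ez]|nt] := pselect (touched o e w); last first.
    by rewrite indF// mulr0; have := t0 (vs s); rewrite ae.
  rewrite indT ?mulr1; last by exists z.
  rewrite (big_rem z) ?(incident_vs es ez)//= ez indT// mul1r lerDl.
  by have := t0 (rem z (vs s)); rewrite ae.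
rewrite Ex_sum; apply: (@le_trans _ _ (\sum_(x <- vs s) Pr p s (fun w => conn w o x) * sig2)).
  apply: ler_sum => x _.
  under Ex_ext do rewrite mulrC; rewrite ExZ mulrC; apply: ler_wpM2l; first exact: Pr_ge0.
  exact: coef_le.
rewrite -big_distrl/= mulrC; apply: ler_wpM2l; [exact: ltW|exact: chi_le].
Qed.

Lemma mass_exp_transport gam y eta : good_factor gam -> good_score y -> 0 < eta ->
  exists2 s, uniq s & forall s', uniq s' -> {subset s <= s'} ->
    `|\sum_(v <- vs s') mass_exp gam y s' o v - \sum_(u <- vs s') mass_exp gam y s' u o| <= eta.
Proof.
move=> gg gy eta0; apply: (@finite_mass_transport _ _ (mass_exp gam y) G_unimodular _ _ _ _ o
  (2 * (sig2 * chi)) _ _ eta0).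
- by move=> s s' u v; exact: mass_exp_mono.
- by move=> s u v; apply: Ex_ge0 => // w; exact: mass_ge0.
- by move=> s u v; exact: mass_exp_supp.
- by move=> f g s u v fg; exact: mass_exp_inv.
- by move=> s us; exact: mass_exp_bound.
Qed.

(* [m * size_weight m = min (m / n) 1] is concave in m, and vanishes at 0. *)
Definition size_weight (m : nat) : R := (maxn n m)%:R^-1.

Local Notation g := size_weight.

Lemma size_weight_ge0 m : 0 <= g m.
Proof. by rewrite invr_ge0. Qed.

Lemma size_weight_decr m m' : (m <= m')%N -> g m' <= g m.
Proof.
move=> mm'; rewrite lef_pV2 ?posrE ?ltr0n ?leq_max ?n_gt0// ler_nat.
by rewrite geq_max !leq_max leqnn mm' orbT.
Qed.

Lemma size_weight_concave k1 k2 :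
  ((n <= k1)%N && (n <= k2)%N)%:R <=
  k1%:R * g k1 + k2%:R * g k2 - (k1 + k2)%:R * g (k1 + k2)%N.
Proof.
have le1 j j' : (j <= j')%N -> j%:R * g j' <= j%:R * g j.
  by move=> jj'; apply: ler_wpM2l => //; exact: size_weight_decr.
have big1 j : (n <= j)%N -> j%:R * g j = 1.
  move=> nj; rewrite /g (maxn_idPr nj) divff// pnatr_eq0 -lt0n.
  exact: leq_trans nj.
have [/andP[h1 h2]|_] /= := boolP (_ && _).
  rewrite !big1//; first lra.
  exact: leq_trans h1 (leq_addr _ _).
have := le1 k1 (k1 + k2)%N (leq_addr _ _); have := le1 k2 (k1 + k2)%N (leq_addl _ _).
rewrite natrD; lra.
Qed.

(** Summation over [u] gathers, for each cluster touching [e], its size m times [size_weight m],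
    that is min(m/n, 1). *)
Definition boundary_weight s e w := \sum_(u <- vs s) g (ksz s w u) * ind (touched u e) w.

Lemma incident_other e v : incident e v -> joins e v (other e v).
Proof.
rewrite /incident /joins /other; case: (@ends R G e) => x z /=.
have [->|xv] /= := eqVneq x v; first by rewrite eqxx.
by move=> /eqP ->; rewrite eqxx orbT.
Qed.

Lemma joins_incident e v z x : joins e v z -> incident e x = (x == v) || (x == z).
Proof.
by rewrite /joins /incident => /orP[]/eqP -> /=; rewrite ![x == _]eq_sym// orbC.
Qed.

Lemma conn_upd_true w e v z u x : joins e v z ->
  let A x := conn (upd w e false) x v \/ conn (upd w e false) x z in
  conn (upd w e true) u x <-> conn (upd w e false) u x \/ (A u /\ A x).
Proof.
move=> ej A; set w0 := upd w e false; set w1 := upd w e true.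
have le01 : conf_le w0 w1 by move=> f; rewrite /w0 /w1 /upd; case: eqVneq.
have vz : conn w1 v z by apply: conn_edge ej; rewrite /w1 updE.
split.
  move: x; apply: conn_ind; first by left; exact: conn_refl.
  move=> x x' f ux _ wf fj; have [fe|fe] := eqVneq f e.
    move: fj; rewrite fe => fj.
    have [[xE x'E]|[xE x'E]] := joins_inj ej fj.
      have Ax' : A x' by right; rewrite x'E; exact: conn_refl.
      by case: ux => [ux|[Au' _]]; right; split => //; left; rewrite -xE.
    have Ax' : A x' by left; rewrite x'E; exact: conn_refl.
    by case: ux => [ux|[Au' _]]; right; split => //; right; rewrite -xE.
  have w0f : w0 f by move: wf; rewrite /w1 /w0 /upd (negbTE fe).
  have xx' : conn w0 x x' by exact: conn_edge fj.
  case: ux => [ux|[Au Ax]]; first by left; exact: conn_trans ux xx'.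
  right; split => //; case: Ax => [xv|xz].
    by left; apply: conn_trans xv; exact: conn_sym.
  by right; apply: conn_trans xz; exact: conn_sym.
case=> [|[Au Ax]]; first exact: conn_le.
have toV x' : A x' -> conn w1 x' v.
  case=> [|xz]; first exact: conn_le.
  by apply: conn_trans (conn_le le01 xz) _; exact: conn_sym.
by apply: conn_trans (toV _ Au) _; apply: conn_sym; exact: toV.
Qed.

Lemma sum_ind s (P : V -> (E -> bool) -> Prop) (r : R) w :
  \sum_(u <- vs s) r * ind (P u) w = (count (fun u => `[< P u w >]) (vs s))%:R * r.
Proof.
rewrite -big_distrr/= mulrC; congr (_ * _).
rewrite -sum1_count natr_sum [RHS]big_mkcond/=; apply: eq_bigr => x _.
by rewrite /ind; case: ifP.
Qed.

(* Opening e either changes no cluster or merges those of its two ends. *)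
Lemma ghost_merge s e z w : supported s w -> e \in s -> joins e o z ->
  ind (fun w => [/\ big w o n, big w z n & ~ conn w o z]) w <=
  boundary_weight s e (upd w e false) - boundary_weight s e (upd w e true).
Proof.
move=> sw es ej; set w0 := upd w e false; set w1 := upd w e true.
have le0 : conf_le w0 w := @upd_false_le _ w e.
have s0 : supported s w0 by move=> f /le0 /sw.
have /andP[ovs zvs] := mem_vs es ej.
pose A x := conn w0 x o \/ conn w0 x z.
have c1 u x : conn w1 u x <-> conn w0 u x \/ (A u /\ A x) by exact: conn_upd_true.
have t0 u : touched u e w0 <-> A u.
  split=> [[x ux]|[uo|uz]].
  - by rewrite (joins_incident _ ej) => /orP[]/eqP xE; [left|right]; rewrite -xE.
  - by exists o; rewrite // (joins_incident _ ej) eqxx.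
  - by exists z; rewrite // (joins_incident _ ej) eqxx orbT.
have Ao : A o by left; exact: conn_refl.
have Az : A z by right; exact: conn_refl.
have t1 u : touched u e w1 <-> A u.
  split=> [[x /c1 ux]|Au].
    rewrite (joins_incident _ ej) => /orP[]/eqP xE; case: ux => [|[]//]; rewrite xE.
      by left.
    by right.
  by exists o; [apply/c1; right|rewrite (joins_incident _ ej) eqxx].
have i0 u : ind (touched u e) w0 = ind (fun=> A u) w0 :> R.
  by rewrite /ind (asbool_equiv_eq (t0 u)).
have i1 u : ind (touched u e) w1 = ind (fun=> A u) w0 :> R.
  by rewrite /ind (asbool_equiv_eq (t1 u)).
have [oz|noz] := pselect (conn w0 o z).
  have AA u x : A u -> A x -> conn w0 u x.
    have toO x' : A x' -> conn w0 x' o.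
      by case=> // h; apply: conn_trans h (conn_sym oz).
    by move=> /toO h /toO h'; apply: conn_trans h (conn_sym h').
  rewrite indF; last by move=> [_ _]; apply; exact: conn_le oz.
  rewrite subr_ge0 le_eqVlt; apply/orP; left; apply/eqP.
  apply: eq_bigr => u _; rewrite i0 i1; congr (g _ * _).
  apply: eq_count => x; apply/asbool_equiv_eq; rewrite c1.
  by split=> [[//|[Au Ax]]|ux]; [exact: AA|left].
have dis u : ~ (conn w0 u o /\ conn w0 u z).
  by move=> [uo uz]; apply: noz; exact: conn_trans (conn_sym uo) uz.
pose k1 := count (fun u => `[< conn w0 u o >]) (vs s).
pose k2 := count (fun u => `[< conn w0 u z >]) (vs s).
have kE x : ksz s w0 x = count (fun u => `[< conn w0 u x >]) (vs s).
  by apply: eq_count => u; apply/asbool_equiv_eq; split; exact: conn_sym.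
have K12 : count (fun u => `[< A u >]) (vs s) = (k1 + k2)%N.
  rewrite /k1 /k2 -count_predUI.
  rewrite [X in (_ + X)%N](eq_count (a2 := pred0)) ?count_pred0 ?addn0.
    by apply: eq_count => u /=; rewrite -asbool_or.
  by move=> u /=; rewrite -asbool_and; apply/asboolP => /dis.
have H1 : boundary_weight s e w1 = (k1 + k2)%:R * g (k1 + k2)%N.
  rewrite -K12 -(sum_ind _ (fun u _ => A u) _ w0); apply: eq_bigr => u _; rewrite i1.
  have [Au|nA] := pselect (A u); last by rewrite indF// !mulr0.
  congr (g _ * _); apply: eq_count => x; apply/asbool_equiv_eq; rewrite c1.
  split=> [[ux|[]//]|Ax]; last by right.
  have xu := conn_sym ux.
  by case: Au => h; [left|right]; exact: conn_trans xu h.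
have H0 : boundary_weight s e w0 = k1%:R * g k1 + k2%:R * g k2.
  rewrite -(sum_ind _ (fun u w => conn w u o) _ w0) -(sum_ind _ (fun u w => conn w u z) _ w0).
  rewrite -big_split/=; apply: eq_bigr => u _; rewrite i0.
  have [uo|nuo] := pselect (conn w0 u o).
    rewrite (@indT _ _ _ w0 uo) (@indT _ _ (fun=> A u)) ?mulr1; last by left.
    rewrite indF ?mulr0 ?addr0; last by move=> uz; apply: (dis u).
    by rewrite (conn_ksz s uo) kE.
  rewrite (@indF _ _ _ w0 nuo) mulr0 add0r.
  have [uz|nuz] := pselect (conn w0 u z).
    rewrite (@indT _ _ _ w0 uz) (@indT _ _ (fun=> A u)) ?mulr1; last by right.
    by rewrite (conn_ksz s uz) kE.
  by rewrite (@indF _ _ _ w0 nuz) (@indF _ _ (fun=> A u)) ?mulr0// => -[].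
rewrite H0 H1; apply: le_trans (size_weight_concave _ _).
rewrite {1}/ind; case: asboolP => [[bo bz nc]|_]; last exact: ler0n.
have we : w e = false by apply/negP => we; apply: nc; exact: conn_edge ej.
have ww0 : w = w0 by rewrite /w0 -we upd_id.
rewrite ww0 in bo bz.
by rewrite /k1 /k2 -!kE !big_ksz.
Qed.

(** Conditionally on the other edges, the score is -c (1 - p) with probability p and c p with
    probability 1 - p, and c p (1 - p) = 1. *)
Lemma boundary_score s e : uniq s -> e \in s -> a e ->
  Ex p s (fun w => c e * (p e - (w e)%:R) * boundary_weight s e w) =
  Ex p s (fun w => boundary_weight s e (upd w e false) - boundary_weight s e (upd w e true)).
Proof.
move=> us es ae; rewrite (Ex_upd _ _ us es) ExB.
under Ex_ext do rewrite updE; under [X in _ + _ * X]Ex_ext do rewrite updE.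
rewrite !ExZ; have := edge_coefE ae; set q := p e; set x := c e.
set h1 := Ex p s _; set h0 := Ex p s _ => h.
transitivity (x * (q * (1 - q)) * (h0 - h1)); first by rewrite /=; ring.
by rewrite h mul1r.
Qed.

(** [size_weight] decreases and the score p - [w e] is signed. Writing them as [gam1 - gam2] and
    [y1 - y2] leaves four products of nonnegative monotone factors, to which mass transport applies
    separately. *)
Let y1 e (_ : bool) := p e.
Let y2 (_ : E) (b : bool) : R := b%:R.
Let gam1 (_ : nat) : R := n%:R^-1.
Let gam2 m : R := n%:R^-1 - g m.

Let good_y1 : good_score y1.
Proof.
rewrite /y1; split=> [e|e|e|f f' fg e b]; rewrite ?lexx//.
- by case/andP: (p01 e).
- by case/andP: (p01 e).
- exact: (pinv fg).
Qed.

Let good_y2 : good_score y2. Proof. by rewrite /y2; split=> // *; rewrite ler01. Qed.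

Let n1 : n%:R^-1 <= 1 :> R.
Proof. by rewrite invf_le1 ?ltr0n// ler1n. Qed.

Let good_gam1 : good_factor gam1.
Proof. by split=> *; rewrite /gam1 ?lexx// n1 invr_ge0 ler0n. Qed.

Let good_gam2 : good_factor gam2.
Proof.
split=> [m|m m' mm']; rewrite /gam2; last by have := size_weight_decr mm'; lra.
have := size_weight_ge0 m; have := size_weight_decr (leq0n m).
by rewrite /g maxn0 => h1 h2; apply/andP; split; have := n1; lra.
Qed.

Let mass_comb s u v w : mass gam1 y1 s u v w - mass gam2 y1 s u v w -
    (mass gam1 y2 s u v w - mass gam2 y2 s u v w) =
  g (ksz s w u) * \sum_(e <- s | a e && incident e v)
    c e * (p e - (w e)%:R) * ind (touched u e) w.
Proof.
rewrite /mass /gam1 /gam2.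
have -> : \sum_(e <- s | a e && incident e v) c e * (p e - (w e)%:R) * ind (touched u e) w =
    \sum_(e <- s | a e && incident e v) c e * y1 e (w e) * ind (touched u e) w -
    \sum_(e <- s | a e && incident e v) c e * y2 e (w e) * ind (touched u e) w.
  by rewrite -sumrB; apply: eq_bigr => e _; rewrite /y1 /y2; ring.
ring.
Qed.

Definition score e (b : bool) : R := if a e then c e * (p e - b%:R) else 0.

Lemma score_mean e : p e * score e true + (1 - p e) * score e false = 0.
Proof. by rewrite /score; case: (a e) => /=; ring. Qed.

Lemma score_varE s v : uniq s -> \sum_(e <- s | incident e v) score_var p score e <= sig2.
Proof.
move=> us; apply: le_trans (coef_le v us); rewrite [leRHS]big_mkcondl/=.
apply: ler_sum => e _; rewrite /score_var /score; case: ifP => ae; last first.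
  by rewrite expr0n/= !mulr0 addr0.
have := edge_coefE ae; set q := p e; set x := c e => h; rewrite /=.
have -> : q * (x * (q - 1)) ^+ 2 + (1 - q) * (x * (q - 0)) ^+ 2 = x * (x * (q * (1 - q))) by ring.
by rewrite h mulr1.
Qed.

(** The mass received at [o] is the expected loss of concave weight when an edge at [o] is opened,
    at least the probability on the left. The mass sent from [o] is a sum of centred scores over the
    edges touching its cluster, bounded by [fluctuation_le]. *)
Lemma two_ghost s0 eta : uniq s0 -> o \in vs s0 -> 0 < eta ->
  exists s, [/\ uniq s, {subset s0 <= s} &
    \sum_(e <- s | a e && incident e o)
      Pr p s (fun w => [/\ big w o n, big w (other e o) n & ~ conn w o (other e o)]) <=
    2 * (\sum_(i < (2 * size s).+1) g (2 ^ i)%N * Num.sqrt (sig2 * (2 ^ i.+1)%:R) *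
      Pr p s (fun w => big w o (2 ^ i))) + eta].
Proof.
(* A quarter of the error for each of the four masses. *)
move=> us0 os0 eta0; have e4 : 0 < eta / 4 by lra.
have [s1 us1 H1] := mass_exp_transport good_gam1 good_y1 e4.
have [s2 us2 H2] := mass_exp_transport good_gam2 good_y1 e4.
have [s3 us3 H3] := mass_exp_transport good_gam1 good_y2 e4.
have [s4 us4 H4] := mass_exp_transport good_gam2 good_y2 e4.
pose s := undup (s0 ++ s1 ++ s2 ++ s3 ++ s4).
have us : uniq s by exact: undup_uniq.
have sub0 : {subset s0 <= s} by move=> e h; rewrite mem_undup !mem_cat h.
have sub1 : {subset s1 <= s} by move=> e h; rewrite mem_undup !mem_cat h ?orbT.
have sub2 : {subset s2 <= s} by move=> e h; rewrite mem_undup !mem_cat h ?orbT.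
have sub3 : {subset s3 <= s} by move=> e h; rewrite mem_undup !mem_cat h ?orbT.
have sub4 : {subset s4 <= s} by move=> e h; rewrite mem_undup !mem_cat h ?orbT.
have os : o \in vs s by exact: vs_sub os0.
exists s; split => //.
have {H1}h1 := H1 s us sub1; have {H2}h2 := H2 s us sub2.
have {H3}h3 := H3 s us sub3; have {H4}h4 := H4 s us sub4.
pose M u v := Ex p s (fun w => g (ksz s w u) *
  \sum_(e <- s | a e && incident e v) c e * (p e - (w e)%:R) * ind (touched u e) w).
have ME u v : mass_exp gam1 y1 s u v - mass_exp gam2 y1 s u v -
    (mass_exp gam1 y2 s u v - mass_exp gam2 y2 s u v) = M u v.
  by rewrite /mass_exp -!ExB; apply: Ex_ext => w; rewrite mass_comb.
have transport : \sum_(u <- vs s) M u o <= \sum_(v <- vs s) M o v + eta.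
  under eq_bigr do rewrite -ME; under [X in _ <= X + _]eq_bigr do rewrite -ME.
  rewrite !sumrB; move: h1 h2 h3 h4; rewrite !ler_norml.
  move=> /andP[? ?] /andP[? ?] /andP[? ?] /andP[? ?]; lra.
have lhs : \sum_(v <- vs s) M o v = 2 * Ex p s (fun w => g (ksz s w o) *
    \sum_(e <- s) ind (touched o e) w * score e (w e)).
  rewrite /M -Ex_sum -ExZ; apply: Ex_ext => w.
  rewrite -big_distrr/= sum_incident// mulrCA; congr (_ * (_ * _)).
  rewrite big_mkcond/=; apply: eq_bigr => e _; rewrite /score.
  by case: ifP => _; rewrite ?mulr0// mulrC.
have rhs : \sum_(e <- s | a e && incident e o) Pr p s
    (fun w => [/\ big w o n, big w (other e o) n & ~ conn w o (other e o)]) <=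
    \sum_(u <- vs s) M u o.
  have -> : \sum_(u <- vs s) M u o = \sum_(e <- s | a e && incident e o)
      Ex p s (fun w => c e * (p e - (w e)%:R) * boundary_weight s e w).
    rewrite /M -!Ex_sum; apply: Ex_ext => w.
    under eq_bigr do rewrite big_distrr/=.
    rewrite exchange_big/=; apply: eq_bigr => e _; rewrite /boundary_weight big_distrr/=.
    by apply: eq_bigr => u _; ring.
  rewrite big_seq_cond [leRHS]big_seq_cond; apply: ler_sum => e /and3P[es ae eo].
  rewrite boundary_score//; apply: Ex_le_supp => // w sw.
  by apply: ghost_merge => //; exact: incident_other.
have fl := fluctuation_le p01 us score_mean sig2_gt0 (fun v => score_varE v us) os
  size_weight_ge0 size_weight_decr.
apply: (le_trans rhs); apply: (le_trans transport); rewrite lhs lerD2r.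
by apply: ler_wpM2l.
Qed.

End two_ghost.

(** * Power sums and the bootstrap inequality *)

Section power_sums.
Context {R : realType}.
Implicit Types (x y th : R) (m n M I : nat).

Lemma powR_add x r s t : 0 < x -> r + s = t -> x `^ t = x `^ r * x `^ s.
Proof. by move=> x0 <-; rewrite powRD// (gt_eqF x0) implybT. Qed.

Lemma powR_gt1 x r : 1 < x -> 0 < r -> 1 < x `^ r.
Proof.
move=> x1 r0; suff : 1 `^ r < x `^ r by rewrite powR1.
by apply: gt0_ltr_powR; rewrite ?nnegrE//; lra.
Qed.

Lemma ler_powR_exp_neg x y r : 0 < x -> x <= y -> 0 <= r -> y `^ (- r) <= x `^ (- r).
Proof.
move=> x0 xy r0; have y0 : 0 < y by exact: lt_le_trans xy.
rewrite !powRN lef_pV2 ?posrE ?powR_gt0//.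
by apply: ge0_ler_powR => //; rewrite nnegrE ltW.
Qed.

(** Telescoping: each term is at most twice the increment of the square root. *)
Lemma sum_sqrt_inv M : \sum_(k < M) (k.+1)%:R `^ (- (1 / 2)) <= 2 * M%:R `^ (1 / 2) :> R.
Proof.
elim: M => [|M IH]; first by rewrite big_ord0 mulr_ge0// powR_ge0.
rewrite big_ord_recr/=; apply: le_trans (lerD IH (lexx _)) _.
rewrite powRN !mul1r !powR12_sqrt// ?ler0n//.
set a := Num.sqrt M%:R; set b := Num.sqrt M.+1%:R.
have a0 : 0 <= a by exact: sqrtr_ge0.
have b0 : 0 < b by rewrite sqrtr_gt0 ltr0n.
have a2 : a ^+ 2 = M%:R by rewrite sqr_sqrtr.
have b2 : b ^+ 2 = a ^+ 2 + 1 by rewrite sqr_sqrtr// a2 -natr1.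
rewrite -subr_ge0.
have -> : 2 * b - (2 * a + b^-1) = b^-1 * (b - a) ^+ 2.
  have -> : b^-1 * (b - a) ^+ 2 = b^-1 * (2 * b ^+ 2 - 2 * (a * b) - (b ^+ 2 - a ^+ 2)) by ring.
  by rewrite {2}b2; field; rewrite gt_eqF.
by rewrite mulr_ge0 ?sqr_ge0// invr_ge0 ltW.
Qed.

(** As th < 1/2, a factor M^(1/2 - th) can be taken out, which leaves the exponent -1/2. *)
Lemma sum_powR_neg th M : 0 < th -> th < 1 / 2 ->
  \sum_(k < M) (k.+1)%:R `^ (- th) <= 2 * M%:R `^ (1 - th) :> R.
Proof.
move=> th0 th1.
apply: (@le_trans _ _ (\sum_(k < M) M%:R `^ (1 / 2 - th) * (k.+1)%:R `^ (- (1 / 2)))).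
  apply: ler_sum => k _.
  rewrite (@powR_add _ (1 / 2 - th) (- (1 / 2)) (- th)) ?ltr0n//; last by ring.
  apply: ler_wpM2r; first exact: powR_ge0.
  by apply: ge0_ler_powR; rewrite ?nnegrE ?ler0n ?ler_nat//; lra.
rewrite -big_distrr/=; apply: le_trans (ler_wpM2l (powR_ge0 _ _) (sum_sqrt_inv M)) _.
case: M => [|M].
  by rewrite !powR0 ?mulr0//; apply/eqP; lra.
rewrite [in leRHS](@powR_add _ (1 / 2 - th) (1 / 2)) ?ltr0n//; last by field.
by rewrite mulrCA.
Qed.

Lemma geometric_ge1 (r : R) m : 1 < r -> \sum_(i < m) r ^+ i <= r ^+ m / (r - 1).
Proof.
move=> r1; have r10 : 0 < r - 1 by lra.
rewrite ler_pdivlMr// mulrC; elim: m => [|m IH].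
  by rewrite big_ord0 mulr0 expr0 ler01.
rewrite big_ord_recr/= exprS mulrDr.
have : 0 <= r ^+ m by apply: exprn_ge0; lra.
set z := r ^+ m in IH *; set S0 := \sum_(i < m) _ in IH * => z0; lra.
Qed.

Lemma geometric_le1 (q : R) m : 0 <= q -> q < 1 -> \sum_(i < m) q ^+ i <= 1 / (1 - q).
Proof.
move=> q0 q1; have q10 : 0 < 1 - q by lra.
rewrite ler_pdivlMr//.
suff : \sum_(i < m) q ^+ i * (1 - q) = 1 - q ^+ m.
  by rewrite -big_distrl/= => ->; have := exprn_ge0 m q0; lra.
elim: m => [|m IH]; first by rewrite big_ord0 expr0 subrr.
by rewrite big_ord_recr/= IH exprS; ring.
Qed.

Lemma natX_powR i th : (2 ^ i)%:R `^ th = (2 `^ th) ^+ i :> R.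
Proof.
elim: i => [|i IH]; first by rewrite expn0 powR1 expr0.
by rewrite expnS natrM powRM// IH exprS.
Qed.

Lemma dyadic_powR_sum th : 0 < th -> th < 1 / 2 -> exists2 C : R, 0 <= C &
  forall n I, (0 < n)%N ->
  \sum_(i < I) (maxn n (2 ^ i))%:R^-1 * (2 ^ i)%:R `^ (1 / 2 - th) <=
  C * n%:R `^ (- (1 / 2 + th)).
Proof.
move=> th0 th1; pose r : R := 2 `^ (1 / 2 - th); pose q : R := 2 `^ (- (1 / 2 + th)).
have r1 : 1 < r.
  by apply: powR_gt1; lra.
have q0 : 0 <= q by exact: powR_ge0.
have q1 : q < 1.
  rewrite /q powRN invf_lt1 ?powR_gt0//; apply: powR_gt1; lra.
have D1 : 0 <= r / (r - 1) by rewrite divr_ge0//; lra.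
have D2 : 0 <= 1 / (1 - q) by rewrite divr_ge0//; lra.
exists (r / (r - 1) + 1 / (1 - q)); first exact: addr_ge0.
move=> n I n0; have n0' : (0 : R) < n%:R by rewrite ltr0n.
pose m := trunc_log 2 n; have mn : (2 ^ m <= n)%N by exact: trunc_logP.
have nm : (n < 2 ^ m.+1)%N by exact: trunc_log_ltn.
pose t i : R := (maxn n (2 ^ i))%:R^-1 * (2 ^ i)%:R `^ (1 / 2 - th).
have t0 i : 0 <= t i by rewrite mulr_ge0 ?powR_ge0// invr_ge0.
apply: (@le_trans _ _ (\sum_(i < m.+1 + I) t i)).
  by rewrite addnC big_split_ord/= lerDl; exact: sumr_ge0.
rewrite big_split_ord/= mulrDl; apply: lerD.
  apply: (@le_trans _ _ (\sum_(i < m.+1) n%:R^-1 * r ^+ i)).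
    apply: ler_sum => i _; rewrite /t natX_powR -/r; apply: ler_wpM2r.
      by apply: exprn_ge0; lra.
    rewrite lef_pV2 ?posrE ?ltr0n ?leq_max ?n0//; by rewrite ler_nat leq_maxl.
  rewrite -big_distrr/=.
  apply: le_trans (ler_wpM2l _ (geometric_ge1 m.+1 r1)) _; first by rewrite invr_ge0 ltW.
  rewrite (@powR_add _ (1 / 2 - th) (- 1) (- (1 / 2 + th)))//; last by field.
  rewrite powR_inv1; last exact: ltW.
  have rm : r ^+ m <= n%:R `^ (1 / 2 - th).
    rewrite /r -natX_powR; apply: ge0_ler_powR; rewrite ?nnegrE ?ler0n ?ler_nat//; lra.
  rewrite exprS.
  have -> : n%:R^-1 * (r * r ^+ m / (r - 1)) = (r / (r - 1) * n%:R^-1) * r ^+ m.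
    by field; rewrite gt_eqF//=; lra.
  have -> : r / (r - 1) * (n%:R `^ (1 / 2 - th) * n%:R^-1) =
     (r / (r - 1) * n%:R^-1) * n%:R `^ (1 / 2 - th) by ring.
  by apply: ler_wpM2l rm; rewrite mulr_ge0// invr_ge0 ltW.
apply: (@le_trans _ _ (\sum_(i < I) q ^+ m.+1 * q ^+ i)).
  apply: ler_sum => i _; rewrite -exprD /t /q -natX_powR.
  have e0 : (0 : R) < (2 ^ (m.+1 + i))%:R by rewrite ltr0n expn_gt0.
  rewrite (@powR_add _ (1 / 2 - th) (- 1) (- (1 / 2 + th)))//; last by field.
  rewrite powR_inv1; last exact: ltW.
  rewrite mulrC.
  apply: ler_wpM2l; first exact: powR_ge0.
  by rewrite lef_pV2 ?posrE// ?ltr0n ?leq_max ?n0// ler_nat leq_maxr.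
rewrite -big_distrr/= mulrC.
apply: ler_pM; rewrite ?geometric_le1//.
- by apply: sumr_ge0 => i _; exact: exprn_ge0.
- exact: exprn_ge0.
- rewrite /q -natX_powR; apply: ler_powR_exp_neg => //; last lra.
  by rewrite ler_nat ltnW.
Qed.

End power_sums.

Section bootstrap_algebra.
Context {R : realType}.

(** M is the integer just above y = (2 A N)^(1/(1+th)), so that M^(1+th) >= 2 A N. The two terms add
    up to at most 6 A M^(1-th), and M <= 2 y costs a further factor of at most 4, whence 24. *)
Lemma exists_scale (th A : R) (N : nat) : 0 < th -> th < 1 / 2 -> 1 <= A -> (0 < N)%N ->
  exists2 M : nat, (0 < M)%N & N%:R * (A * M%:R `^ (- th)) / M%:R <= 1 / 2 /\
    \sum_(k < M) A * (k.+1)%:R `^ (- th) + 4 * M%:R * (A * M%:R `^ (- th)) <=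
    24 * (A `^ (2 / (1 + th)) * N%:R `^ ((1 - th) / (1 + th))).
Proof.
move=> th0 th1 A1 N0; have A0 : 0 < A by lra.
have N0' : (0 : R) < N%:R by rewrite ltr0n.
have N1 : (1 : R) <= N%:R by rewrite ler1n.
pose z : R := 2 * (A * N%:R).
have z1 : 1 <= z.
  have : 1 * 1 <= A * N%:R by apply: ler_pM.
  by rewrite /z; lra.
have z0 : 0 < z by lra.
pose y := z `^ (1 + th)^-1.
have y1 : 1 <= y.
  have -> : 1 = 1 `^ (1 + th)^-1 :> R by rewrite powR1.
  by apply: ge0_ler_powR; rewrite ?nnegrE ?invr_ge0//; lra.
pose M := (Num.truncn y).+1.
have yM : y < M%:R by exact: truncnS_gt.
have M0 : (0 : R) < M%:R by rewrite ltr0n.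
have My : M%:R <= 2 * y.
  have := truncn_le y; rewrite (le_trans ler01 y1) => h.
  by rewrite /M -natr1; lra.
have Mp : M%:R `^ (1 - th) = M%:R * M%:R `^ (- th).
  by rewrite (@powR_add _ _ 1 (- th)) ?powRr1 ?ltW//; ring.
exists M => //; split.
  have zM : z <= M%:R `^ (1 + th).
    have -> : z = y `^ (1 + th).
      rewrite /y -powRrM mulVf ?powRr1//; first exact: ltW.
      by apply/eqP; lra.
    apply: ge0_ler_powR; rewrite ?nnegrE//; lra.
  have e1 : M%:R `^ (1 + th) = M%:R * M%:R `^ th.
    by rewrite (@powR_add _ _ 1 th) ?powRr1 ?ltW//; ring.
  have e2 : 0 < M%:R `^ th by rewrite powR_gt0.
  rewrite powRN ler_pdivrMr//.
  have -> : N%:R * (A / M%:R `^ th) = (A * N%:R) / M%:R `^ th by ring.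
  rewrite ler_pdivrMr// -mulrA -e1; rewrite /z in zM; lra.
rewrite -big_distrr/=.
apply: (@le_trans _ _ (6 * (A * M%:R `^ (1 - th)))).
  have := ler_wpM2l (ltW A0) (sum_powR_neg M th0 th1).
  rewrite Mp; set S0 := A * \sum_(k < M) _; move: (M%:R `^ _) => x; lra.
have -> : A `^ (2 / (1 + th)) = A * A `^ ((1 - th) / (1 + th)).
  rewrite (@powR_add _ _ 1 ((1 - th) / (1 + th))) ?powRr1 ?ltW//.
  by field; apply/eqP; lra.
have h1 : M%:R `^ (1 - th) <= (2 * y) `^ (1 - th).
  by apply: ge0_ler_powR; rewrite ?nnegrE//; lra.
have h2 : (2 * y) `^ (1 - th) = 2 `^ (1 - th) * (2 `^ ((1 - th) / (1 + th)) *
    (A `^ ((1 - th) / (1 + th)) * N%:R `^ ((1 - th) / (1 + th)))).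
  rewrite powRM//; last lra.
  congr (_ * _); rewrite /y -powRrM [_^-1 * _]mulrC /z.
  by rewrite !powRM ?mulr_ge0 ?(ltW A0).
have p2 r : 0 <= r -> r <= 1 -> (2 : R) `^ r <= 2.
  move=> r0 r1; rewrite -[leRHS]powRr1//; apply: ler_powR => //; lra.
have q0 : 0 <= (1 - th) / (1 + th) by apply: divr_ge0; lra.
have q1 : (1 - th) / (1 + th) <= 1 by rewrite ler_pdivrMr; lra.
have h3 : 2 `^ (1 - th) * 2 `^ ((1 - th) / (1 + th)) <= 2 * 2 :> R.
  by apply: ler_pM; rewrite ?powR_ge0 ?p2//; lra.
rewrite h2 mulrA in h1.
set B := A `^ _ * _ in h1 *.
have B0 : 0 <= B by rewrite mulr_ge0 ?powR_ge0.
have h4 := ler_wpM2r B0 h3.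
have h5 := ler_wpM2l (ltW A0) (le_trans h1 h4).
rewrite -mulrA -/B; lra.
Qed.

(** After division by N both terms are at most a multiple of A^(2/(1+th)) n^(-2 th): the first
    because N >= n^(1+th), the second by the choice of th, together with A <= A^(2/(1+th)). *)
Lemma bootstrap_step (a th c D Cth : R) : 1 / 2 < a -> a < 1 -> 0 < c -> 0 < D -> 0 <= Cth ->
  th = (2 * a - 1) / (a + 1) ->
  exists2 C : R, 0 <= C & forall (A q : R) (n N : nat), 1 <= A -> (0 < n)%N ->
  n%:R `^ (1 + th) <= N%:R ->
  let eps := (c / 4) `^ a^-1 * n%:R `^ (- ((1 + th) / a)) in
  N%:R * q ^+ 2 <= 24 * (A `^ (2 / (1 + th)) * N%:R `^ ((1 - th) / (1 + th))) +
    2 * (Num.sqrt (2 * (N%:R * D / eps)) * A * (Cth * n%:R `^ (- (1 / 2 + th)))) ->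
  (n%:R `^ th * q) ^+ 2 <= C * A `^ (2 / (1 + th)).
Proof.
move=> a1 a2 c0 D0 Cth0 thE; have a0 : 0 < a by lra.
have th0 : 0 < th by rewrite thE divr_gt0//; lra.
have th1 : th < 1 / 2 by rewrite thE ltr_pdivrMr; lra.
pose D2 := (c / 4) `^ a^-1; have D20 : 0 < D2 by apply: powR_gt0; lra.
pose S0 := Num.sqrt (2 * (D / D2)).
have S00 : 0 <= S0 by exact: sqrtr_ge0.
exists (24 + 2 * (S0 * Cth)); first by rewrite addr_ge0// !mulr_ge0.
move=> A q n N A1 n0 hN eps hq.
have A0 : 0 < A by lra.
have nu0 : (0 : R) < n%:R by rewrite ltr0n.
have N0 : (0 : R) < N%:R by apply: lt_le_trans hN; exact: powR_gt0.
have eps0 : 0 < eps by rewrite /eps mulr_gt0 ?powR_gt0//; lra.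
set P := A `^ (2 / (1 + th)).
have AP : A <= P.
  rewrite -[leLHS]powRr1; last exact: ltW.
  apply: ler_powR => //.
  by rewrite ler_pdivlMr; lra.
have h1 : N%:R `^ ((1 - th) / (1 + th)) <= N%:R * n%:R `^ (- (2 * th)).
  have -> : N%:R `^ ((1 - th) / (1 + th)) = N%:R * N%:R `^ (- (2 * th / (1 + th))).
    rewrite (@powR_add _ _ 1 (- (2 * th / (1 + th)))) ?powRr1 ?ltW//.
    by field; apply/eqP; lra.
  apply: ler_wpM2l; first exact: ltW.
  have -> : n%:R `^ (- (2 * th)) = (n%:R `^ (1 + th)) `^ (- (2 * th / (1 + th))).
    by rewrite -powRrM; congr powR; field; apply/eqP; lra.
  by apply: ler_powR_exp_neg; rewrite ?powR_gt0// divr_ge0//; lra.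
have h2 : Num.sqrt (2 * (N%:R * D / eps)) * n%:R `^ (- (1 / 2 + th)) <=
    N%:R * (S0 * n%:R `^ (- (2 * th))).
  have -> : n%:R `^ (- (2 * th)) = n%:R `^ (1 / 2 - th) * n%:R `^ (- (1 / 2 + th)).
    by rewrite (@powR_add _ _ (1 / 2 - th) (- (1 / 2 + th)))//; field.
  rewrite !mulrA; apply: ler_wpM2r; first exact: powR_ge0.
  have -> : n%:R `^ (1 / 2 - th) = Num.sqrt (n%:R `^ (1 - 2 * th)).
    by rewrite -powR12_sqrt ?powR_ge0// -powRrM; congr powR; field.
  rewrite -[X in _ <= X * _ * _](ger0_norm (ltW N0)) -sqrtr_sqr -!sqrtrM ?sqr_ge0//; last first.
    by rewrite mulr_ge0 ?sqr_ge0// mulr_ge0// divr_ge0// ltW.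
  apply: ler_wsqrtr.
  have -> : 2 * N%:R * D / eps = (2 * D * N%:R) * eps^-1 by ring.
  have -> : N%:R ^+ 2 * (2 * (D / D2)) * n%:R `^ (1 - 2 * th) =
    (2 * D * N%:R) * (N%:R * (D2^-1 * n%:R `^ (1 - 2 * th))) by ring.
  apply: ler_wpM2l; first by rewrite !mulr_ge0// ltW.
  rewrite /eps -/D2 invfM [n%:R `^ (- ((1 + th) / a))]powRN invrK.
  have -> : N%:R * (D2^-1 * n%:R `^ (1 - 2 * th)) = D2^-1 * (N%:R * n%:R `^ (1 - 2 * th)) by ring.
  apply: ler_wpM2l; first by rewrite invr_ge0 ltW.
  apply: le_trans (ler_wpM2r (powR_ge0 _ _) hN).
  (* This identity of exponents, 2 - th = (1 + th) / a, determines th. *)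
  rewrite -(@powR_add _ _ (1 + th) (1 - 2 * th) ((1 + th) / a))//.
  rewrite thE; field; apply/andP; split; apply/eqP; lra.
have h3 : N%:R * q ^+ 2 <= N%:R * ((24 + 2 * (S0 * Cth)) * P * n%:R `^ (- (2 * th))).
  apply: (le_trans hq); rewrite -/P.
  have P0 : 0 <= P by exact: powR_ge0.
  have i1 := ler_wpM2l P0 h1.
  have i2 : Num.sqrt (2 * (N%:R * D / eps)) * A * (Cth * n%:R `^ (- (1 / 2 + th))) <=
      P * Cth * (N%:R * (S0 * n%:R `^ (- (2 * th)))).
    have -> : Num.sqrt (2 * (N%:R * D / eps)) * A * (Cth * n%:R `^ (- (1 / 2 + th))) =
      A * Cth * (Num.sqrt (2 * (N%:R * D / eps)) * n%:R `^ (- (1 / 2 + th))) by ring.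
    apply: ler_pM.
    - by rewrite mulr_ge0// ltW.
    - by rewrite mulr_ge0 ?sqrtr_ge0 ?powR_ge0.
    - exact: ler_wpM2r.
    - exact: h2.
  move: i1 i2; set u := n%:R `^ _; set v := N%:R `^ _; set w := Num.sqrt _ * A * _.
  move=> i1 i2.
  have -> : N%:R * ((24 + 2 * (S0 * Cth)) * P * u) =
    24 * (P * (N%:R * u)) + 2 * (P * Cth * (N%:R * (S0 * u))) by ring.
  lra.
rewrite ler_pM2l// in h3.
rewrite exprMn.
have -> : (n%:R `^ th) ^+ 2 = n%:R `^ (2 * th).
  by rewrite expr2 -(@powR_add _ _ th th (2 * th))//; ring.
have n2 := ler_wpM2l (powR_ge0 n%:R (2 * th)) h3.
apply: (le_trans n2).
have uv : n%:R `^ (- (2 * th)) * n%:R `^ (2 * th) = 1 :> R.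
  by rewrite -(@powR_add _ _ (- (2 * th)) (2 * th) 0) ?powRr0//; ring.
move: uv; set u := _ `^ (- _); set v := _ `^ (2 * th) => uv.
have -> : v * ((24 + 2 * (S0 * Cth)) * P * u) = (24 + 2 * (S0 * Cth)) * P * (u * v) by ring.
by rewrite uv mulr1.
Qed.

Lemma bootstrap_close (A C th : R) : 0 < th -> 1 <= A -> 0 <= C ->
  A ^+ 2 <= C * A `^ (2 / (1 + th)) -> A <= C `^ ((1 + th) / (2 * th)).
Proof.
move=> th0 A1 C0 h; have A0 : 0 < A by lra.
have A2 : A ^+ 2 = A `^ (2 * th / (1 + th)) * A `^ (2 / (1 + th)).
  rewrite -(@powR_add _ _ (2 * th / (1 + th)) (2 / (1 + th)) 2)//.
    by rewrite powR_mulrn// ltW.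
  by field; apply/eqP; lra.
rewrite A2 ler_pM2r ?powR_gt0// in h.
have -> : A = (A `^ (2 * th / (1 + th))) `^ ((1 + th) / (2 * th)).
  rewrite -powRrM -[LHS]powRr1 ?ltW//; congr powR.
  by field; apply/andP; split; apply/eqP; lra.
by apply: ge0_ler_powR; rewrite ?nnegrE ?powR_ge0// divr_ge0//; lra.
Qed.

End bootstrap_algebra.

(** * Power law *)

Section stars.
Context {R : realType} {G : weighted_graph R}.
Local Notation V := (vertex G).
Local Notation E := (edge G).
Implicit Types (e : E) (s S : seq E) (v o : V).

(** Loops are left out because [two_ghost] compares the clusters of two distinct ends. *)
Definition heavy (eps : R) e : bool :=
  (eps <= @weight R G e) && ((@ends R G e).1 != (@ends R G e).2).

Lemma heavy_inv eps f g : @automorphism R G f g -> forall e, heavy eps (g e) = heavy eps e.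
Proof.
move=> [fb gb gends gw] e; have fI := bij_inj fb; rewrite /heavy gw; congr (_ && _).
by have [h|h] := gends e; rewrite h /= (inj_eq fI)// eq_sym.
Qed.

Lemma heavy_darts_finite v (eps : R) : 0 < eps ->
  finite_set (oriented_edges_from v `&` [set d | eps <= @weight R G d.1]).
Proof.
move=> eps0; apply: contrapT => inf.
have W0 : (0 <= \esum_(d in [set d | origin (@ends R G) d = v]) (weight d.1)%:E)%E.
  by apply: esum_ge0 => d _; rewrite lee_fin ltW// weight_gt0.
have := @weight_summable R G v; move: W0.
case WE : (\esum_(d in _) _)%E => [W| |] // W0 _; rewrite lee_fin in W0.
pose n := Num.bound (W / eps).
have [B BA nB] := infinite_set_fset n inf.
have : ((\sum_(d <- finmap.enum_fset B) @weight R G d.1)%:E <= W%:E)%E.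
  rewrite -WE; apply: esum_ge; exists [set` finmap.enum_fset B].
    by split; [exact: finite_seq|move=> d dB; have [] := BA d dB].
  by rewrite -sumEFin -fsbig_seq ?finmap.fset_uniq.
rewrite lee_fin; apply/negP; rewrite -ltNge.
apply: (@lt_le_trans _ _ (n%:R * eps)).
  by rewrite -ltr_pdivrMr//; apply: archi_boundP; rewrite divr_ge0// ltW.
apply: (@le_trans _ _ (\sum_(d <- finmap.enum_fset B) eps)).
  rewrite big_const_seq iter_addr_0 count_predT -[leRHS]mulr_natl.
  by apply: ler_wpM2r; [exact: ltW|rewrite ler_nat].
rewrite big_seq [leRHS]big_seq; apply: ler_sum => d dB.
by have [] := BA d dB.
Qed.

Lemma star_exists v (eps : R) : @simple_graph R G -> 0 < eps ->
  exists S, [/\ uniq S, forall e, (e \in S) = heavy eps e && incident e v &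
    (@counting _ R (oriented_edges_from v `&` [set d | (eps <= @weight R G d.1)%R]) <=
      (2 * (size S)%:R + 2)%:E)%E].
Proof.
move=> simple eps0; set A := oriented_edges_from v `&` _.
have finA : finite_set A by exact: heavy_darts_finite.
pose ds := finmap.enum_fset (fset_set A).
have dsA d : d \in ds -> A d by rewrite in_fset_set// inE.
have Ads d : A d -> d \in ds by move=> h; rewrite in_fset_set// inE.
pose T := undup (map fst ds); pose S := [seq e <- T | (@ends R G e).1 != (@ends R G e).2].
have TP e : e \in T <-> (eps <= @weight R G e) /\ incident e v.
  rewrite mem_undup; split=> [/mapP[d /dsA[dv dw] ->]|[we ev]].
    split => //; move: dv; rewrite /oriented_edges_from/= /origin /incident.
    by case: (d.2) => <-; rewrite eqxx ?orbT.
  apply/mapP; case/orP: ev => /eqP ev.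
    by exists (e, false) => //; apply: Ads.
  by exists (e, true) => //; apply: Ads.
have uT : uniq T by exact: undup_uniq.
exists S; split.
- by rewrite filter_uniq.
- move=> e; rewrite mem_filter /heavy; apply/andP/andP => [[ll /TP[we ev]]|[/andP[we ll] ev]].
    by rewrite we.
  by split => //; apply/TP.
rewrite /counting asboolT// lee_fin -/ds -natrM -natrD ler_nat.
have h1 : (size ds <= size [seq (e, b) | e <- T, b <- [:: true; false]])%N.
  apply: uniq_leq_size; first exact: finmap.fset_uniq.
  move=> [e b] edb; apply/allpairsP; exists (e, b); split => //=; last by case: b {edb}.
  by rewrite mem_undup; apply/mapP; exists (e, b).
have h2 : (size [seq e <- T | ~~ ((@ends R G e).1 != (@ends R G e).2)] <= 1)%N.
  set T' := [seq e <- T | _]; have uT' : uniq T' by rewrite filter_uniq.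
  have same : {in T' &, forall e e', e = e'}.
    move=> e e'; rewrite !mem_filter !negbK => /andP[/eqP l /TP[_ ev]] /andP[/eqP l' /TP[_ ev']].
    apply: simple; left; move: l l' ev ev'; rewrite /incident.
    case: (ends e) => x x' /=; case: (ends e') => y y' /= -> ->.
    by rewrite !orbb => /eqP -> /eqP ->.
  case: T' uT' same => [|e [|e' l]] //= /andP[]; rewrite inE negb_or => /andP[ee' _] _ same.
  by move: ee'; rewrite (same e e') ?inE ?eqxx ?orbT.
have h3 : size T = (size S + size [seq e <- T | ~~ ((@ends R G e).1 != (@ends R G e).2)])%N.
  by rewrite !size_filter -(count_predC (fun e => (@ends R G e).1 != (@ends R G e).2) T).
rewrite size_allpairs/= in h1; move: h1 h2; rewrite h3.
move: (size ds) (size S) (size _) => x y z; lia.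
Qed.

(** Simplicity of the graph turns N edges at [v] into N distinct vertices, the set to which
    [tightness] is applied. *)
Lemma other_inj v S : @simple_graph R G -> (forall e, e \in S -> incident e v) ->
  {in S &, injective (fun e => other e v)}.
Proof.
move=> simple Sv e e' /Sv/incident_other je /Sv/incident_other je' oo.
apply: simple; move: je je'; rewrite oo /same_ends /joins.
by case: (ends e) => x x'; case: (ends e') => y y' /= /orP[]/eqP[-> ->] /orP[]/eqP[-> ->] /=; auto.
Qed.

Lemma Pr_big_map (k : E -> R) f g s v n : invariant_weights k -> @automorphism R G f g ->
  Pr (pexp k 1) (map g s) (fun w => big w (f v) n) = Pr (pexp k 1) s (fun w => big w v n).
Proof.
move=> kinv fg; apply: (@Pr_map _ _ k 1 f g s _ _ kinv fg) => g' gK g'K w.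
have [[f' fK f'K] _ gends _] := fg.
exact: (big_mapE fK f'K gK g'K gends).
Qed.

End stars.

Section power_law.
Context {R : realType} {G : weighted_graph R}.
Local Notation V := (vertex G).
Local Notation E := (edge G).
Implicit Types (e : E) (s S : seq E) (v o : V).
Hypothesis G_simple : @simple_graph R G.
Hypothesis G_transitive : @transitive_graph R G.
Hypothesis G_unimodular : @unimodular R G.
Variables (o : V) (a c eps0 K sl : R).
Hypotheses (a_gt : 1 / 2 < a) (a_lt : a < 1) (c_gt0 : 0 < c) (eps0_gt0 : 0 < eps0)
  (sl_gt0 : 0 < sl).
Hypothesis G_edges : forall eps : R, 0 < eps -> eps <= eps0 ->
  ((c * eps `^ (- a))%:E <=
     @counting _ R (oriented_edges_from o `&` [set d | (eps <= @weight R G d.1)%R]))%E.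

Let th := (2 * a - 1) / (a + 1).

Let th0 : 0 < th. Proof. by rewrite divr_gt0//; move: a_gt; lra. Qed.
Let th1 : th < 1 / 2. Proof. by rewrite ltr_pdivrMr; move: a_gt a_lt; lra. Qed.

(** The class of weights over which the constant of [power_law] is uniform. It is used for beta J
    with beta close to [beta_c], and for the truncated weights min(beta J, 1) with arbitrarily large
    beta. *)
Definition dominating (k : E -> R) := [/\ forall e, 0 <= k e, invariant_weights k,
  forall e, k e <= K &
  forall eps e, 0 < eps -> eps <= eps0 -> eps <= @weight R G e -> sl * eps <= k e].

Let D := expR (2 * K) / sl.

(** The solution eps of c eps^(-a) = 4 n^(1+th). The factor 4 absorbs the loss from [2 * size S + 2]
    in [star_exists]. *)
Let scale (n : nat) : R := (c / 4) `^ a^-1 * n%:R `^ (- ((1 + th) / a)).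

Let a0 : 0 < a. Proof. by move: a_gt; lra. Qed.

Lemma scale_gt0 n : (0 < n)%N -> 0 < scale n.
Proof. by move=> n0; rewrite mulr_gt0// powR_gt0 ?ltr0n// divr_gt0. Qed.

Lemma star_size n S : (0 < n)%N -> scale n <= eps0 ->
  (@counting _ R (oriented_edges_from o `&` [set d | (scale n <= @weight R G d.1)%R]) <=
      (2 * (size S)%:R + 2)%:E)%E ->
  n%:R `^ (1 + th) <= (size S)%:R.
Proof.
move=> n0 le0 hS; have nu0 : (0 : R) < n%:R by rewrite ltr0n.
have := le_trans (G_edges (scale_gt0 n0) le0) hS; rewrite lee_fin.
have -> : c * scale n `^ (- a) = 4 * n%:R `^ (1 + th).
  rewrite /scale powRM ?powR_ge0// -!powRrM.
  have -> : a^-1 * - a = -1 by field; rewrite gt_eqF.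
  have -> : - ((1 + th) / a) * - a = 1 + th by field; rewrite gt_eqF.
  rewrite powR_inv1; last by rewrite divr_ge0// ltW.
  by field; rewrite gt_eqF.
have : 1 <= n%:R `^ (1 + th).
  suff : 1 `^ (1 + th) <= n%:R `^ (1 + th) by rewrite powR1.
  by apply: ge0_ler_powR; rewrite ?nnegrE ?ler1n//; move: th0; lra.
lra.
Qed.

Section fixed_weights.
Variables (k : E -> R) (A : R).
Hypothesis kdom : dominating k.
Hypothesis A_ge1 : 1 <= A.
Hypothesis A_bound : forall s v n, uniq s -> (0 < n)%N ->
  Pr (pexp k 1) s (fun w => big w v n) <= A * n%:R `^ (- th).
Variable chi : R.
Hypothesis chi_bound : forall s u T, uniq s -> uniq T ->
  \sum_(y <- T) Pr (pexp k 1) s (fun w => conn w u y) <= chi.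

Let k0 e : 0 <= k e. Proof. by case: kdom => h _ _ _; exact: h. Qed.
Let kinv : invariant_weights k. Proof. by case: kdom. Qed.
Let p01 : prob_vec (pexp k 1). Proof. by apply: pexp_prob. Qed.

(** p (1 - p) = (1 - exp(-k)) exp(-k) is at least k exp(-2 k), hence at least sl eps exp(-2 K), the
    inverse of [D / eps]. *)
Lemma coef_bound eps e : 0 < eps -> eps <= eps0 -> heavy eps e ->
  edge_coef k e <= D / eps.
Proof.
move=> eps_gt0 epsle /andP[we _]; have [_ _ kK ksl] := kdom.
have ke := ksl _ _ eps_gt0 epsle we; have keK := kK e.
have ke0 : 0 < k e by apply: lt_le_trans ke; rewrite mulr_gt0.
have sle : 0 < sl * eps by rewrite mulr_gt0.
rewrite /edge_coef /pexp !mul1r subKr.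
have -> : D / eps = (expR (- (2 * K)) * (sl * eps))^-1.
  by rewrite /D expRN; field; rewrite !gt_eqF ?expR_gt0.
have e1 : expR (- k e) < 1 by rewrite -[ltRHS]expR0 ltr_expR oppr_lt0.
rewrite lef_pV2 ?posrE ?mulr_gt0 ?expR_gt0 ?subr_gt0//.
have h1 : k e * expR (- k e) <= 1 - expR (- k e).
  have := expR_ge1Dx (k e); have := expR_gt0 (- k e); have := expRN (k e).
  set x := expR (k e); set y := expR (- k e) => yE y0 hx.
  have xy : x * y = 1 by rewrite yE divff// gt_eqF// expR_gt0.
  have := ler_wpM2r (ltW y0) hx; rewrite xy; lra.
have h2 : expR (- (2 * K)) <= expR (- k e) * expR (- k e).
  rewrite -expRD ler_expR; lra.
apply: (@le_trans _ _ (expR (- k e) * (k e * expR (- k e)))); last first.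
  by rewrite mulrC; apply: ler_wpM2r => //; exact: expR_ge0.
rewrite [leRHS]mulrCA [leRHS]mulrC.
by apply: ler_pM => //; exact: ltW.
Qed.

Lemma star_coef_bound eps S s v : 0 < eps -> eps <= eps0 -> uniq S -> uniq s ->
  (forall e, (e \in S) = heavy eps e && incident e o) ->
  \sum_(e <- s | heavy eps e && incident e v) edge_coef k e <= (size S)%:R * D / eps.
Proof.
move=> eps_gt0 epsle uS us SE.
apply: (@le_trans _ _ (\sum_(e <- s | heavy eps e && incident e v) D / eps)).
  by apply: ler_sum => e /andP[he _]; exact: coef_bound.
rewrite big_const_seq iter_addr_0 -[leLHS]mulr_natl -mulrA; apply: ler_wpM2r.
  by rewrite !divr_ge0 ?expR_ge0// ltW.
rewrite ler_nat -size_filter.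
have [f [g [fg fov]]] := G_transitive v o.
have [_ gb _ _] := fg; have gI := bij_inj gb.
rewrite -(size_map g); apply: uniq_leq_size.
  by rewrite map_inj_uniq// filter_uniq.
move=> _ /mapP[e + ->]; rewrite mem_filter => /andP[/andP[he ev] _].
by rewrite SE (heavy_inv eps fg) he/= -fov (incident_map _ _ fg).
Qed.

Lemma bootstrap_ineq n s1 : (0 < n)%N -> scale n <= eps0 -> uniq s1 ->
  forall Cth, (forall n I, (0 < n)%N ->
    \sum_(i < I) (maxn n (2 ^ i))%:R^-1 * (2 ^ i)%:R `^ (1 / 2 - th) <=
    Cth * n%:R `^ (- (1 / 2 + th)) :> R) ->
  let q := Pr (pexp k 1) s1 (fun w => big w o n) in
  exists2 N : nat, n%:R `^ (1 + th) <= N%:R &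
  N%:R * q ^+ 2 <= 24 * (A `^ (2 / (1 + th)) * N%:R `^ ((1 - th) / (1 + th))) +
    2 * (Num.sqrt (2 * (N%:R * D / scale n)) * A * (Cth * n%:R `^ (- (1 / 2 + th)))).
Proof.
move=> n0 le0 us1 Cth hCth q.
have eps_gt0 := scale_gt0 n0.
have [S [uS SE hS]] := star_exists o G_simple eps_gt0.
have hN := star_size n0 le0 hS; pose N := size S; exists N => //.
have nu0 : (0 : R) < n%:R by rewrite ltr0n.
have N0 : (0 < N)%N by rewrite -(ltr0n R); apply: lt_le_trans hN; exact: powR_gt0.
have N0' : (0 : R) < N%:R by rewrite ltr0n.
have D0 : 0 < D by rewrite divr_gt0// expR_gt0.
pose sig2 := N%:R * D / scale n.
have sig20 : 0 < sig2 by rewrite /sig2 divr_gt0// mulr_gt0.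
have q0 : 0 <= q by exact: Pr_ge0.
(* By transitivity [q] is also attained at each neighbour, on a translate of [s1]; finitely many
   such lists are merged. *)
have [s2 us2 hs2] : exists2 s, uniq s & forall e, e \in S ->
    q <= Pr (pexp k 1) s (fun w => big w (other e o) n).
  apply: common_edges.
    move=> e s s' us us' ss' h; apply: le_trans h _.
    by apply: Pr_subset => //; exact: big_incr.
  move=> e; have [f [g [fg fo]]] := G_transitive o (other e o).
  exists (map g s1).
    by have [_ gb _ _] := fg; rewrite map_inj_uniq//; exact: bij_inj.
  by rewrite -fo Pr_big_map.
pose s0 := undup (s1 ++ s2 ++ S).
have us0 : uniq s0 by exact: undup_uniq.
have sub1 : {subset s1 <= s0} by move=> e h; rewrite mem_undup !mem_cat h.
have sub2 : {subset s2 <= s0} by move=> e h; rewrite mem_undup !mem_cat h orbT.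
have sub3 : {subset S <= s0} by move=> e h; rewrite mem_undup !mem_cat h !orbT.
have os0 : o \in vs s0.
  have [e eS] : exists e, e \in S by move: N0; rewrite /N; case: (S) => // e l _; exists e; rewrite mem_head.
  by apply: (@incident_vs _ _ s0 e); [exact: sub3|move: eS; rewrite SE => /andP[]].
have heavy_pos e : heavy (scale n) e -> 0 < k e.
  move=> /andP[we _]; have [_ _ _ ksl] := kdom.
  by apply: lt_le_trans (ksl _ _ eps_gt0 le0 we); rewrite mulr_gt0.
apply/ler_addgt0Pr => eta eta0.
have [s [us s0s hs]] := two_ghost G_unimodular k0 kinv
  (fun f g fg e => heavy_inv (scale n) fg e) (fun e h => proj2 (andP h))
  heavy_pos n0 sig20 (fun s v us => star_coef_bound v eps_gt0 le0 uS us SE)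
  (fun s us => chi_bound o us (vs_uniq s)) us0 os0 eta0.
have Ssum (F : E -> R) : \sum_(e <- s | heavy (scale n) e && incident e o) F e =
    \sum_(e <- S) F e.
  rewrite -big_filter; apply: perm_big; apply: uniq_perm; rewrite ?filter_uniq//.
  move=> e; rewrite mem_filter -SE; apply/andP/idP => [[]//|eS].
  by split => //; apply: s0s; exact: sub3.
rewrite Ssum in hs.
(* The maximum matters at j = 0, where the power of 0 would be 0 but the probability is 1. *)
pose Q j := A * (maxn j 1)%:R `^ (- th).
have Qbig v j : Pr (pexp k 1) s (fun w => big w v j) <= Q j.
  case: j => [|j]; last by rewrite /Q (maxn_idPl _)//; exact: A_bound.
  by rewrite /Q max0n powR1 mulr1; apply: le_trans A_ge1; exact: Pr_le1.
have [M M0 [hM1 hM2]] := exists_scale th0 th1 A_ge1 N0.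
pose L := map (fun e => other e o) S.
have uL : uniq L.
  rewrite map_inj_in_uniq//; apply: (@other_inj _ _ o) => // e; rewrite SE => /andP[]//.
have QM : Q M = A * M%:R `^ (- th) by rewrite /Q (maxn_idPl _).
have tight : \sum_(e <- S) Pr (pexp k 1) s (fun w => conn w o (other e o)) <=
    24 * (A `^ (2 / (1 + th)) * N%:R `^ ((1 - th) / (1 + th))).
  apply: le_trans hM2.
  have := @tightness _ _ L (pexp k 1) p01 s us Q Qbig uL o M M0.
  rewrite QM size_map => /(_ hM1); rewrite /L big_map => /le_trans; apply.
  rewrite lerD2r; apply: ler_sum => j _; by rewrite /Q (maxn_idPl _).
(* By Harris both clusters are large with probability at least q^2; then either the two vertices are
   connected or the two-ghost event occurs. *)
have sumS : \sum_(e <- S) (q ^+ 2 - Pr (pexp k 1) s (fun w => conn w o (other e o))) <=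
   \sum_(e <- S) Pr (pexp k 1) s
     (fun w => [/\ big w o n, big w (other e o) n & ~ conn w o (other e o)]).
  rewrite big_seq [leRHS]big_seq; apply: ler_sum => e eS; rewrite lerBlDr.
  apply: (@le_trans _ _ (Pr (pexp k 1) s (fun w => big w o n) *
     Pr (pexp k 1) s (fun w => big w (other e o) n))).
    rewrite expr2; apply: ler_pM => //.
      by apply: Pr_subset => // [|z /sub1/s0s]; first exact: big_incr.
    apply: le_trans (hs2 _ eS) _; apply: Pr_subset => //; first exact: big_incr.
    by move=> z /sub2/s0s.
  apply: le_trans (Harris_Pr s p01 (@big_incr _ _ o n) (@big_incr _ _ (other e o) n)) _.
  rewrite /Pr -ExD; apply: Ex_le => // w.
  have [oy|noy] := pselect (conn w o (other e o)).
    by rewrite [X in _ + X]indT// (le_trans (ind_le1 _ _))// lerDr ind_ge0.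
  rewrite [X in _ + X]indF// addr0; apply: ind_le => -[b1 b2]; by split.
rewrite sumrB big_const_seq iter_addr_0 count_predT -[_ *+ _]mulr_natl -/N in sumS.
have fluct : \sum_(i < (2 * size s).+1) size_weight n (2 ^ i)%N *
    Num.sqrt (sig2 * (2 ^ i.+1)%:R) * Pr (pexp k 1) s (fun w => big w o (2 ^ i)) <=
    Num.sqrt (2 * sig2) * A * (Cth * n%:R `^ (- (1 / 2 + th))).
  have sA : 0 <= Num.sqrt (2 * sig2) * A.
    by apply: mulr_ge0; [exact: sqrtr_ge0|apply: le_trans A_ge1; exact: ler01].
  apply: le_trans (ler_wpM2l sA (hCth n (2 * size s).+1 n0)).
  rewrite big_distrr/=; apply: ler_sum => i _.
  have i0 : (0 : R) < (2 ^ i)%:R by rewrite ltr0n expn_gt0.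
  have -> : sig2 * (2 ^ i.+1)%:R = 2 * sig2 * (2 ^ i)%:R by rewrite expnS natrM; ring.
  rewrite sqrtrM; last by rewrite mulr_ge0// ltW.
  have -> : Num.sqrt (2 ^ i)%:R = (2 ^ i)%:R `^ (1 / 2) :> R.
    by rewrite mul1r powR12_sqrt// ltW.
  rewrite (@powR_add _ _ (1 / 2) (- th) (1 / 2 - th))// /size_weight.
  set u := _^-1; set x := Num.sqrt _; set y := _ `^ (1 / 2).
  have -> : x * A * (u * (y * (2 ^ i)%:R `^ (- th))) =
    u * (x * y) * (A * (2 ^ i)%:R `^ (- th)) by ring.
  apply: ler_wpM2l; first by rewrite !mulr_ge0 ?invr_ge0 ?sqrtr_ge0 ?powR_ge0.
  by apply: A_bound => //; rewrite expn_gt0.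
have := le_trans sumS hs; move: tight fluct.
rewrite /sig2; set X := \sum_(e <- S) _; set Y := \sum_(i < _) _.
by set Z := Num.sqrt _ * A * _; set T := 24 * _ => *; lra.
Qed.

End fixed_weights.

(** Markov's inequality for the cluster size; it gives the a priori finiteness of the best constant
    in [power_law]. *)
Lemma size_moment_le (k : E -> R) chi : (forall e, 0 <= k e) ->
  (forall s u T, uniq s -> uniq T ->
    \sum_(y <- T) Pr (pexp k 1) s (fun w => conn w u y) <= chi) ->
  forall s v n, uniq s -> n%:R * Pr (pexp k 1) s (fun w => big w v n) <= chi.
Proof.
move=> k0 hchi s v n us; have p01 : prob_vec (pexp k 1) by exact: pexp_prob.
pose T := undup (v :: vs s).
apply: le_trans (hchi s v T us (undup_uniq _)); rewrite /Pr -Ex_sum -ExZ.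
apply: Ex_le_supp => // w sw; have [b|nb] := pselect (big w v n); last first.
  by rewrite indF// mulr0; apply: sumr_ge0 => y _; exact: ind_ge0.
rewrite indT// mulr1; have [t [ut <- ht]] := b.
have -> : \sum_(y <- T) ind (fun w => conn w v y) w = (count (fun y => `[< conn w v y >]) T)%:R :> R.
  rewrite -sum1_count natr_sum [RHS]big_mkcond/=; apply: eq_bigr => y _.
  by rewrite /ind; case: ifP.
rewrite ler_nat -size_filter; apply: uniq_leq_size => // x xt.
rewrite mem_filter asboolT/=; last exact: ht.
rewrite mem_undup inE; have [<-|[_ ->]] := conn_supp sw (ht _ xt); by rewrite ?eqxx ?orbT.
Qed.

Lemma power_law : exists2 C : R, 0 <= C & forall k, dominating k -> forall chi,
  (forall s u T, uniq s -> uniq T ->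
    \sum_(y <- T) Pr (pexp k 1) s (fun w => conn w u y) <= chi) ->
  forall s v n, uniq s -> (0 < n)%N ->
  Pr (pexp k 1) s (fun w => big w v n) <= C * n%:R `^ (- th).
Proof.
have [Cth Cth0 hCth] := dyadic_powR_sum th0 th1.
have D0 : 0 < D by rewrite divr_gt0// expR_gt0.
have [C1 C10 hC1] := bootstrap_step a_gt a_lt c_gt0 D0 Cth0 (erefl th).
(* If [scale n] exceeds [eps0], the hypothesis on the edges says nothing, but then n <= [n0] and
   n^th q <= n <= [n0]; hence the term n0^2 in [C2]. *)
pose n0 := (c / 4) `^ a^-1 / eps0.
pose C2 := C1 + n0 ^+ 2.
have C20 : 0 <= C2 by rewrite addr_ge0 ?sqr_ge0.
exists (C2 `^ ((1 + th) / (2 * th))); first exact: powR_ge0.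
move=> k kdom chi hchi.
have [k0 kinv _ _] := kdom.
have p01 : prob_vec (pexp k 1) by exact: pexp_prob.
(* [X] is bounded by [chi] since th <= 1, so the best constant [A] exists; the bound found for it is
   free of [chi]. *)
pose X : set R := [set x | exists s v n, [/\ uniq s, (0 < n)%N &
  x = n%:R `^ th * Pr (pexp k 1) s (fun w => big w v n)]].
have X1 : X 1.
  exists [::], o, 1%N; split => //; rewrite powR1 mul1r /Pr/= indT//; exact: big_self.
have Xle : ubound X chi.
  move=> _ [s [v [n [us n_gt0 ->]]]].
  apply: le_trans (size_moment_le k0 hchi v n us); apply: ler_wpM2r; first exact: Pr_ge0.
  rewrite -[leRHS]powRr1//; apply: ler_powR; first by rewrite ler1n.
  by move: th1; lra.
have supX : has_sup X by split; [exists 1|exists chi].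
pose A := sup X.
have XA x : X x -> x <= A by move=> Xx; apply: ub_le_sup => //; exists chi.
have A1 : 1 <= A by exact: XA.
have powN n : (0 < n)%N -> n%:R `^ th * n%:R `^ (- th) = 1 :> R.
  move=> n_gt0; rewrite -(@powR_add _ _ th (- th) 0) ?powRr0 ?ltr0n//; ring.
have A_bound s v n : uniq s -> (0 < n)%N ->
    Pr (pexp k 1) s (fun w => big w v n) <= A * n%:R `^ (- th).
  move=> us n_gt0; have := XA _ (ex_intro _ s (ex_intro _ v (ex_intro _ n (And3 us n_gt0 erefl)))).
  move=> /(ler_wpM2r (powR_ge0 n%:R (- th))); apply: le_trans.
  by rewrite mulrAC powN// mul1r.
have P1 : 1 <= A `^ (2 / (1 + th)).
  suff : 1 `^ (2 / (1 + th)) <= A `^ (2 / (1 + th)) by rewrite powR1.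
  apply: ge0_ler_powR; rewrite ?nnegrE ?ler01//; last by apply: le_trans A1; exact: ler01.
  by rewrite divr_ge0//; move: th0; lra.
have key x : X x -> x ^+ 2 <= C2 * A `^ (2 / (1 + th)).
  move=> [s [v [n [us n_gt0 ->]]]].
  have nu0 : (0 : R) < n%:R by rewrite ltr0n.
  have [f [g [fg fov]]] := G_transitive o v.
  have [f' [g' [fK f'K gK g'K fg']]] := automorphism_inv fg.
  have us' : uniq (map g' s) by rewrite map_inj_uniq//; exact: can_inj g'K.
  have -> : Pr (pexp k 1) s (fun w => big w v n) =
      Pr (pexp k 1) (map g' s) (fun w => big w o n).
    by rewrite -(Pr_big_map s v n kinv fg') -fov fK.
  set q := Pr _ _ _; have q0 : 0 <= q by exact: Pr_ge0.
  have q1 : q <= 1 by exact: Pr_le1.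
  have [sn|sn] := leP (scale n) eps0.
    have [N hN hq] := bootstrap_ineq kdom A1 A_bound hchi n_gt0 sn us' hCth.
    apply: le_trans (hC1 A q n N A1 n_gt0 hN hq) _.
    by apply: ler_wpM2r; [exact: powR_ge0|rewrite lerDl sqr_ge0].
  have nth : n%:R `^ th <= n%:R.
    rewrite -[leRHS]powRr1//; apply: ler_powR; first by rewrite ler1n.
    by move: th1; lra.
  have nn0 : n%:R <= n0.
    rewrite /n0 ler_pdivlMr// mulrC; apply: le_trans (ler_wpM2r (ltW nu0) (ltW sn)) _.
    rewrite /scale -mulrA ger_pMr ?powR_gt0//; last by rewrite divr_gt0.
    rewrite -{2}[n%:R]powRr1//.
    rewrite -(@powR_add _ _ (- ((1 + th) / a)) 1 (1 - (1 + th) / a))//; last by ring.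
    rewrite -[leRHS](powRr0 n%:R); apply: ler_powR; first by rewrite ler1n.
    rewrite subr_le0 ler_pdivlMr//; move: th0 a_lt; lra.
  have n00 : 0 <= n0 by apply: le_trans nn0; exact: ltW.
  have h1 : n%:R `^ th * q <= n0.
    apply: le_trans nn0; apply: le_trans nth; rewrite -[leRHS]mulr1.
    by apply: ler_wpM2l => //; exact: powR_ge0.
  have h0 : 0 <= n%:R `^ th * q by rewrite mulr_ge0 ?powR_ge0.
  apply: (@le_trans _ _ (n0 ^+ 2)); first by rewrite ler_sqr ?nnegrE.
  apply: (@le_trans _ _ (C2 * 1)); first by rewrite mulr1 lerDr.
  exact: ler_wpM2l.
set B := C2 * _ in key.
have B0 : 0 <= B by rewrite mulr_ge0 ?powR_ge0.
have AB : A ^+ 2 <= B.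
  have : A <= Num.sqrt B.
    apply: ge_sup; first by exists 1.
    by move=> x Xx; apply: (le_trans (ler_norm x)); rewrite -sqrtr_sqr; apply/ler_wsqrtr/key.
  move=> h; rewrite -(sqr_sqrtr B0) ler_sqr ?nnegrE ?sqrtr_ge0//.
  by apply: le_trans A1; exact: ler01.
have AC := bootstrap_close th0 A1 C20 AB.
move=> s v n us n_gt0; apply: le_trans (A_bound s v n us n_gt0) _.
by apply: ler_wpM2r => //; exact: powR_ge0.
Qed.

End power_law.

(** * From finite edge sets to the percolation measure *)

Section cylinders.
Context {R : realType} {G : weighted_graph R}.
Local Notation V := (vertex G).
Local Notation E := (edge G).
Implicit Types (w : E -> bool) (e : E) (s t : seq E) (b : E -> bool)
  (A : (E -> bool) -> Prop).
Variable p : E -> R.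
Variable P : probability (configuration E) R.
Hypothesis Pp : is_bernoulli_product p P.

Lemma measurable_cylinder s b : measurable (cylinder s b : set (configuration E)).
Proof.
have -> : cylinder s b = \bigcap_(e in [set` s]) [set w | w e = b e] by [].
apply: fin_bigcap_measurable => // e _.
have me : measurable ([set w : E -> bool | w e] : set (configuration E)).
  by apply: sub_sigma_algebra; exists e.
case: (b e) => //; rewrite (_ : [set w | _] = ~` [set w : configuration E | w e]).
  exact: measurableC.
by apply/seteqP; split => w /=; case: (w e).
Qed.

(** The cylinder over [t] records the edges whose state is already fixed; the induction on [s] moves
    them there one by one. *)
Definition finite_event s t b A : set (configuration E) :=
  cylinder t b `&` [set w | A (restr s w)].

Lemma finite_event_prob s t b A : uniq (s ++ t) ->
  measurable (finite_event s t b A) /\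
  P (finite_event s t b A) =
    ((\prod_(e <- t) (if b e then p e else 1 - p e)) * Pr p s A)%:E.
Proof.
elim: s t b A => [|e s IH] t b A ust.
  have rE w : restr [::] w = (fun=> false) by apply/funext.
  have [A0|nA0] := pselect (A (fun=> false)).
    have -> : finite_event [::] t b A = cylinder t b.
      by apply/seteqP; split => w => [[]|cw]//; split => //=; rewrite rE.
    split; first exact: measurable_cylinder.
    by rewrite (Pp _ _) // /Pr/= indT// mulr1.
  have -> : finite_event [::] t b A = set0.
    by apply/seteqP; split => w //= -[_ /=]; rewrite rE.
  by split; [exact: measurable0|rewrite measure0 /Pr/= indF// mulr0].
move: ust => /= /andP[]; rewrite mem_cat negb_or => /andP[es et] ust.
have ust' : uniq (s ++ e :: t).
  by rewrite (perm_uniq (permEl (perm_catCA s [:: e] t)))/= mem_cat negb_or es et.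
pose Ab (c : bool) w := A (upd w e c).
have [m1 P1] := IH (e :: t) (upd b e true) (Ab true) ust'.
have [m0 P0] := IH (e :: t) (upd b e false) (Ab false) ust'.
have rU w c : w e = c -> restr (e :: s) w = upd (restr s w) e c.
  move=> we; apply/funext => f; rewrite /restr /upd inE.
  by case: eqVneq => [->|].
have cylE w c : cylinder (e :: t) (upd b e c) w <-> w e = c /\ cylinder t b w.
  split=> [h|[we h] f].
    split; first by have := h e (mem_head _ _); rewrite updE.
    move=> f ft; have := h f; rewrite inE ft orbT /upd => /(_ isT).
    by case: eqVneq => // fe; move: et; rewrite -fe ft.
  rewrite inE /upd; case: eqVneq => [->//|_ /=]; exact: h.
have UE : finite_event (e :: s) t b A =
    finite_event s (e :: t) (upd b e true) (Ab true) `|`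
    finite_event s (e :: t) (upd b e false) (Ab false).
  apply/seteqP; split => w /=.
    move=> [cw /= Aw]; case we : (w e); [left|right]; split; try (by apply/cylE);
      by rewrite /= /Ab -rU.
  by case=> -[/cylE[we cw] /= Aw]; split => //=; rewrite (rU _ _ we).
rewrite UE; split; first exact: measurableU.
set X1 := finite_event s _ _ (Ab true) in m1 P1 *.
set X0 := finite_event s _ _ (Ab false) in m0 P0 *.
have PU : P (X1 `|` X0) = (P X1 + P X0)%E.
  apply: measureU => //; apply/seteqP; split => // w [[/cylE[w1 _] _] [/cylE[w0 _] _]].
  by rewrite w1 in w0.
rewrite PU P1 P0 -EFinD !big_cons !updE; congr EFin.
have prodE c : \prod_(f <- t) (if upd b e c f then p f else 1 - p f) =
    \prod_(f <- t) (if b f then p f else 1 - p f).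
  rewrite !big_seq; apply: eq_bigr => f ft; rewrite /upd; case: eqVneq => // fe.
  by move: et; rewrite -fe ft.
rewrite !prodE /Pr /= /Ab; ring.
Qed.

Lemma restr_event_prob s A : uniq s ->
  measurable ([set w | A (restr s w)] : set (configuration E)) /\
  P [set w | A (restr s w)] = (Pr p s A)%:E.
Proof.
move=> us; have us' : uniq (s ++ [::]) by rewrite cats0.
have [m PE] := finite_event_prob (fun=> true) A us'.
have h : finite_event s [::] (fun=> true) A = [set w | A (restr s w)].
  by apply/seteqP; split => w => [[]|Aw].
by rewrite -h PE big_nil mul1r.
Qed.

Definition exhaustion (m : nat) : seq E := undup (pmap unpickle (iota 0 m)).

Lemma mem_exhaustion e m : (pickle e < m)%N -> e \in exhaustion m.
Proof.
move=> em; rewrite mem_undup mem_pmap; apply/mapP; exists (pickle e).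
  by rewrite mem_iota.
by rewrite pickleK.
Qed.

Lemma exhaustion_sub m m' : (m <= m')%N -> {subset exhaustion m <= exhaustion m'}.
Proof.
move=> mm' e; rewrite !mem_undup !mem_pmap => /mapP[i im ->]; apply: map_f.
by move: im; rewrite !mem_iota /= !add0n => /leq_trans; apply.
Qed.

Lemma exhaustion_cover s : exists m, {subset s <= exhaustion m}.
Proof.
elim: s => [|e s [m hm]]; first by exists 0%N.
exists (maxn m (pickle e).+1) => f; rewrite inE => /orP[/eqP ->|/hm].
  by apply: mem_exhaustion; rewrite leq_max leqnn orbT.
by apply: exhaustion_sub; rewrite leq_maxl.
Qed.

Definition local_event A := forall w, A w -> exists s, A (restr s w).

Section increasing.
Variables (A : (E -> bool) -> Prop) (A_incr : incr_event A) (A_local : local_event A).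

Let F m : set (configuration E) := [set w | A (restr (exhaustion m) w)].

Let mF m : measurable (F m).
Proof. by have [] := restr_event_prob A (undup_uniq (pmap unpickle (iota 0 m))). Qed.

Let FA : [set w | A w] = \bigcup_m F m :> set (configuration E).
Proof.
apply/seteqP; split => w /=.
  move=> /A_local[s As]; have [m hm] := exhaustion_cover s; exists m => //=.
  by apply: A_incr As; exact: restr_mono.
by move=> [m _ /=]; apply: A_incr; exact: restr_le.
Qed.

Lemma incr_event_measurable : measurable ([set w | A w] : set (configuration E)).
Proof. by rewrite FA; exact: bigcup_measurable. Qed.

Lemma Pr_le_prob s : uniq s -> ((Pr p s A)%:E <= P [set w | A w])%E.
Proof.
move=> us; have [ms <-] := restr_event_prob A us.
apply: le_measure; rewrite ?inE//; first exact: incr_event_measurable.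
by move=> w /=; apply: A_incr; exact: restr_le.
Qed.

(** A local increasing event is the increasing union of its restrictions to the lists
    [exhaustion m]. *)
Lemma prob_le_Pr (c : R) : (forall s, uniq s -> Pr p s A <= c) ->
  (P [set w | A w] <= c%:E)%E.
Proof.
move=> hc; rewrite FA.
have cv : P \o F @ \oo --> P (\bigcup_m F m).
  apply: nondecreasing_cvg_mu => //; first exact: bigcup_measurable.
  move=> m m' mm'; apply/subsetPset => w /=; apply: A_incr.
  by apply: restr_mono; exact: exhaustion_sub.
rewrite -(cvg_lim _ cv)//; apply: lime_le; first by apply/cvg_ex; exists (P (\bigcup_m F m)).
apply: nearW => m /=.
have [_ ->] := restr_event_prob A (undup_uniq (pmap unpickle (iota 0 m))).
by rewrite lee_fin; apply: hc; exact: undup_uniq.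
Qed.

End increasing.

Lemma big_local v n : local_event (fun w => big w v n).
Proof. by move=> w /big_restr. Qed.

Lemma escape_local S o : local_event (escape S o).
Proof. by move=> w [y yS /conn_restr[s oy]]; exists s, y. Qed.

Lemma card_big w v n : (`I_n #<= @open_cluster R G w v)%card <-> big w v n.
Proof.
split=> [h|[t [ut st ht]]].
  have [fin|inf] := pselect (finite_set (@open_cluster R G w v)); last first.
    have [B BA nB] := infinite_set_fset n inf.
    apply: big_leq nB _; exists (finmap.enum_fset B).
    by split => //; exact: finmap.fset_uniq.
  have [m Am] := fin; have nm : (n <= m)%N.
    by rewrite -card_le_II; apply: card_le_trans h _; move: Am; rewrite card_eq_le => /andP[].
  apply: big_leq nm _; exists (finmap.enum_fset (fset_set (@open_cluster R G w v))); split.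
  - exact: finmap.fset_uniq.
  - exact: card_fset_set.
  - by move=> x; rewrite in_fset_set// inE.
apply: (@card_le_trans _ _ _ [set` t]).
  have fin : finite_set [set` t] by exact: finite_seq.
  have [m tm] := fin.
  have nm : (n <= m)%N.
    rewrite -(card_fset_set tm) -st; apply: uniq_leq_size => // x xt.
    by rewrite in_fset_set// inE.
  rewrite -card_le_II in nm; apply: card_le_trans nm _.
  by move: tm; rewrite card_eq_le => /andP[].
by apply: subset_card_le => x /ht.
Qed.

End cylinders.

(** * Absence of infinite clusters and its consequences *)

Section infinite_clusters.
Context {R : realType} {G : weighted_graph R}.
Local Notation V := (vertex G).
Local Notation E := (edge G).
Implicit Types (w : E -> bool) (e : E) (s : seq E) (v o : V).
Variables (p : E -> R) (p01 : prob_vec p).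
Variable P : probability (configuration E) R.
Hypothesis Pp : is_bernoulli_product p P.

Lemma infinite_cluster_big w v n : infinite_set (@open_cluster R G w v) -> big w v n.
Proof.
move=> inf; have [B BA nB] := infinite_set_fset n inf.
apply: big_leq nB _; exists (finmap.enum_fset B).
by split => //; exact: finmap.fset_uniq.
Qed.

Lemma ae_no_infinite_cluster (c : nat -> R) :
  (forall eps, 0 < eps -> exists2 n, (0 < n)%N & c n < eps) ->
  (forall s v n, uniq s -> (0 < n)%N -> Pr p s (fun w => big w v n) <= c n) ->
  {ae P, forall w, ~ @has_infinite_cluster R G w}.
Proof.
move=> c0 hc.
pose N v : set (configuration E) := \bigcap_n [set w | big w v n].
have mb v n : measurable ([set w | big w v n] : set (configuration E)).
  exact: (incr_event_measurable Pp (@big_incr _ _ v n) (@big_local _ _ v n)).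
have mN v : measurable (N v) by exact: bigcap_measurable.
have N0 v : P (N v) = 0%E.
  apply/eqP; rewrite eq_le measure_ge0 andbT; apply/lee_addgt0Pr => eps eps0.
  rewrite add0e; have [n n0 cn] := c0 _ eps0.
  apply: (@le_trans _ _ (P [set w | big w v n])).
    by apply: le_measure; rewrite ?inE// => w /(_ n); exact.
  apply: le_trans (prob_le_Pr Pp (@big_incr _ _ v n) (@big_local _ _ v n)
    (fun s us => hc s v n us n0)) _.
  by rewrite lee_fin ltW.
pose M k : set (configuration E) := if unpickle k is Some v then N v else set0.
have negM : P.-negligible (\bigcup_k M k).
  apply: negligible_bigcup => k; rewrite /M; case: unpickle => [v|].
    by exists (N v); split => //; exact: N0.
  exact: negligible_set0.
apply: negligibleS negM => w /= /contrapT[v inf].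
exists (pickle v) => //; rewrite /M pickleK => n _ /=; exact: infinite_cluster_big.
Qed.

Lemma escape_infinite (o : V) w :
  (forall m, escape (undup (o :: pmap unpickle (iota 0 m))) o w) ->
  infinite_set (@open_cluster R G w o).
Proof.
move=> esc fin; pose T := finmap.enum_fset (fset_set (@open_cluster R G w o)).
pose m := (\max_(v <- T) pickle v).+1.
have [y yT oy] := esc m; move/negP: yT; apply.
rewrite mem_undup inE; apply/orP; right; rewrite mem_pmap; apply/mapP.
exists (pickle y); last by rewrite pickleK.
rewrite mem_iota add0n ltnS; apply: (@leq_bigmax_seq _ T xpredT pickle) => //.
by rewrite in_fset_set// inE.
Qed.

(** Otherwise every finite set is escaped from with probability at least the constant of
    [escape_bound], positive by r > 1. The decreasing limit over finite sets is an infinite cluster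
    of positive probability. *)
Lemma subcritical_phi (k : E -> R) (r : R) (o : V) : (forall e, 0 <= k e) -> 1 < r ->
  (forall e, pexp k r e <= p e) ->
  {ae P, forall w, ~ @has_infinite_cluster R G w} ->
  exists2 S : seq V, o \in S & forall s, uniq s -> phi k 1 s S o <= 1 / 2.
Proof.
move=> k0 r1 kp noinf; apply: contrapT => hS.
have hphi S : uniq S -> o \in S -> exists2 s, uniq s & 1 / 2 < phi k 1 s S o.
  move=> uS oS; apply: contrapT => hs; apply: hS; exists S => // s us.
  by rewrite leNgt; apply/negP => h; apply: hs; exists s.
pose rho := ((r - 1) / 2) / (1 + (r - 1) / 2).
have rho0 : 0 < rho by apply: divr_gt0; lra.
pose L m : seq V := undup (o :: pmap unpickle (iota 0 m)).
pose F m : set (configuration E) := [set w | escape (L m) o w].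
have Lsub m m' : (m <= m')%N -> {subset L m <= L m'}.
  move=> mm' x; rewrite !mem_undup !inE => /orP[->//|].
  rewrite !mem_pmap => /mapP[i im ->]; apply/orP; right; apply: map_f.
  by move: im; rewrite !mem_iota /= !add0n => /leq_trans; apply.
have mF m : measurable (F m).
  exact: (incr_event_measurable Pp (@escape_incr _ _ (L m) o) (@escape_local _ _ (L m) o)).
have kr01 : prob_vec (pexp k r) by apply: pexp_prob => //; lra.
have PF m : (rho%:E <= P (F m))%E.
  have oL : o \in L m by rewrite mem_undup mem_head.
  have [s us hs] := escape_bound k0 r1 oL (undup_uniq _) hphi.
  apply: (@le_trans _ _ (Pr p s (escape (L m) o))%:E).
    rewrite lee_fin; apply: (le_trans hs); apply: Pr_le_p => //; exact: escape_incr.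
  exact: (Pr_le_prob Pp (@escape_incr _ _ (L m) o) (@escape_local _ _ (L m) o) us).
have cv : P \o F @ \oo --> P (\bigcap_m F m).
  apply: nonincreasing_cvg_mu => //.
  - by apply: (le_lt_trans (probability_le1 _ _)) => //; rewrite ltry.
  - exact: bigcap_measurable.
  - move=> m m' mm'; apply/subsetPset => w /= [y yL oy]; exists y => //.
    by apply: contra yL; exact: Lsub.
have PI : (rho%:E <= P (\bigcap_m F m))%E.
  rewrite -(cvg_lim _ cv)//; apply: lime_ge; first by apply/cvg_ex; exists (P (\bigcap_m F m)).
  exact: nearW.
have [N [mN N0 sN]] := noinf.
have IN : \bigcap_m F m `<=` N.
  move=> w hw; apply: sN => /= h; apply: h; exists o; apply: escape_infinite => m.
  exact: hw.
have : (P (\bigcap_m F m) <= P N)%E.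
  by apply: le_measure; rewrite ?inE//; exact: bigcap_measurable.
rewrite [X in (_ <= X)%E]N0 => h; have := le_trans PI h; rewrite lee_fin; lra.
Qed.

End infinite_clusters.

(** * The critical parameter *)

Lemma powR_neg_small (R : realType) (C th eps : R) : 0 <= C -> 0 < th -> 0 < eps ->
  exists2 n, (0 < n)%N & C * n%:R `^ (- th) < eps.
Proof.
move=> C0 th0 eps0; pose y := (C / eps) `^ th^-1.
have y0 : 0 <= y by exact: powR_ge0.
exists (Num.truncn y).+1 => //; set n := _.+1.
have yn : y < n%:R by exact: truncnS_gt.
have n0 : (0 : R) < n%:R by rewrite ltr0n.
have h : C / eps < n%:R `^ th.
  have -> : C / eps = y `^ th.
    by rewrite /y -powRrM mulVf ?gt_eqF// powRr1// divr_ge0// ltW.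
  by apply: gt0_ltr_powR; rewrite ?nnegrE// ltW.
rewrite powRN ltr_pdivrMr ?powR_gt0//.
by rewrite ltr_pdivrMr// mulrC in h.
Qed.

Section critical.
Context {R : realType} {G : weighted_graph R}.
Local Notation V := (vertex G).
Local Notation E := (edge G).
Local Notation J := (@weight R G).
Implicit Types (e : E) (s S : seq E) (v o : V).

(** Transitivity moves any edge to one at [o], where the total weight is finite. *)
Lemma weight_bounded o : @transitive_graph R G -> exists W, forall e, J e <= W.
Proof.
move=> tr.
have W0 : (0 <= \esum_(d in [set d | origin (@ends R G) d = o]) (J d.1)%:E)%E.
  by apply: esum_ge0 => d _; rewrite lee_fin ltW// weight_gt0.
have := @weight_summable R G o; move: W0.
case WE : (\esum_(d in _) _)%E => [W| |] // _ _; exists W => e.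
have [f [g [fg fo]]] := tr (@ends R G e).1 o; have [_ _ gends gw] := fg.
have [b eb] : exists b, origin (@ends R G) (g e, b) = o.
  have [h|h] := gends e; [exists false|exists true]; by rewrite /origin h /= fo.
rewrite -(gw e) -lee_fin -WE; apply: esum_ge; exists [set (g e, b)].
  by split; [exact: finite_set1|move=> _ ->].
by rewrite fsbig_set1.
Qed.

Definition subcritical (beta : R) :=
  0 <= beta /\ {ae percolation G beta, forall w, ~ @has_infinite_cluster R G w}.

Lemma lt_beta_c (beta : R) : (beta%:E < beta_c G)%E ->
  exists2 beta', subcritical beta' & beta < beta'.
Proof.
move=> /ereal_sup_gt[_ [beta' [b0 nb] <-]]; rewrite lte_fin => bb.
by exists beta'.
Qed.

Let weight0 e : 0 <= J e. Proof. by rewrite ltW// weight_gt0. Qed.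

Let prob01 (beta : R) : 0 <= beta -> prob_vec (pexp J beta).
Proof. by move=> b0; exact: pexp_prob. Qed.

Lemma Pr_beta0 s v n : (1 < n)%N -> Pr (pexp J 0) s (fun w => big w v n) = 0.
Proof.
move=> n1; have p0 e : pexp J 0 e = 0 by rewrite /pexp mul0r oppr0 expR0 subrr.
have Ex0 F : Ex (pexp J 0) s F = F (fun=> false).
  elim: s F => [//|e s IH] F /=; rewrite !IH p0 mul0r add0r subr0 mul1r; congr F.
  by apply/funext => x; rewrite /upd; case: eqVneq.
rewrite /Pr Ex0 indF// => -[t [ut st ht]].
have sub : {subset t <= [:: v]}.
  by move=> x /ht/(conn_supp (@supported0 _))[<-|[]]; rewrite ?mem_head.
by have := uniq_leq_size ut sub; rewrite st leqNgt n1.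
Qed.

Lemma beta_c_ge0 : (0 <= beta_c G)%E.
Proof.
apply: ereal_sup_ubound; exists 0 => //; split => //.
apply: (ae_no_infinite_cluster (@percolationP R G 0 (lexx 0)) (c := fun n => (n <= 1)%N%:R)).
  by move=> eps eps0; exists 2%N.
move=> s v [|[|n]] us // _; first by exact: Pr_le1 (prob01 (lexx 0)) s _.
by rewrite Pr_beta0.
Qed.

(** For a fixed finite list the probability is continuous in the parameter; this carries the
    subcritical bound to [beta_c] itself. *)
Lemma Pr_left_limit s v n (b0 b1 c : R) : b0 < b1 ->
  (forall b, b0 <= b -> b < b1 -> Pr (pexp J b) s (fun w => big w v n) <= c) ->
  uniq s -> Pr (pexp J b1) s (fun w => big w v n) <= c.
Proof.
move=> b01 hc us; rewrite leNgt; apply/negP => cf.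
pose f t := Pr (pexp J t) s (fun w => big w v n).
have fd : is_derive b1 (1 : R) f _ := is_derive_Ex J (ind (fun w => big w v n)) b1 us.
have fc : {for b1, continuous f}.
  by apply: differentiable_continuous; apply/derivable1_diffP; have [] := fd.
have nb : nbhs (b1 : R) (fun t : R => c < f t) by exact: (@cvgr_gt _ _ _ _ f _ fc c cf).
have [d /= d0 hd] := (nbhs_ballP _ _).1 nb.
pose t := Num.max b0 (b1 - d / 2).
have tb : t < b1 by rewrite gt_max b01/=; lra.
have : c < f t.
  apply: hd; rewrite /ball/= ltr_norml; apply/andP; split; first by lra.
  have : b1 - d / 2 <= t by rewrite le_max lexx orbT.
  by lra.
by apply/negP; rewrite -leNgt; apply: hc => //; rewrite le_max lexx.
Qed.

End critical.

(** * Finiteness of the critical parameter and the bound up to it *)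

Section main_estimates.
Context {R : realType} {G : weighted_graph R}.
Local Notation V := (vertex G).
Local Notation E := (edge G).
Local Notation J := (@weight R G).
Implicit Types (e : E) (s S : seq E) (v : V).
Hypothesis G_simple : @simple_graph R G.
Hypothesis G_transitive : @transitive_graph R G.
Hypothesis G_unimodular : @unimodular R G.
Variables (o : V) (a c eps0 : R).
Hypotheses (a_gt : 1 / 2 < a) (a_lt : a < 1) (c_gt0 : 0 < c) (eps0_gt0 : 0 < eps0).
Hypothesis G_edges : forall eps : R, 0 < eps -> eps <= eps0 ->
  ((c * eps `^ (- a))%:E <=
     @counting _ R (oriented_edges_from o `&` [set d | (eps <= J d.1)%R]))%E.

Let th := (2 * a - 1) / (a + 1).

Let th0 : 0 < th. Proof. by rewrite divr_gt0//; move: a_gt; lra. Qed.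

Let weight0 e : 0 <= J e. Proof. by rewrite ltW// weight_gt0. Qed.

(** The gap r > 1 between [k] and a parameter without infinite clusters yields a finite mean; its
    size does not influence [C]. *)
Lemma subcritical_power_law K sl : 0 < sl -> exists2 C : R, 0 <= C &
  forall k beta r, dominating eps0 K sl k -> @subcritical R G beta -> 1 < r ->
  (forall e, r * k e <= beta * J e) ->
  forall s v n, uniq s -> (0 < n)%N ->
  Pr (pexp k 1) s (fun w => big w v n) <= C * n%:R `^ (- th).
Proof.
move=> sl0; have [C C0 hC] := power_law G_simple G_transitive G_unimodular K
  a_gt a_lt c_gt0 eps0_gt0 sl0 G_edges.
exists C => // k beta r kdom [b0 noinf] r1 kb.
have [k0 kinv _ _] := kdom.
have [S oS hS] := subcritical_phi (pexp_prob b0 weight0) (@percolationP R G _ b0) o k0 r1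
  (fun e => pexp_le (kb e)) noinf.
exact: hC kdom _ (susceptibility_bound G_transitive k0 kinv oS hS).
Qed.

Lemma beta_c_finite : (beta_c G < +oo)%E.
Proof.
rewrite ltNge leye_eq; apply/negP => /eqP bc.
(* Valid for min(beta J, 1) with any beta >= 1: beta J is at least J, and 1 is at least eps / eps0.
   So [C] is fixed before beta is chosen. *)
pose sl := Num.min 1 eps0^-1.
have sl0 : 0 < sl by rewrite lt_min ltr01/= invr_gt0.
have [C C0 hC] := subcritical_power_law 1 sl0.
have [m m0 hm] := powR_neg_small C0 th0 (eps := 1 / 4) ltac:(lra).
(* Chosen so that c y^(-a) = 8 m + 2; by [star_exists] there are then at least 4 m heavy edges at
   [o]. *)
pose y := (c / (8 * m + 2)%:R) `^ a^-1.
have m82 : (0 : R) < (8 * m + 2)%:R by rewrite ltr0n addn2.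
have y0 : 0 < y by rewrite powR_gt0// divr_gt0.
pose eps := Num.min eps0 (Num.min 1 y).
have eps_gt0 : 0 < eps by rewrite !lt_min eps0_gt0 ltr01.
have eps_le0 : eps <= eps0 by rewrite ge_min lexx.
have eps_le1 : eps <= 1 by rewrite !ge_min lexx orbT.
have eps_ley : eps <= y by rewrite !ge_min lexx !orbT.
have [S [uS SE hS]] := star_exists o G_simple eps_gt0.
have a0 : 0 < a by move: a_gt; lra.
have hN : (4 * m <= size S)%N.
  have := le_trans (G_edges eps_gt0 eps_le0) hS; rewrite lee_fin.
  have h1 : (8 * m + 2)%:R / c <= eps `^ (- a).
    have -> : (8 * m + 2)%:R / c = y `^ (- a).
      rewrite /y -powRrM.
      have -> : a^-1 * - a = -1 by field; rewrite gt_eqF.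
      by rewrite powR_inv1 ?invf_div// divr_ge0// ltW.
    by apply: ler_powR_exp_neg => //; exact: ltW.
  move=> h2; have := le_trans (ler_wpM2l (ltW c_gt0) h1) h2.
  have -> : c * ((8 * m + 2)%:R / c) = (8 * m + 2)%:R by field; rewrite gt_eqF.
  have -> : 2 * (size S)%:R + 2 = (2 * size S + 2)%:R :> R by rewrite natrD natrM.
  by rewrite ler_nat; move: (size S) => N; clear; lia.
(* Every heavy edge then has truncated weight exactly 1, hence is open with probability 1 - 1/e >=
   1/2. *)
pose beta := eps^-1; have beta0 : 0 < beta by rewrite invr_gt0.
have beta1 : 1 <= beta by rewrite invf_ge1.
pose k e := Num.min (beta * J e) 1.
have kdom : dominating eps0 1 sl k.
  split=> [e|f g [_ _ _ gw] e|e|eps' e e'0 e'le e'w].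
  - by rewrite le_min ler01 mulr_ge0// ltW.
  - by rewrite /k gw.
  - by rewrite ge_min lexx orbT.
  rewrite le_min; apply/andP; split.
    apply: (@le_trans _ _ (1 * eps')).
      by apply: ler_wpM2r; [exact: ltW|rewrite ge_min lexx].
    by apply: ler_pM => //; exact: ltW.
  apply: (@le_trans _ _ (eps0^-1 * eps0)); last by rewrite mulVf// gt_eqF.
  by apply: ler_pM => //; [exact: ltW|exact: ltW|rewrite ge_min lexx orbT].
have [|beta' sub' bb'] := @lt_beta_c R G (2 * beta); first by rewrite bc ltry.
have kb e : 2 * k e <= beta' * J e.
  apply: (@le_trans _ _ (2 * (beta * J e))).
    by apply: ler_wpM2l => //; rewrite ge_min lexx.
  by rewrite mulrA; apply: ler_wpM2r => //; exact: ltW.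
have r2 : 1 < 2 :> R by lra.
have hP := hC k beta' 2 kdom sub' r2 kb S o m uS m0.
have k0 e : 0 <= k e by case: kdom.
have p01 : prob_vec (pexp k 1) by exact: pexp_prob.
pose N := size S.
have N0 : (0 : R) < N%:R by rewrite ltr0n; apply: leq_trans hN; rewrite muln_gt0.
have EX : Ex (pexp k 1) S (fun w => (count w S)%:R) <=
    m%:R + N%:R * Pr (pexp k 1) S (fun w => big w o m).
  rewrite -{1}[m%:R](Ex_cst (pexp k 1) S) /Pr -ExZ -ExD; apply: Ex_le => // w.
  have [b|nb] := pselect (big w o m).
    rewrite indT// mulr1; apply: (@le_trans _ _ N%:R); last by rewrite lerDr.
    by rewrite ler_nat count_size.
  rewrite indF// mulr0 addr0 ler_nat leqNgt; apply/negP => mw; apply: nb.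
  apply: big_leq (ltnW mw) _; exists [seq other e o | e <- S & w e]; split.
  - rewrite map_inj_in_uniq ?filter_uniq// => e e'.
    rewrite !mem_filter => /andP[_ eS] /andP[_ e'S].
    by apply: (other_inj G_simple) eS e'S => z; rewrite SE => /andP[].
  - by rewrite size_map size_filter.
  - move=> _ /mapP[e + ->]; rewrite mem_filter => /andP[we].
    by rewrite SE => /andP[_ eo]; apply: (conn_edge we); exact: incident_other.
have EX2 : N%:R / 2 <= Ex (pexp k 1) S (fun w => (count w S)%:R).
  have -> : Ex (pexp k 1) S (fun w => (count w S)%:R) = \sum_(e <- S) pexp k 1 e.
    transitivity (Ex (pexp k 1) S (fun w => \sum_(e <- S) (w e)%:R)).
      by apply: Ex_ext => w; rewrite -sum1_count natr_sum big_mkcond; apply: eq_bigr => e _; case: (w e).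
    rewrite Ex_sum big_seq [RHS]big_seq; apply: eq_bigr => e eS.
    rewrite (Ex_upd _ _ uS eS).
    under Ex_ext do rewrite updE; under [X in _ + _ * X]Ex_ext do rewrite updE.
    by rewrite !Ex_cst mulr1 mulr0 addr0.
  rewrite -[N%:R / 2]/(N%:R * 2^-1) mulr_natl.
  have -> : 2^-1 *+ N = \sum_(e <- S) 2^-1 :> R.
    by rewrite big_const_seq iter_addr_0 count_predT.
  rewrite big_seq [leRHS]big_seq; apply: ler_sum => e; rewrite SE => /andP[/andP[we _] _].
  have -> : pexp k 1 e = 1 - expR (-1).
    have ke : k e = 1.
      by apply/min_idPr; rewrite /beta mulrC ler_pdivlMr// mul1r.
    by rewrite /pexp mul1r ke.
  have e2 : 2 <= expR 1 :> R by have := expR_ge1Dx (1 : R); lra.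
  have : expR (-1) <= 2^-1 :> R.
    by rewrite expRN lef_pV2 ?posrE// expR_gt0.
  lra.
have h3 : N%:R * Pr (pexp k 1) S (fun w => big w o m) <= N%:R * (1 / 4).
  by apply: ler_wpM2l; [exact: ltW|exact: le_trans hP (ltW hm)].
have h4 : 4 * m%:R <= N%:R :> R by rewrite -natrM ler_nat.
have hlt : Pr (pexp k 1) S (fun w => big w o m) < 1 / 4 by exact: le_lt_trans hP hm.
have h5 : N%:R * Pr (pexp k 1) S (fun w => big w o m) < N%:R * (1 / 4) by rewrite ltr_pM2l.
(* The expected number of open edges in [S] is at least N/2, but less than m + N/4 <= N/2. *)
move: (le_trans EX2 EX) h5 h4; lra.
Qed.

Lemma critical_power_law : exists2 C : R, 0 <= C & forall beta s v n,
  0 <= beta -> (beta%:E <= beta_c G)%E -> uniq s -> (0 < n)%N ->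
  Pr (pexp J beta) s (fun w => big w v n) <= C * n%:R `^ (- th).
Proof.
have := beta_c_ge0 (G := G); have := beta_c_finite.
case bcE : (beta_c G) => [bc| |] // _; rewrite lee_fin le_eqVlt => /orP[/eqP bc0|bc0].
  exists 1 => // beta s v n b0; rewrite -bc0 lee_fin => b1 us n0.
  have -> : beta = 0 by apply/eqP; rewrite eq_le b0 b1.
  case: n n0 => [|[|n]] // _; last by rewrite Pr_beta0// mul1r powR_ge0.
  by rewrite powR1 mul1r; apply: Pr_le1; exact: pexp_prob.
have [W hW] := weight_bounded o G_transitive.
(* Uniform weight bounds need beta away from 0: the estimate is proved on the upper half of the
   interval, and monotonicity gives the lower half. *)
have sl0 : 0 < bc / 2 by rewrite divr_gt0.
have [C C0 hC] := subcritical_power_law (bc * W) sl0.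
have sub beta s v n : bc / 2 <= beta -> beta < bc -> uniq s -> (0 < n)%N ->
    Pr (pexp J beta) s (fun w => big w v n) <= C * n%:R `^ (- th).
  move=> b1 b2 us n0; have b0 : 0 < beta by apply: lt_le_trans b1.
  have [|beta' [b'0 noinf] bb'] := @lt_beta_c R G beta; first by rewrite bcE lte_fin.
  pose k e := beta * J e.
  have -> : pexp J beta = pexp k 1.
    by apply/funext => e; rewrite /pexp /k mul1r.
  apply: (hC k beta' (beta' / beta)) => //.
  - split=> [e|f g [_ _ _ gw] e|e|eps' e e'0 _ e'w].
    + by rewrite mulr_ge0// ltW.
    + by rewrite /k gw.
    + apply: (@le_trans _ _ (bc * J e)).
        by apply: ler_wpM2r => //; exact: ltW.
      by apply: ler_wpM2l => //; exact: ltW.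
    + by apply: ler_pM => //; exact: ltW.
  - by rewrite ltr_pdivlMr// mul1r.
  - by move=> e; rewrite /k mulrA divfK// gt_eqF.
exists C => // beta s v n b0; rewrite lee_fin => bb us n0.
have [b1|b1] := leP (bc / 2) beta; last first.
  apply: le_trans (sub (bc / 2) s v n _ _ us n0); [|by []|lra].
  apply: Pr_le_p; [exact: pexp_prob|apply: pexp_prob => //; lra| |exact: big_incr].
  by move=> e; apply: pexp_le; apply: ler_wpM2r => //; exact: ltW.
move: bb; rewrite le_eqVlt => /orP[/eqP ->|bb]; last exact: sub.
by apply: (@Pr_left_limit _ _ s v n (bc / 2) bc) => // [|b hb1 hb2]; [lra|exact: sub].
Qed.

End main_estimates.

Theorem theorem1p2 (R : realType) (G : weighted_graph R)
  (G_infinite : infinite_set [set: vertex G])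
  (G_simple : simple_graph G)
  (G_transitive : transitive_graph G)
  (G_unimodular : unimodular G)
  (o : vertex G)
  (a c eps0 : R)
  (a_gt : 1 / 2 < a) (a_lt : a < 1) (c_gt0 : 0 < c) (eps0_gt0 : 0 < eps0)
  (G_edges : forall eps : R, 0 < eps -> eps <= eps0 ->
    ((c * eps `^ (- a))%:E <=
       counting (oriented_edges_from o `&` [set d | (eps <= weight d.1)%R]))%E) :
  [/\ (beta_c G < +oo)%E,
      exists C : R, forall (beta : R) (n : nat),
        0 <= beta -> (beta%:E <= beta_c G)%E -> (1 <= n)%N ->
        (percolation G beta [set w | (`I_n #<= open_cluster w o)%card] <=
           (C * n%:R `^ (- ((2 * a - 1) / (a + 1))))%:E)%E &
      {ae percolation G (fine (beta_c G)),
        forall w, ~ has_infinite_cluster w}].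
Proof.
have bc_fin := beta_c_finite G_simple G_transitive G_unimodular a_gt a_lt c_gt0 eps0_gt0 G_edges.
have bc_ge0 := beta_c_ge0 (G := G).
have [C C0 hC] :=
  critical_power_law G_simple G_transitive G_unimodular a_gt a_lt c_gt0 eps0_gt0 G_edges.
split=> //.
  exists C => beta n b0 bb n1.
  have -> : [set w | (`I_n #<= open_cluster w o)%card] =
      [set w | big w o n] :> set (configuration (edge G)).
    by apply/seteqP; split=> w /=; rewrite card_big.
  apply: (prob_le_Pr (@percolationP R G _ b0)) => [||s us].
  - exact: big_incr.
  - exact: big_local.
  - exact: hC.
have bc_real : (fine (beta_c G))%:E = beta_c G.
  by rewrite fineK// ge0_fin_numE.
have bc0 : 0 <= fine (beta_c G) by rewrite fine_ge0.
apply: (ae_no_infinite_cluster (@percolationP R G _ bc0)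
  (c := fun n => C * n%:R `^ (- ((2 * a - 1) / (a + 1))))) => [eps eps_gt0|s v n us n0].
  apply: powR_neg_small => //; apply: divr_gt0; lra.
by apply: hC; rewrite // bc_real.
Qed.
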